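(* Let $M$ be a manifold modelled on separable Banach spaces and let $h\colon TM\to M$ be a tame algebra over the tangent functor monad. Then the accessible sets $L_x=h(T_xM)$, $x\in M$, are the leaves of a foliation of $M$ (in the singular sense) whose tangent distribution is the distribution $\mathcal D$ induced by $h$, i.e. $T_yL_x=\mathcal D_y$ for all $y\in L_x$. In particular, $\mathcal D$ is integrable.
   Context: Manifolds are smooth paracompact Hausdorff manifolds modelled on real or complex (separable) Banach spaces. An algebra over the tangent functor monad on $M$ is a smooth map $h\colon TM\to M$ with $h(x,0)=x$ for all $x\in M$ and $h\circ Th=h\circ\mu_M$, where $\mu_M\colon T^2M\to TM$, $\mu_M(\xi)=\tau_{TM}(\xi)+T\tau_M(\xi)$ with $\tau$ the tangent bundle projection; in charts, $h\big(h(x,v),h'(x,v)(\dot x,\dot v)\big)=h(x,v+\dot x)$. For $x\in M$ put $h_x=h|_{T_xM}\colon T_xM\to M$, $A_x=h_x'(0)\in\mathcal L(T_xM)$ and $\mathcal D_x=\operatorname{im}A_x\subseteq T_xM$; $\mathcal D$ is the distribution induced by $h$. The algebra $h$ is tame if for every $x\in M$ the map $h_x$ is a subimmersion at the origin, i.e. on a neighbourhood of $0\in T_xM$ it factors as a submersion followed by an immersion. An initial submanifold of $M$ is a smooth injection $i\colon S\to M$ of manifolds such that any set map $f\colon L\to S$ from a manifold $L$ with $i\circ f$ smooth is itself smooth (it is then an immersion). A (singular, or Štefan) foliation of $M$ is a partition of $M$ into connected initial submanifolds, called leaves, such that for every $x\in M$ there is a chart $(U,\phi)$ of $M$ at $x$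 with $\phi(U)=V\times W$, where $V$ (resp. $W$) is a neighbourhood of $0$ in a Banach space $E$ (resp. $F$), $E$ being isomorphic to the tangent space at $x$ of the leaf through $x$, $\phi(x)=(0,0)$, and for every leaf $S$, $\phi(U\cap S)=V\times B$ for some $B\subseteq W$. Leaves may have different dimensions. The tangent distribution of a foliation assigns to each point the tangent space at that point of the leaf through it; a distribution is integrable if it is the tangent distribution of a foliation. *)

(* Defs.v *)
From HB Require Import structures.
From mathcomp Require Import all_boot all_order all_algebra.
From mathcomp Require Import all_classical all_reals all_analysis.
From mathcomp.real_closed Require Import complex.

Set Implicit Arguments.
Unset Strict Implicit.
Unset Printing Implicit Defensive.

Import Order.TTheory GRing.Theory Num.Theory.
Import numFieldNormedType.Exports.

Local Open Scope classical_set_scope.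
Local Open Scope ring_scope.

Variant real_or_complex : numFieldType -> Prop :=
  | scalars_real (R : realType) : real_or_complex R
  | scalars_complex (R : realType) : real_or_complex (complex R).

Section Topology.
Context (T : topologicalType).

Definition separable := exists2 S : set T, countable S & dense S.

Definition locally_finite (C : set (set T)) :=
  forall x : T,
    exists2 N, nbhs x N & finite_set [set A | C A /\ A `&` N !=set0].

Definition open_cover (C : set (set T)) :=
  (forall A, C A -> open A) /\ \bigcup_(A in C) A = [set: T].

Definition paracompact :=
  forall C : set (set T), open_cover C ->
  exists D : set (set T), [/\ open_cover D, locally_finite D &
    forall B, D B -> exists2 A, C A & B `<=` A].

End Topology.

Section ProductComplete.
Context {U V : completeType}.
HB.instance Definition _ := Pointed.on (U * V)%type.

Lemma prod_cauchy_cvg (G : set_system (U * V)) :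
  ProperFilter G -> cauchy G -> cvg G.
Proof.
move=> PG Gc.
have c1 : cauchy (fst @ G).
  move=> A /= entA.
  have := Gc [set p | A (p.1.1, p.2.1) /\ setT (p.1.2, p.2.2)].
  case; first exact: prod_entP entA entourageT.
  move=> [P Q] /= [GP GQ] PQ.
  exists ([set x | exists2 p, P p & p.1 = x], [set x | exists2 p, Q p & p.1 = x]).
    by split; [apply: filterS GP|apply: filterS GQ] => p ?; exists p.
  by move=> [a b] /= [[p Pp <-] [q Qq <-]]; case: (PQ (p, q)).
have c2 : cauchy (snd @ G).
  move=> A /= entA.
  have := Gc [set p | setT (p.1.1, p.2.1) /\ A (p.1.2, p.2.2)].
  case; first exact: prod_entP entourageT entA.
  move=> [P Q] /= [GP GQ] PQ.
  exists ([set x | exists2 p, P p & p.2 = x], [set x | exists2 p, Q p & p.2 = x]).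
    by split; [apply: filterS GP|apply: filterS GQ] => p ?; exists p.
  by move=> [a b] /= [[p Pp <-] [q Qq <-]]; case: (PQ (p, q)).
have /cvg_ex[l1 cl1] : cvg (fst @ G) by exact: cauchy_cvg c1.
have /cvg_ex[l2 cl2] : cvg (snd @ G) by exact: cauchy_cvg c2.
apply/cvg_ex; exists (l1, l2).
apply: cvg_trans (cvg_pair cl1 cl2) => A; rewrite /nbhs /= => GA.
by apply: filterS GA => -[].
Qed.

HB.instance Definition _ := Uniform_isComplete.Build (U * V)%type prod_cauchy_cvg.
End ProductComplete.

HB.instance Definition _ (K : numFieldType) (E F : completeNormedModType K) :=
  Complete.on (E * F)%type.

Section Smooth.
Context {K : numFieldType}.

Definition tmap (E F : normedModType K) (f : E -> F) (p : E * E) : F * F :=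
  (f p.1, 'd f (p.1) (p.2)).

(* [Ck n U f]: [f] is Frechet differentiable on the open set [U] and its
   tangent map is [Ck (n - 1)] on [U * E].  For fixed [n] this sits between the
   classical C^n and C^(n-1), so the intersection over [n] is the usual class
   of infinitely Frechet differentiable maps (holomorphic ones if [K] is the
   field of complex numbers).  [f] is a total function, but only its values on
   [U] matter. *)
Fixpoint Ck (n : nat) (E F : normedModType K) (U : set E) (f : E -> F) : Prop :=
  match n with
  | 0 => forall x, U x -> {for x, continuous f}
  | n'.+1 => (forall x, U x -> differentiable f x) /\
             @Ck n' (E * E)%type (F * F)%type (U `*` setT) (tmap f)
  end.

Definition smooth_on (E F : normedModType K) (U : set E) (f : E -> F) :=
  forall n, Ck n U f.

Definition toplinear_iso (E F : normedModType K) :=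
  exists (f : {linear E -> F}) (g : {linear F -> E}),
    [/\ continuous f, continuous g, cancel f g & cancel g f].

Lemma near_eq_diff (E F : normedModType K) (f g : E -> F) (x : E) :
  {near x, f =1 g} -> differentiable f x ->
  differentiable g x /\ 'd g x = 'd f x :> (E -> F).
Proof.
move=> fg df; have fgx : f x = g x := nbhs_singleton fg.
have cdf := diff_continuous df.
have /diff_locallyP[_ /eqaddoP ef] := df.
have eg : g \o shift x = cst (g x) + 'd f x +o_ 0 id.
  apply/eqaddoP => e e0; have := ef e e0.
  have fg0 : \forall h \near 0, f (h + x) = g (h + x).
    have /nbhs0P : \forall z \near x, f z = g z by [].
    by apply: filterS => h; rewrite addrC.
  by apply: filterS2 fg0 => h /=; rewrite !fctE /= fgx => ->.
have d1 := diff_unique cdf eg.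
split=> //; apply/diff_locallyP; split; first by rewrite d1.
by rewrite eg d1.
Qed.

Lemma open_nbhs_eq (E : topologicalType) (T : Type) (U : set E) (f g : E -> T)
    x : open U -> (forall y, U y -> f y = g y) -> U x -> {near x, f =1 g}.
Proof.
by move=> oU fg Ux; apply: filterS fg _; apply: open_nbhs_nbhs.
Qed.

Lemma open_setX (S T : topologicalType) (A : set S) (B : set T) :
  open A -> open B -> open (A `*` B).
Proof.
move=> oA oB; rewrite openE => -[a b] [/= Aa Bb].
by exists (A, B) => //=; split; apply: open_nbhs_nbhs.
Qed.

Lemma Ck_ext n (E F : normedModType K) (U : set E) (f g : E -> F) :
  open U -> (forall x, U x -> f x = g x) -> Ck n U f -> Ck n U g.
Proof.
elim: n E F U f g => [|n IH] E F U f g oU fg /=.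
  move=> cf x Ux; have fgx := open_nbhs_eq oU fg Ux.
  rewrite /prop_for /continuous_at -(fg _ Ux); apply: cvg_trans (cf x Ux).
  by apply: near_eq_cvg.
move=> [df Cf]; split=> [x Ux|].
  by case: (near_eq_diff (open_nbhs_eq oU fg Ux) (df x Ux)).
apply: IH Cf; first by apply: open_setX => //; exact: openT.
move=> [x v] [/= Ux _]; rewrite /tmap /= (fg _ Ux).
by case: (near_eq_diff (open_nbhs_eq oU fg Ux) (df x Ux)) => _ ->.
Qed.

Lemma smooth_on_ext (E F : normedModType K) (U : set E) (f g : E -> F) :
  open U -> (forall x, U x -> f x = g x) -> smooth_on U f -> smooth_on U g.
Proof. by move=> oU fg sf n; apply: Ck_ext (sf n). Qed.

Lemma smooth_on_diff (E F : normedModType K) (U : set E) (f : E -> F) x :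
  smooth_on U f -> U x -> differentiable f x.
Proof. by move=> /(_ 1%N) [+ _]; exact. Qed.

Lemma smooth_on_tmap (E F : normedModType K) (U : set E) (f : E -> F) :
  smooth_on U f -> smooth_on (U `*` setT) (tmap f).
Proof. by move=> sf n; case: (sf n.+1). Qed.

Lemma Ck_id n (E : normedModType K) (U : set E) : open U -> Ck n U id.
Proof.
elim: n E U => [|n IH] E U oU /=; first by move=> x _; exact: cvg_id.
split=> [x _|]; first by [].
apply: (@Ck_ext _ _ _ _ id); [| |apply: IH].
- by apply: open_setX => //; exact: openT.
- by move=> [x v] _; rewrite /tmap /= diff_val.
- by apply: open_setX => //; exact: openT.
Qed.

End Smooth.

Section Charts.
Context {K : numFieldType}.

(* A bijection from [dom] onto the open set [cod], given by two mutually
   inverse total functions with irrelevant values off [dom] and [cod]. *)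
Record chart (E : normedModType K) (T : Type) := Chart {
  dom : set T;
  cod : set E;
  fwd : T -> E;
  bwd : E -> T;
  cod_open : open cod;
  fwd_cod : forall x, dom x -> cod (fwd x);
  bwd_dom : forall y, cod y -> dom (bwd y);
  fwdK : forall x, dom x -> bwd (fwd x) = x;
  bwdK : forall y, cod y -> fwd (bwd y) = y }.

Definition smooth_transition (E F : normedModType K) (T : Type)
    (c : chart E T) (d : chart F T) :=
  let U := cod c `&` bwd c @^-1` dom d in
  open U /\ smooth_on U (fwd d \o bwd c).

(* A set with a smooth Banach atlas; [chart_at] merely selects, once and for
   all, a chart of the atlas around each point. *)
Record atlas := Atlas {
  carrier :> Type;
  index : Type;
  model : index -> completeNormedModType K;
  chart_of : forall i, chart (model i) carrier;
  chart_at : carrier -> index;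
  chart_at_dom : forall x, dom (chart_of (chart_at x)) x;
  atlas_compat : forall i j, smooth_transition (chart_of i) (chart_of j) }.

HB.instance Definition _ (M : atlas) := gen_eqMixin (carrier M).
HB.instance Definition _ (M : atlas) := gen_choiceMixin (carrier M).

Definition atlas_open (M : atlas) (O : set M) :=
  forall i : index M, open (cod (chart_of i) `&` bwd (chart_of i) @^-1` O).

Lemma atlas_openT (M : atlas) : atlas_open [set: M].
Proof. by move=> i; rewrite preimage_setT setIT; exact: cod_open. Qed.

Lemma atlas_openI (M : atlas) : setI_closed (@atlas_open M).
Proof.
by move=> A B oA oB i; rewrite preimage_setI setIIr; exact: openI.
Qed.

Lemma atlas_open_bigU (M : atlas) (I : Type) (f : I -> set M) :
  (forall i, atlas_open (f i)) -> atlas_open (\bigcup_i f i).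
Proof.
move=> of_ i; rewrite preimage_bigcup setI_bigcupr.
by apply: bigcup_open => j _; exact: of_.
Qed.

HB.instance Definition _ (M : atlas) :=
  isOpenTopological.Build (carrier M)
    (@atlas_openT M) (@atlas_openI M) (@atlas_open_bigU M).

Lemma open_atlasE (M : atlas) (O : set M) : open O = atlas_open O.
Proof. by []. Qed.

Record manifold := Manifold {
  manifold_atlas :> atlas;
  manifold_hausdorff : hausdorff_space (carrier manifold_atlas);
  manifold_paracompact : paracompact (carrier manifold_atlas) }.

Definition modelled_on_separable (M : atlas) :=
  forall i : index M, separable (model i).

Definition atlas_chart (M : atlas) (E : normedModType K) (c : chart E M) :=
  forall i : index M, smooth_transition c (chart_of i) /\
                        smooth_transition (chart_of i) c.

Definition smooth_map_on (M N : atlas) (O : set M) (f : M -> N) :=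
  (forall x, O x -> {for x, continuous f}) /\
  forall (i : index M) (j : index N), smooth_on
    (cod (chart_of i) `&`
       bwd (chart_of i) @^-1` (O `&` f @^-1` dom (chart_of j)))
    (fwd (chart_of j) \o f \o bwd (chart_of i)).

Definition smooth_map (M N : atlas) (f : M -> N) := smooth_map_on setT f.

Definition full_chart (E : normedModType K) : chart E E :=
  @Chart E E setT setT id id openT (fun _ => id) (fun _ => id)
    (fun _ _ => erefl) (fun _ _ => erefl).

Lemma full_chart_transition (E : normedModType K) :
  smooth_transition (full_chart E) (full_chart E).
Proof.
rewrite /smooth_transition /=; have oT : open ([set: E] `&` id @^-1` [set: E]).
  by rewrite preimage_setT setIT; exact: openT.
by split=> // n; exact: Ck_id.
Qed.

Definition banach_atlas (E : completeNormedModType K) : atlas :=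
  @Atlas E unit (fun=> E) (fun=> full_chart E) (fun=> tt) (fun=> I)
    (fun _ _ => full_chart_transition E).

End Charts.

Arguments atlas : clear implicits.
Arguments manifold : clear implicits.

Section Tangent.
Context {K : numFieldType} (M : atlas K).

(* The tangent space at [x] read in the preferred chart at [x]; the coordinate
   change to another chart is the derivative of the transition map. *)
Definition tangent_space (x : M) : completeNormedModType K :=
  model (chart_at x).

Definition tangent_carrier := {x : M & tangent_space x}.

Definition tangent_coord (i : index M) (x : M) (v : tangent_space x) :
    model i :=
  'd (fwd (chart_of i) \o bwd (chart_of (chart_at x)))
     (fwd (chart_of (chart_at x)) x) v.

Definition tangent_vector (i : index M) (y : model i) (w : model i) :
    tangent_space (bwd (chart_of i) y) :=
  'd (fwd (chart_of (chart_at (bwd (chart_of i) y))) \o bwd (chart_of i)) y w.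

Lemma transition_chain (i j k : index M) (x : M) :
  dom (chart_of i) x -> dom (chart_of j) x -> dom (chart_of k) x ->
  forall v,
  'd (fwd (chart_of k) \o bwd (chart_of j)) (fwd (chart_of j) x)
    ('d (fwd (chart_of j) \o bwd (chart_of i)) (fwd (chart_of i) x) v) =
  'd (fwd (chart_of k) \o bwd (chart_of i)) (fwd (chart_of i) x) v.
Proof.
move=> xi xj xk v.
have [oij sij] := atlas_compat i j; have [ojk sjk] := atlas_compat j k.
have Uij : (cod (chart_of i) `&` bwd (chart_of i) @^-1` dom (chart_of j))
    (fwd (chart_of i) x).
  by split; [exact: fwd_cod|rewrite /= fwdK].
have Ujk : (cod (chart_of j) `&` bwd (chart_of j) @^-1` dom (chart_of k))
    (fwd (chart_of j) x).
  by split; [exact: fwd_cod|rewrite /= fwdK].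
have dij := smooth_on_diff sij Uij.
have xE : (fwd (chart_of j) \o bwd (chart_of i)) (fwd (chart_of i) x) =
          fwd (chart_of j) x by rewrite /= fwdK.
have djk := smooth_on_diff sjk Ujk.
rewrite -xE in djk *; rewrite -[LHS](congr1 (@^~ v) (diff_comp dij djk)).
have dc := differentiable_comp dij djk.
set g := (X in 'd X _ _ = _); set f := (X in _ = 'd X _ _).
suff fg : {near fwd (chart_of i) x, g =1 f}.
  by have [_ ->] := near_eq_diff fg dc.
apply: open_nbhs_eq oij _ Uij => y [_ /= yj].
by rewrite /g /f /= fwdK.
Qed.

Lemma transition_id (i : index M) (x : M) : dom (chart_of i) x ->
  forall v, 'd (fwd (chart_of i) \o bwd (chart_of i)) (fwd (chart_of i) x) v = v.
Proof.
move=> xi v; have := @near_eq_diff K (model i) (model i) id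
  (fwd (chart_of i) \o bwd (chart_of i)) (fwd (chart_of i) x).
case=> [||_ ->]; last by rewrite diff_val.
- apply: open_nbhs_eq (cod_open (chart_of i)) _ (fwd_cod xi) => y cy.
  by rewrite /= bwdK.
- by [].
Qed.

Section TangentChart.
Variable i : index M.

Definition tangent_fwd (p : tangent_carrier) : model i * model i :=
  (fwd (chart_of i) (projT1 p), tangent_coord i (projT2 p)).

Definition tangent_bwd (q : model i * model i) : tangent_carrier :=
  existT _ (bwd (chart_of i) q.1) (tangent_vector q.1 q.2).

Lemma tangent_cod_open : open (cod (chart_of i) `*` [set: model i]).
Proof. by apply: open_setX; [exact: cod_open|exact: openT]. Qed.

Lemma tangent_fwdK p : dom (chart_of i) (projT1 p) ->
  tangent_bwd (tangent_fwd p) = p.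
Proof.
case: p => x v /= xi; rewrite /tangent_bwd /tangent_fwd /=.
rewrite /tangent_vector fwdK // /tangent_coord transition_chain //;
  try exact: chart_at_dom.
by rewrite transition_id //; exact: chart_at_dom.
Qed.

Lemma tangent_bwdK q : cod (chart_of i) q.1 -> tangent_fwd (tangent_bwd q) = q.
Proof.
case: q => y w /= yi; rewrite /tangent_fwd /= bwdK //; congr (_, _).
rewrite /tangent_coord /tangent_vector.
have xi := bwd_dom yi.
have := transition_chain xi (chart_at_dom _) xi w; rewrite (bwdK yi) => ->.
by have := transition_id xi w; rewrite (bwdK yi).
Qed.

Definition tangent_chart : chart (model i * model i)%type tangent_carrier :=
  @Chart K (model i * model i)%type tangent_carrier
    [set p | dom (chart_of i) (projT1 p)] (cod (chart_of i) `*` setT)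
    tangent_fwd tangent_bwd tangent_cod_open
    (fun p xp => conj (fwd_cod xp) I) (fun q yq => bwd_dom yq.1)
    tangent_fwdK (fun q yq => tangent_bwdK yq.1).

End TangentChart.

Lemma tangent_transition (i j : index M) :
  smooth_transition (tangent_chart i) (tangent_chart j).
Proof.
have [oij sij] := atlas_compat i j.
pose U := cod (chart_of i) `&` bwd (chart_of i) @^-1` dom (chart_of j).
have UE : cod (tangent_chart i) `&`
    bwd (tangent_chart i) @^-1` dom (tangent_chart j) = U `*` setT.
  by apply/seteqP; split=> [[y w] [[/= ? _] ?]|[y w] [[/= ? ?] _]].
rewrite /smooth_transition UE.
have oU : open (U `*` [set: model i]) by apply: open_setX => //; exact: openT.
split=> //; apply: smooth_on_ext oU _ (smooth_on_tmap sij).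
move=> [y w] [[/= yi yj] _]; rewrite /tangent_fwd /tmap /=; congr (_, _).
have := transition_chain (bwd_dom yi) (chart_at_dom _) yj w.
by rewrite (bwdK yi).
Qed.

Definition tangent_bundle : atlas K :=
  @Atlas K tangent_carrier (index M) (fun i => (model i * model i)%type)
    tangent_chart (fun p => chart_at (projT1 p)) (fun p => chart_at_dom _)
    tangent_transition.

Definition tangent_pt (x : M) (v : tangent_space x) : tangent_bundle :=
  existT _ x v.

Definition tangent_proj (p : tangent_bundle) : M := projT1 p.

End Tangent.

Section TangentMap.
Context {K : numFieldType}.

Definition tangent_at (M N : atlas K) (f : M -> N) (x : M) :
    {linear tangent_space x -> tangent_space (f x)} :=
  'd (fwd (chart_of (chart_at (f x))) \o f \o bwd (chart_of (chart_at x)))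
     (fwd (chart_of (chart_at x)) x).

Definition tangent_map (M N : atlas K) (f : M -> N)
    (p : tangent_bundle M) : tangent_bundle N :=
  tangent_pt (tangent_at f (projT1 p) (projT2 p)).

(* Immersions and submersions of Banach manifolds have split tangent maps. *)
Definition immersion_at (M N : atlas K) (f : M -> N) (x : M) :=
  exists2 r : {linear tangent_space (f x) -> tangent_space x},
    continuous r & cancel (tangent_at f x) r.

Definition submersion_at (M N : atlas K) (f : M -> N) (x : M) :=
  exists2 s : {linear tangent_space (f x) -> tangent_space x},
    continuous s & cancel s (tangent_at f x).

Definition immersion (M N : atlas K) (f : M -> N) :=
  smooth_map f /\ forall x, immersion_at f x.

Definition submersion_on (M N : atlas K) (O : set M) (f : M -> N) :=
  smooth_map_on O f /\ forall x, O x -> submersion_at f x.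

Definition subimmersion_at (M N : atlas K) (f : M -> N) (x : M) :=
  exists (O : set M) (P : manifold K) (s : M -> P) (i : P -> N),
    [/\ open O /\ O x, submersion_on O s, immersion i &
        forall y, O y -> f y = i (s y)].

End TangentMap.

Section Algebra.
Context {K : numFieldType} (M : atlas K).

(* Both summands lie over the same point of [M], so that the sum is taken in
   one tangent space. *)
Definition tangent_mu (xi : tangent_bundle (tangent_bundle M)) :
    tangent_bundle M :=
  @tangent_pt K M (projT1 (projT1 xi))
    (projT2 (tangent_proj xi) + projT2 (tangent_map (@tangent_proj K M) xi)).

Definition tangent_algebra (h : tangent_bundle M -> M) :=
  [/\ smooth_map h,
      forall x : M, h (tangent_pt (0 : tangent_space x)) = x &
      forall xi : tangent_bundle (tangent_bundle M),
        h (tangent_map h xi) = h (tangent_mu xi)].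

Definition algebra_fiber (h : tangent_bundle M -> M) (x : M) :
    banach_atlas (tangent_space x) -> M :=
  fun v => h (@tangent_pt K M x v).

Definition tame (h : tangent_bundle M -> M) :=
  forall x : M,
    subimmersion_at (@algebra_fiber h x) (0 : tangent_space x).

(* The derivative at 0 of [h] restricted to the fiber over [x]; since
   [h (x, 0) = x], the chart at [x] serves on both sides. *)
Definition algebra_anchor (h : tangent_bundle M -> M) (x : M) :
    {linear tangent_space x -> tangent_space x} :=
  'd (fwd (chart_of (chart_at x)) \o @algebra_fiber h x) (0 : tangent_space x).

Definition induced_distribution (h : tangent_bundle M -> M) (x : M) :
    set (tangent_space x) :=
  range (algebra_anchor h x).

Definition accessible_set (h : tangent_bundle M -> M) (x : M) : set M :=
  range (@algebra_fiber h x).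

End Algebra.

Section Foliation.
Context {K : numFieldType}.

Definition initial_submanifold (S M : manifold K) (i : S -> M) :=
  [/\ injective i, immersion i &
      forall (L : manifold K) (f : L -> S),
        smooth_map (i \o f) -> smooth_map f].

Record foliation (M : manifold K) := Foliation {
  leaf_index : Type;
  leaf : leaf_index -> manifold K;
  leaf_incl : forall a, leaf a -> M;
  leaf_connected : forall a, connected [set: leaf a];
  leaf_initial : forall a, initial_submanifold (@leaf_incl a);
  leaf_partition :
    partition [set: leaf_index] (fun a => range (@leaf_incl a)) [set: M];
  leaf_charts : forall a (s : leaf a),
    exists (E F : completeNormedModType K) (c : chart (E * F)%type M)
           (V : set E) (W : set F),
    [/\ atlas_chart c /\ dom c (leaf_incl s),
        [/\ cod c = V `*` W, nbhs 0 V & nbhs 0 W],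
        toplinear_iso E (tangent_space s),
        fwd c (leaf_incl s) = (0, 0) &
        forall b, exists2 B, B `<=` W &
          fwd c @` (dom c `&` range (@leaf_incl b)) = V `*` B] }.

Definition leaves (M : manifold K) (F : foliation M) : set (set M) :=
  range (fun a : leaf_index F => range (@leaf_incl M F a)).

Definition distribution_on (M : manifold K) :=
  forall x : M, set (tangent_space x).

Definition tangent_distribution (M : manifold K) (F : foliation M) :
    distribution_on M :=
  fun x => [set v | exists (a : leaf_index F) (p : tangent_bundle (leaf a)),
    tangent_map (@leaf_incl M F a) p = tangent_pt v].

Arguments tangent_distribution {M} F x _.

Definition integrable_distribution (M : manifold K) (D : distribution_on M) :=
  exists F : foliation M, forall x : M, tangent_distribution F x = D x.

End Foliation.

Arguments induced_distribution {K M} h x _.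
Arguments tangent_distribution {K M} F x _.
Arguments leaves {K M} F _.

(* Main.v *)
(* Differentiating [h (h (x, v), d h (x, v) (u, u')) = h (x, v + u)] gives two
   facts.  First, [A_{h(x, w)} d_1h(x, w) u = d_2h(x, w) u], so that moving inside
   an accessible set means moving in the direction of the distribution.  Second,
   near [(x, 0)] the operators [d_1h(x, w)] are isomorphisms that carry [D_x] onto
   [D_{h(x, w)}]; hence accessible sets partition [M] and a property invariant
   under these isomorphisms holds on all of an accessible set [L] or nowhere on it.

   Tameness splits each [D_x], but [D] could still jump along [L].  Continuity of
   [z |-> D_z] at a point of [L] is such an invariant property, and it holds at
   some point: otherwise a Baire argument with nested balls centred on [L] produces
   a point of [M] at which the anchor has no bounded generalized inverse.

   The inverse function theorem applied to [(a, b) |-> h (x + b, G a)], with [G] a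
   generalized inverse of the anchor, yields a chart in which accessible sets are
   unions of plaques [b = const].  By continuity of [D] along [L] the transverse
   coordinate of [v |-> h (x, v)] has derivative zero, so by separability it takes
   only countably many values on [L].  A continuous map of a ball with countably
   many values is constant; this makes the plaques an atlas of [L] and [L] an
   initial submanifold. *)

(* Only half of the tangency between D and the plaques is automatic. By the algebra law every plaque
   points along D, but D_z could be larger than the tangent space of the plaque at a nearby point z
   of the same leaf: tameness bounds the anchor at each point separately, and a leaf may return to
   the chart infinitely often. Continuity closes the gap, for a transverse vector of D_z would be
   close both to the kernel and to the image of the projection onto D_y. The Baire argument rests on
   a semicontinuity: if the anchor at z is not open onto its image with constant 2c, then near z it
   is not so with constant c, and this uses the generalized inverse at z alone. The limit of the
   nested balls may lie off L, so tameness is applied at a point of M that is not under control. The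
   leaf topology is finer than that of M, and M may fail to be second countable, so paracompactness
   of a leaf is not inherited. A leaf is Lindelof as a continuous image of a separable tangent
   space, and regular because M, being paracompact and Hausdorff, is regular. *)
From HB Require Import structures.
From mathcomp Require Import all_boot all_order all_algebra.
From mathcomp Require Import all_classical all_reals all_analysis.
From mathcomp.real_closed Require Import complex.
From mathcomp Require Import ring lra.
Require Import Defs.

Set Implicit Arguments.
Unset Strict Implicit.
Unset Printing Implicit Defensive.

Import Order.TTheory GRing.Theory Num.Theory.
Import numFieldNormedType.Exports.

Local Open Scope classical_set_scope.
Local Open Scope ring_scope.

(* [ring] does not apply to a [zmodType]; [abel] compares the integer
   multiplicities of the atoms on both sides. *)
Inductive zexp := ZVar of nat | ZAdd of zexp & zexp | ZOpp of zexp | ZZero.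

Section ZmodReflection.
Context {V : zmodType}.

Fixpoint zeval (env : seq V) (e : zexp) : V :=
  match e with
  | ZVar i => env`_i
  | ZAdd a b => zeval env a + zeval env b
  | ZOpp a => - zeval env a
  | ZZero => 0
  end.

Fixpoint zcoef (i : nat) (e : zexp) : int :=
  match e with
  | ZVar j => if j == i then 1 else 0
  | ZAdd a b => zcoef i a + zcoef i b
  | ZOpp a => - zcoef i a
  | ZZero => 0
  end.

Lemma zevalE env e : zeval env e = \sum_(i < size env) env`_i *~ zcoef i e.
Proof.
elim: e => /= [j|a -> b ->|a ->|].
- have [jn|nj] := ltnP j (size env).
    rewrite (bigD1 (Ordinal jn))//= eqxx mulr1z big1 ?addr0// => i.
    by rewrite -val_eqE /= eq_sym => /negbTE ->; rewrite mulr0z.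
  rewrite nth_default// big1// => i _.
  by rewrite gtn_eqF ?mulr0z// (leq_trans (ltn_ord i)).
- by rewrite -big_split; apply: eq_bigr => i _; rewrite mulrzDr.
- by rewrite -sumrN; apply: eq_bigr => i _; rewrite mulrNz.
- by rewrite big1// => i _; rewrite mulr0z.
Qed.

Lemma zeval_eq env a b :
  all (fun i => zcoef i a == zcoef i b) (iota 0 (size env)) ->
  zeval env a = zeval env b.
Proof.
move=> /allP ab; rewrite !zevalE; apply: eq_bigr => i _.
by have /eqP -> := ab i ltac:(by rewrite mem_iota ltn_ord).
Qed.
End ZmodReflection.

Ltac zindex x env k :=
  match env with
  | nil => constr:(pair k (cons x nil))
  | cons ?y ?e =>
    match constr:(Set) with
    | _ => let _ := match constr:(Set) with _ => unify x y end in
           constr:(pair k env)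
    | _ => match zindex x e (S k) with
           | pair ?j ?e' => constr:(pair j (cons y e'))
           end
    end
  end.

Ltac zreify t env :=
  match t with
  | (?a + ?b)%R =>
    match zreify a env with
    | pair ?ea ?env1 => match zreify b env1 with
      | pair ?eb ?env2 => constr:(pair (ZAdd ea eb) env2) end end
  | (- ?a)%R =>
    match zreify a env with
    | pair ?ea ?env1 => constr:(pair (ZOpp ea) env1) end
  | 0%R => constr:(pair ZZero env)
  | _ => match zindex t env O with
         | pair ?k ?env' => constr:(pair (ZVar k) env') end
  end.

Ltac zsolve env env0 ea eb :=
  match env with
  | cons ?y ?e =>
    first [ let T := type of y in
            exact (@zeval_eq (T : zmodType) env0 ea eb
                     (ltac:(vm_compute; reflexivity)))
          | zsolve e env0 ea eb ]
  end.

Ltac abel :=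
  match goal with
  | |- @eq ?T ?a ?b =>
    match zreify a (@nil T) with
    | pair ?ea ?env1 =>
      match zreify b env1 with
      | pair ?eb ?env2 => zsolve env2 env2 ea eb
      end
    end
  end.

(** * Real-valued norms over real or complex scalars *)

(* Norms of a [normedModType K] lie in [K]; [nm] below reads them in the ordered
   subfield [reals], where [lra] and the order are total. *)
Record scalars := Scalars {
  scal :> numFieldType;
  reals : realType;
  io : {rmorphism reals -> scal};
  io_le : forall x y, (io x <= io y) = (x <= y);
  io_ge0P : forall x : scal, 0 <= x -> exists r, io r = x }.

Lemma real_or_complex_scalars (K : numFieldType) :
  real_or_complex K -> exists S : scalars, scal S = K.
Proof.
case=> R.
  by exists (@Scalars R R idfun (fun _ _ => erefl)
    (fun x _ => ex_intro _ x erefl)).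
have ge0P (x : complex R) : 0 <= x -> exists r, real_complex R r = x.
  by case: x => a b /ger0_Im /= ->; exists a.
by exists (@Scalars (complex R) R (real_complex R) (@lecR R) ge0P).
Qed.

Section RealNorm.
Context {S : scalars}.
Implicit Types (E F G : normedModType S).

Lemma io_lt (x y : reals S) : (io S x < io S y) = (x < y).
Proof. by rewrite !lt_def io_le (inj_eq (fmorph_inj (io S))). Qed.

Lemma io_norm (x : reals S) : `|io S x| = io S `|x|.
Proof.
have [x0|/ltW x0] := leP 0 x; first by rewrite !ger0_norm// -(rmorph0 (io S)) io_le.
by rewrite !ler0_norm ?rmorphN// -(rmorph0 (io S)) io_le.
Qed.

Definition nm E (x : E) : reals S := xget 0 [set r | io S r = `|x|].

Lemma nmE E (x : E) : io S (nm x) = `|x|.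
Proof.
have [r rx] := io_ge0P (normr_ge0 x).
by rewrite /nm; have := xgetPex 0 (ex_intro [set r | io S r = `|x|] r rx).
Qed.

Lemma nm_inj E F (x : E) (y : F) : `|x| = `|y| -> nm x = nm y.
Proof. by move=> xy; apply: (fmorph_inj (io S)); rewrite !nmE. Qed.

Lemma nm0 E : nm (0 : E) = 0.
Proof. by apply: (fmorph_inj (io S)); rewrite nmE rmorph0 normr0. Qed.

Lemma nm_ge0 E (x : E) : 0 <= nm x.
Proof. by rewrite -io_le rmorph0 nmE. Qed.

Lemma nm_eq0 E (x : E) : (nm x == 0) = (x == 0).
Proof. by rewrite -(inj_eq (fmorph_inj (io S))) nmE rmorph0 normr_eq0. Qed.

Lemma nm_gt0 E (x : E) : (0 < nm x) = (x != 0).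
Proof. by rewrite lt_def nm_eq0 nm_ge0 andbT. Qed.

Lemma nmD E (x y : E) : nm (x + y) <= nm x + nm y.
Proof. by rewrite -io_le rmorphD /= !nmE ler_normD. Qed.

Lemma nmN E (x : E) : nm (- x) = nm x.
Proof. by apply: nm_inj; rewrite normrN. Qed.

Lemma nmC E (x y : E) : nm (x - y) = nm (y - x).
Proof. by rewrite -nmN opprB. Qed.

Lemma nmZ E (t : reals S) (x : E) : nm (io S t *: x) = `|t| * nm x.
Proof.
by apply: (fmorph_inj (io S)); rewrite rmorphM /= !nmE normrZ io_norm.
Qed.

Lemma nm_pair E F (x : E) (y : F) : nm (x, y) = Num.max (nm x) (nm y).
Proof.
apply: (fmorph_inj (io S)); rewrite nmE prod_normE /= -!nmE.
by have [xy|/ltW xy] := leP (nm x) (nm y); [rewrite max_r|rewrite max_l];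
  rewrite // io_le.
Qed.

Lemma nm_fst E F (p : E * F) : nm p.1 <= nm p.
Proof. by case: p => a b; rewrite nm_pair le_max lexx. Qed.

Lemma nm_snd E F (p : E * F) : nm p.2 <= nm p.
Proof. by case: p => a b; rewrite nm_pair le_max lexx orbT. Qed.

Lemma nm_pair_lt E F (x : E) (y : F) r : (nm (x, y) < r) = (nm x < r) && (nm y < r).
Proof. by rewrite nm_pair gt_max. Qed.

Lemma nm_pair_le E F (x : E) (y : F) r :
  (nm (x, y) <= r) = (nm x <= r) && (nm y <= r).
Proof. by rewrite nm_pair ge_max. Qed.

Lemma nm_tri E (z x y : E) : nm (x - y) <= nm (x - z) + nm (z - y).
Proof. by apply: le_trans (nmD _ _); rewrite addrA subrK. Qed.

Lemma nmB E (x y : E) : nm (x - y) <= nm x + nm y.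
Proof. by rewrite -(nmN y) nmD. Qed.

Lemma nm_split E (x y : E) : nm x <= nm (x - y) + nm y.
Proof. by rewrite -{1}(subrK y x) nmD. Qed.

Lemma nbhs_nm E (x : E) (A : set E) :
  nbhs x A <-> exists2 r : reals S, 0 < r & forall y, nm (y - x) < r -> A y.
Proof.
split=> [/nbhs_normP[e /= e0 eA]|[r r0 rA]].
  have [r re] := io_ge0P (ltW e0); exists r.
    by rewrite -io_lt re rmorph0.
  by move=> y yx; apply: eA; rewrite /ball_ /= -nmE -re io_lt nmC.
apply/nbhs_normP; exists (io S r) => /=; first by rewrite -(rmorph0 (io S)) io_lt.
by move=> y; rewrite /ball_ /= -nmE io_lt nmC; exact: rA.
Qed.

Lemma continuous_nm E F (f : E -> F) x : {for x, continuous f} <->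
  forall e : reals S, 0 < e ->
    exists2 r : reals S, 0 < r & forall y, nm (y - x) < r -> nm (f y - f x) < e.
Proof.
split=> [cf e e0|H A].
  have /cf : nbhs (f x) [set z | nm (z - f x) < e] by apply/nbhs_nm; exists e.
  by move=> /nbhs_nm.
rewrite nbhs_nm => -[e e0 eA]; have [r r0 rH] := H e e0.
by apply/nbhs_nm; exists r => // y /rH /eA.
Qed.

Lemma open_nm E (A : set E) : open A <->
  forall x, A x -> exists2 r : reals S, 0 < r & forall y, nm (y - x) < r -> A y.
Proof.
rewrite openE; split=> H x Ax; first by apply/nbhs_nm; exact: H.
by apply/nbhs_nm; exact: H.
Qed.

Lemma open_ball_nm E (x : E) (r : reals S) : open [set y | nm (y - x) < r].
Proof.
apply/open_nm => y /= yx; exists (r - nm (y - x)); first by rewrite subr_gt0.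
by move=> z zy; have := nm_tri y z x; lra.
Qed.

Lemma lin_bound E F (f : {linear E -> F}) : continuous f ->
  exists2 C : reals S, 0 < C & forall x, nm (f x) <= C * nm x.
Proof.
move=> /linear_lipschitz[k k0 kf]; have [r rk] := io_ge0P (ltW k0).
exists r => [|x]; first by rewrite -io_lt rk rmorph0.
by rewrite -io_le rmorphM /= !nmE rk.
Qed.

Lemma bound_lin E F (f : {linear E -> F}) (C : reals S) :
  (forall x, nm (f x) <= C * nm x) -> continuous f.
Proof.
move=> fC x; apply/continuous_nm => e e0.
have C0 : 0 < `|C| + 1 by rewrite ltr_wpDl.
exists (e / (`|C| + 1)); first exact: divr_gt0.
move=> y; rewrite ltr_pdivlMr// -linearB => yx.
apply: le_lt_trans (fC _) _; apply: le_lt_trans yx; rewrite mulrC.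
apply: ler_wpM2l; first exact: nm_ge0.
by rewrite ler_wpDr// ler_norm.
Qed.

Lemma diff_nm E F (f : E -> F) x : differentiable f x ->
  forall e : reals S, 0 < e -> exists2 r : reals S, 0 < r &
    forall y, nm (y - x) < r -> nm (f y - f x - 'd f x (y - x)) <= e * nm (y - x).
Proof.
move=> /diff_locallyP[_ /eqaddoP /= ef] e e0.
have ie0 : 0 < io S e by rewrite -(rmorph0 (io S)) io_lt.
have /nbhs_nm[r r0 rH] := ef _ ie0.
exists r => // y yx; have := rH (y - x); rewrite subr0 => /(_ yx).
by rewrite -io_le rmorphM /= !nmE !fctE /= subrK opprD addrA.
Qed.

Lemma nm_diff E F (f : E -> F) x (L : {linear E -> F}) : continuous L ->
  (forall e : reals S, 0 < e -> exists2 r : reals S, 0 < r &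
    forall y, nm (y - x) < r -> nm (f y - f x - L (y - x)) <= e * nm (y - x)) ->
  differentiable f x /\ 'd f x = L :> (E -> F).
Proof.
move=> cL H.
have eL : f \o shift x = cst (f x) + L +o_ 0 id.
  apply/eqaddoP => e e0; have [r re] := io_ge0P (ltW e0).
  have [|s s0 sH] := H r; first by rewrite -io_lt re rmorph0.
  apply/nbhs_nm; exists s => // y; rewrite subr0 => ys.
  have := sH (y + x); rewrite addrK => /(_ ys).
  by rewrite -io_le rmorphM /= !nmE re !fctE opprD addrA.
have d1 := diff_unique cL eL.
by split=> //; apply/diff_locallyP; rewrite d1 -eL.
Qed.

End RealNorm.

Ltac generalize_norms :=
  repeat match goal with
  | |- context [@nm ?S ?E ?x] => generalize (@nm S E x)
  end; intros.

Ltac merge_norms :=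
  repeat match goal with
  | |- context [@nm ?S ?E ?x] =>
    match goal with
    | |- context [@nm S ?E' ?y] =>
      tryif constr_eq (@nm S E x) (@nm S E' y) then fail
      else (unify (@nm S E x) (@nm S E' y);
            change (@nm S E' y) with (@nm S E x))
    end
  end.

(* Abstracting the norms first spares [lra] from comparing large differentials
   up to conversion; norms of equal vectors may differ in the canonical
   instances they mention, hence the second attempt. *)
Ltac nlra :=
  clear; first [generalize_norms; lra | merge_norms; generalize_norms; lra].

(** * Differential calculus *)

Section Limits.
Context {S : scalars}.

(** The explicit modulus [e] passes to the limit. This serves the contraction argument as well as
    the nested balls of the Baire argument. *)
Lemma nested_limit (X : completeNormedModType S) (u : nat -> X)
    (e : nat -> reals S) :
  (forall n m, (n <= m)%N -> nm (u m - u n) <= e n) ->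
  (forall d, 0 < d -> exists n, e n < d) ->
  exists l, forall n, nm (l - u n) <= e n.
Proof.
move=> ue e0.
have cu : cauchy (u @ \oo).
  apply: cauchy_exP => d d0; have [r rd] := io_ge0P (ltW d0).
  have [|n en] := e0 r; first by rewrite -io_lt rd rmorph0.
  exists (u n); exists n => // m /= nm_; rewrite -ball_normE /ball_ /= -rd -nmE.
  by rewrite io_lt nmC (le_lt_trans (ue _ _ nm_)).
have /cvg_ex[l ul] : cvg (u @ \oo) by exact: cauchy_cvg.
exists l => n; rewrite leNgt; apply/negP => eln.
have [N _ NH] : \forall m \near \oo, nm (u m - l) < nm (l - u n) - e n.
  suff /ul : nbhs l [set z | nm (z - l) < nm (l - u n) - e n] by [].
  by apply/nbhs_nm; exists (nm (l - u n) - e n); rewrite ?subr_gt0.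
have := NH (maxn n N) (leq_maxr _ _); rewrite [X in X < _]nmC => NHn.
have := ue n (maxn n N) (leq_maxl _ _).
by have := nm_tri (u (maxn n N)) l (u n); lra.
Qed.

(** Continuous induction: the local estimate at the supremum of the times that satisfy the bound
    puts the supremum among them, and a later time too if the supremum is below 1. No integral and
    no functional is involved, so real and complex scalars are treated alike. *)
Lemma increment_bound (F : normedModType S) (g : reals S -> F) (C : reals S) :
  (forall c, 0 <= c <= 1 -> exists2 r, 0 < r & forall s, 0 <= s <= 1 ->
     `|s - c| < r -> nm (g s - g c) <= C * `|s - c|) ->
  nm (g 1 - g 0) <= C.
Proof.
move=> H; pose A := [set t | 0 <= t <= 1 /\ nm (g t - g 0) <= C * t].
have A0 : A 0 by split; rewrite ?lexx ?ler01// subrr nm0 mulr0.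
have supA : has_sup A by split; [exists 0|exists 1 => t [/andP[]]].
have c01 : 0 <= sup A <= 1.
  rewrite (ub_le_sup supA.2)//=; apply: ge_sup; first by exists 0.
  by move=> t [/andP[]].
set c := sup A in c01; have [r r0 rH] := H c c01.
have /andP[c0 c1] := c01.
have Ac : A c.
  split=> //; have [t At ct] := sup_adherent r0 supA.
  have tc : t <= c by apply: ub_le_sup => //; case: supA.
  case: At => t01 tg.
  have := rH t t01; rewrite ler0_norm ?subr_le0// => /(_ ltac:(rewrite -/c in ct; lra)).
  rewrite nmC => gct; have := nm_tri (g t) (g c) (g 0); nra.
have [c_1|c_1] := eqVneq c 1; first by have := Ac.2; rewrite c_1 mulr1.
have cl1 : c < 1 by rewrite lt_neqAle c_1.
pose s := Num.min 1 (c + r / 2).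
have cs : c < s by rewrite lt_min cl1 ltrDl divr_gt0.
have s1 : s <= 1 by rewrite ge_min lexx.
have sr : s <= c + r / 2 by rewrite ge_min lexx orbT.
have As : A s.
  have s01 : 0 <= s <= 1 by rewrite s1 (le_trans c0 (ltW cs)).
  split=> //; have := rH s s01; rewrite ger0_norm ?subr_ge0 ?(ltW cs)//.
  move=> /(_ ltac:(lra)) gsc.
  apply: le_trans (nm_tri (g c) _ _) _; apply: le_trans (lerD gsc Ac.2) _.
  by rewrite mulrBr subrK.
by have := ub_le_sup supA.2 As; rewrite leNgt cs.
Qed.

Lemma mean_value (E F : normedModType S) (f : E -> F) (x y : E) (C : reals S) :
  (forall t : reals S, 0 <= t <= 1 ->
     differentiable f (x + io S t *: (y - x)) /\
     forall v, nm ('d f (x + io S t *: (y - x)) v) <= C * nm v) ->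
  nm (f y - f x) <= C * nm (y - x).
Proof.
move=> H; apply/ler_addgt0Pr => e e0.
have [xy0|xy0] := eqVneq x y.
  by rewrite xy0 !subrr !nm0 mulr0 add0r ltW.
have d0 : 0 < nm (y - x) by rewrite nm_gt0 subr_eq0 eq_sym.
pose g (t : reals S) := f (x + io S t *: (y - x)).
have -> : f y - f x = g 1 - g 0.
  by rewrite /g rmorph1 rmorph0 scale1r scale0r addr0 [x + _]addrC subrK.
apply: increment_bound => c c01; have [dfc Cc] := H c c01.
(* The tolerance is scaled by the length of the segment, so that the first order remainder costs
   [e * |s - c|] in the parameter. *)
have [|r r0 rH] := @diff_nm S _ _ _ _ dfc (e / nm (y - x)); first exact: divr_gt0.
exists (r / nm (y - x)) => [|s s01 sc]; first exact: divr_gt0.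
have E1 : x + io S s *: (y - x) - (x + io S c *: (y - x)) = io S (s - c) *: (y - x).
  by rewrite opprD addrACA subrr add0r -scalerBl rmorphB.
have := rH (x + io S s *: (y - x)); rewrite E1 nmZ.
rewrite ltr_pdivlMr// in sc; move=> /(_ sc); rewrite -/(g s) -/(g c).
have := Cc (io S (s - c) *: (y - x)); rewrite nmZ.
set D := 'd _ _ _ => H1 H2; have := nm_split (g s - g c) D => H3.
have EE : e / nm (y - x) * (`|s - c| * nm (y - x)) = e * `|s - c|.
  by field; rewrite gt_eqF.
rewrite EE in H2; lra.
Qed.

End Limits.

Section SmoothCalculus.
Context {K : numFieldType}.
Implicit Types (E F G : normedModType K).

(** All clauses of [Ck] are statements at single points about a total function, so [V] need not be
    open. *)
Lemma Ck_local n E F (U : set E) (f : E -> F) :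
  (forall x, U x -> exists2 V, V x & Ck n V f) -> Ck n U f.
Proof.
elim: n E F U f => [|n IH] E F U f H /=.
  by move=> x /H[V Vx]; exact.
split=> [x /H[V Vx [/(_ _ Vx)]]//|].
by apply: IH => -[x v] [/= /H[V Vx [_ CV]] _]; exists (V `*` setT).
Qed.

Lemma Ck_sub n E F (U V : set E) (f : E -> F) :
  V `<=` U -> Ck n U f -> Ck n V f.
Proof. by move=> VU Uf; apply: Ck_local => x /VU Ux; exists U. Qed.

Lemma Ck_comp n E F G (U : set E) (V : set F) (f : E -> F) (g : F -> G) :
  open U -> (forall x, U x -> V (f x)) ->
  Ck n U f -> Ck n V g -> Ck n U (g \o f).
Proof.
elim: n E F G U V f g => [|n IH] E F G U V f g oU UV /=.
  by move=> cf cg x Ux; apply: continuous_comp; [exact: cf|exact/cg/UV].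
move=> [df Cf] [dg Cg]; split=> [x Ux|].
  by apply: differentiable_comp; [exact: df|exact/dg/UV].
have oUT : open (U `*` [set: E]) by apply: open_setX => //; exact: openT.
apply: Ck_ext oUT _ (IH _ _ _ _ (V `*` setT) _ _ oUT _ Cf Cg).
  move=> [x v] [/= Ux _]; have dfx := df _ Ux; have dgx := dg _ (UV _ Ux).
  by rewrite /tmap /= (diff_comp dfx dgx).
by move=> [x v] [/= /UV].
Qed.

Lemma continuous_pair (T T1 T2 : topologicalType) (f : T -> T1) (g : T -> T2) :
  continuous f -> continuous g -> continuous (fun x => (f x, g x)).
Proof. by move=> cf cg x; apply: cvg_pair; [exact: cf|exact: cg]. Qed.

Definition mklin E F (f : E -> F) (lf : linear f) : {linear E -> F} :=
  HB.pack f (GRing.isLinear.Build K E F *:%R f lf).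

Lemma fst_lin E F : linear (@fst E F). Proof. by []. Qed.
Lemma snd_lin E F : linear (@snd E F). Proof. by []. Qed.

Lemma tmap_lin E F (f : {linear E -> F}) : linear (fun p : E * E => (f p.1, f p.2)).
Proof. by move=> a x y; rewrite !linearP. Qed.

Lemma Ck_lin n E F (f : {linear E -> F}) (U : set E) :
  open U -> continuous f -> Ck n U f.
Proof.
elim: n E F f U => [|n IH] E F f U oU cf /=; first by move=> x _; exact: cf.
split=> [x _|]; first exact: linear_differentiable.
have oUT : open (U `*` [set: E]) by apply: open_setX => //; exact: openT.
apply: (@Ck_ext _ _ _ _ _ (mklin (tmap_lin f))) => //.
  by move=> [x v] _; rewrite /tmap /= diff_lin.
apply: IH => //= p; apply: cvg_pair.
  by apply: (@continuous_comp _ _ _ fst f); [exact: cvg_fst|exact: cf].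
by apply: (@continuous_comp _ _ _ snd f); [exact: cvg_snd|exact: cf].
Qed.

(** The tangent map of a pair is the pair of the tangent maps up to this exchange of the middle
    factors. *)
Lemma swap_lin E F : linear (fun p : (E * E) * (F * F) =>
  ((p.1.1, p.2.1), (p.1.2, p.2.2))).
Proof. by []. Qed.

Lemma Ck_pair n E F G (U : set E) (f : E -> F) (g : E -> G) :
  open U -> Ck n U f -> Ck n U g -> Ck n U (fun x => (f x, g x)).
Proof.
elim: n E F G U f g => [|n IH] E F G U f g oU /=.
  by move=> cf cg x Ux; apply: cvg_pair; [exact: cf|exact: cg].
move=> [df Cf] [dg Cg]; split=> [x Ux|].
  by apply: differentiable_pair; [exact: df|exact: dg].
have oUT : open (U `*` [set: E]) by apply: open_setX => //; exact: openT.
pose sw : (F * F) * (G * G) -> (F * G) * (F * G) := mklin (@swap_lin F G).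
pose fg : E * E -> (F * F) * (G * G) := fun p => (tmap f p, tmap g p).
apply: (@Ck_ext K n (E * E)%type ((F * G) * (F * G))%type _ (sw \o fg)) => //.
  move=> [x v] [/= Ux _]; have dfx := df _ Ux; have dgx := dg _ Ux.
  by rewrite /tmap /= (diff_pair dfx dgx).
apply: (@Ck_comp n _ _ _ _ setT) => //; first exact: IH.
apply: Ck_lin; first exact: openT.
have cfst (A B : normedModType K) : continuous (@fst A B) by move=> ?; exact: cvg_fst.
have csnd (A B : normedModType K) : continuous (@snd A B) by move=> ?; exact: cvg_snd.
apply: (@continuous_pair _ _ _ (fun p => (p.1.1, p.2.1)) (fun p => (p.1.2, p.2.2)));
  apply: continuous_pair => p.
- by apply: (@continuous_comp _ _ _ fst fst); [exact: cfst|exact: cfst].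
- by apply: (@continuous_comp _ _ _ snd fst); [exact: csnd|exact: cfst].
- by apply: (@continuous_comp _ _ _ fst snd); [exact: cfst|exact: csnd].
- by apply: (@continuous_comp _ _ _ snd snd); [exact: csnd|exact: csnd].
Qed.

Lemma smooth_on_local E F (U : set E) (f : E -> F) :
  (forall x, U x -> exists2 V, V x & smooth_on V f) -> smooth_on U f.
Proof. by move=> H n; apply: Ck_local => x /H[V Vx sV]; exists V. Qed.

Lemma smooth_on_sub E F (U V : set E) (f : E -> F) :
  V `<=` U -> smooth_on U f -> smooth_on V f.
Proof. by move=> VU sf n; exact: Ck_sub (sf n). Qed.

Lemma smooth_on_comp E F G (U : set E) (V : set F) (f : E -> F) (g : F -> G) :
  open U -> (forall x, U x -> V (f x)) ->
  smooth_on U f -> smooth_on V g -> smooth_on U (g \o f).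
Proof. by move=> oU UV sf sg n; exact: Ck_comp UV (sf n) (sg n). Qed.

Lemma smooth_on_lin E F (U : set E) (f : {linear E -> F}) :
  open U -> continuous f -> smooth_on U f.
Proof. by move=> oU cf n; exact: Ck_lin. Qed.

Lemma smooth_on_pair E F G (U : set E) (f : E -> F) (g : E -> G) :
  open U -> smooth_on U f -> smooth_on U g -> smooth_on U (fun x => (f x, g x)).
Proof. by move=> oU sf sg n; exact: Ck_pair. Qed.

Lemma inl_lin E F : linear (fun u : E => (u, 0 : F)).
Proof.
move=> a u v; transitivity (a *: u + v, a *: (0 : F) + 0) => //.
by rewrite scaler0 addr0.
Qed.

Lemma inr_lin E F : linear (fun u : F => (0 : E, u)).
Proof.
move=> a u v; transitivity (a *: (0 : E) + 0, a *: u + v) => //.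
by rewrite scaler0 addr0.
Qed.

Lemma continuous_inl E F (y : F) : continuous (fun u : E => (u, y)).
Proof. by move=> x; apply: cvg_pair; [exact: cvg_id|exact: cvg_cst]. Qed.

Lemma continuous_inr E F (x : E) : continuous (fun u : F => (x, u)).
Proof. by move=> y; apply: cvg_pair; [exact: cvg_cst|exact: cvg_id]. Qed.

Lemma diff_fst E F (p : E * F) :
  differentiable (@fst E F) p /\ 'd (@fst E F) p = @fst E F :> (_ -> _).
Proof.
have cf : continuous (mklin (@fst_lin E F)) by move=> ?; exact: cvg_fst.
have := @linear_differentiable _ _ _ (mklin (@fst_lin E F)) p cf.
by have := @diff_lin _ _ _ (mklin (@fst_lin E F)) p cf.
Qed.

Lemma diff_snd E F (p : E * F) :
  differentiable (@snd E F) p /\ 'd (@snd E F) p = @snd E F :> (_ -> _).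
Proof.
have cf : continuous (mklin (@snd_lin E F)) by move=> ?; exact: cvg_snd.
have := @linear_differentiable _ _ _ (mklin (@snd_lin E F)) p cf.
by have := @diff_lin _ _ _ (mklin (@snd_lin E F)) p cf.
Qed.

(** [L] is a bare function that agrees pointwise with the derivative, so that chain rules can be
    composed before any linear structure is put on the result. *)
Definition has_diff E F (f : E -> F) (x : E) (L : E -> F) :=
  differentiable f x /\ forall u, 'd f x u = L u.

Lemma has_diffP E F (f : E -> F) x : differentiable f x -> has_diff f x ('d f x).
Proof. by []. Qed.

Lemma has_diff_comp E F G (f : E -> F) (g : F -> G) x y L N :
  has_diff f x L -> f x = y -> has_diff g y N -> has_diff (g \o f) x (N \o L).
Proof.
move=> [df fL] fx; rewrite -fx => -[dg gN]; split; first exact: differentiable_comp.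
by move=> u; apply: etrans (congr1 (@^~ u) (diff_comp df dg)) _; rewrite /= fL gN.
Qed.

Lemma has_diff_pair E F G (f : E -> F) (g : E -> G) x L N :
  has_diff f x L -> has_diff g x N ->
  has_diff (fun a => (f a, g a)) x (fun u => (L u, N u)).
Proof.
move=> [df fL] [dg gN]; split; first exact: differentiable_pair.
by move=> u; apply: etrans (congr1 (@^~ u) (diff_pair df dg)) _; rewrite fL gN.
Qed.

Lemma has_diff_cst E F (a : F) (x : E) : has_diff (fun _ : E => a) x (fun=> 0).
Proof.
split=> [|u]; first exact: differentiable_cst.
by rewrite (diff_cst a x).
Qed.

Lemma has_diff_id E (x : E) : has_diff id x id.
Proof. by split=> // u; rewrite diff_val. Qed.

Lemma has_diff_lin E F (f : {linear E -> F}) x : continuous f -> has_diff f x f.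
Proof.
by move=> cf; split=> [|u]; [exact: linear_differentiable|rewrite diff_lin].
Qed.

Lemma has_diff_add E F (f g : E -> F) x L N :
  has_diff f x L -> has_diff g x N ->
  has_diff (fun a => f a + g a) x (fun u => L u + N u).
Proof.
move=> [df fL] [dg gN]; split; first exact: differentiableD.
by move=> u; apply: etrans (congr1 (@^~ u) (diffD df dg)) _; rewrite /= fL gN.
Qed.

Lemma has_diff_near E F (U : set E) (f g : E -> F) x L :
  open U -> U x -> (forall y, U y -> f y = g y) -> has_diff f x L -> has_diff g x L.
Proof.
move=> oU Ux fg [df fL]; have [dg gf] := near_eq_diff (open_nbhs_eq oU fg Ux) df.
by split=> // u; rewrite -fL; exact: (congr1 (@^~ u) gf).
Qed.

Lemma has_diff_uniq E F (f : E -> F) x L N u :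
  has_diff f x L -> has_diff f x N -> L u = N u.
Proof. by move=> [_ fL] [_ fN]; rewrite -fL -fN. Qed.

Lemma has_diff_snd E F (p : E * F) : has_diff snd p snd.
Proof. by have [d1 d2] := diff_snd p; split=> // u; rewrite d2. Qed.

Lemma has_diff_inl E F (x : E) (y : F) :
  has_diff (fun a : E => (a, y)) x (fun u => (u, 0)).
Proof. exact: has_diff_pair (has_diff_id x) (has_diff_cst y x). Qed.

Lemma has_diff_inr E F (x : E) (y : F) :
  has_diff (fun b : F => (x, b)) y (fun u => (0, u)).
Proof. exact: has_diff_pair (has_diff_cst x y) (has_diff_id y). Qed.

Lemma has_diff_addl E (a x : E) : has_diff (fun v : E => a + v) x id.
Proof.
have := has_diff_add (has_diff_cst a x) (has_diff_id x).
by move=> [d E1]; split=> // u; rewrite E1 add0r.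
Qed.

Lemma Ck_cst n E F (U : set E) (a : F) : Ck n U (fun _ : E => a).
Proof.
elim: n E F U a => [|n IH] E F U a /=; first by move=> x _; exact: cvg_cst.
split=> [x _|]; first exact: differentiable_cst.
suff -> : tmap (fun _ : E => a) = fun _ => (a, 0) by exact: IH.
by apply/funext => -[x v]; rewrite /tmap /= diff_cst.
Qed.

Lemma smooth_on_cst E F (U : set E) (a : F) : smooth_on U (fun _ : E => a).
Proof. by move=> n; exact: Ck_cst. Qed.

Lemma smooth_on_fst E F : smooth_on setT (@fst E F).
Proof.
apply: (@smooth_on_lin _ _ setT (mklin (@fst_lin E F))); first exact: openT.
by move=> ?; exact: cvg_fst.
Qed.

Lemma smooth_on_snd E F : smooth_on setT (@snd E F).
Proof.
apply: (@smooth_on_lin _ _ setT (mklin (@snd_lin E F))); first exact: openT.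
by move=> ?; exact: cvg_snd.
Qed.

Lemma smooth_on_cont E F (U : set E) (f : E -> F) x :
  smooth_on U f -> U x -> {for x, continuous f}.
Proof. by move=> /(_ 0%N) /=; exact. Qed.

Lemma add_lin E : linear (fun p : E * E => p.1 + p.2).
Proof. by move=> a x y; rewrite /= !scalerDr addrACA. Qed.

Lemma smooth_on_add E F (U : set E) (f g : E -> F) :
  open U -> smooth_on U f -> smooth_on U g -> smooth_on U (fun x => f x + g x).
Proof.
move=> oU sf sg.
apply: (@smooth_on_comp _ _ _ _ setT (fun x => (f x, g x)) (mklin (@add_lin F))) => //.
  exact: smooth_on_pair.
by apply: smooth_on_lin; [exact: openT|exact: add_continuous].
Qed.

End SmoothCalculus.

(** * Smooth inverses and the inverse function theorem *)

Section Inverse.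
Context {S : scalars}.
Implicit Types (E F G : normedModType S).

Lemma sndD (U V : zmodType) (p q : U * V) : (p + q).2 = p.2 + q.2.
Proof. by []. Qed.

(* The remainder of [tmap f] at [(x, 0)] controls ['d f y w - 'd f x w] when
   [w] and [y - x] have comparable norms; linearity in [w] does the rest. *)
Lemma derivative_continuous E F (U : set E) (f : E -> F) x :
  open U -> smooth_on U f -> U x -> forall e : reals S, 0 < e ->
  exists2 r : reals S, 0 < r & forall y, nm (y - x) < r ->
    U y /\ forall v, nm ('d f y v - 'd f x v) <= e * nm v.
Proof.
move=> oU sf Ux e e0.
have [r1 r10 r1U] := (open_nm U).1 oU x Ux.
have dT : differentiable (tmap f) (x, 0 : E).
  by apply: (smooth_on_diff (smooth_on_tmap sf)).
have e30 : 0 < e / 3 by rewrite divr_gt0.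
have [r r0 rH] := diff_nm dT e30.
set D := 'd (tmap f) (x, 0) in rH.
exists (Num.min r1 (r / 2)) => [|y]; first by rewrite lt_min r10 divr_gt0.
rewrite lt_min => /andP[yr1 yr].
split=> [|v]; first exact: r1U.
have [v0|v0] := eqVneq v 0; first by rewrite v0 !linear0 ?subrr ?addr0 !nm0 mulr0.
have nv0 : 0 < nm v by rewrite nm_gt0.
(* The vector [v] is rescaled to length [r / 2], the scale on which the remainder estimate at
   [(x, 0)] is informative. *)
pose c := r / (2 * nm v).
have c0 : 0 < c by rewrite divr_gt0// mulr_gt0.
have cv : c * nm v = r / 2 by rewrite /c; field; rewrite gt_eqF.
pose w := io S c *: v.
have nw : nm w = r / 2 by rewrite nmZ gtr0_norm.
have H (p : E * E) : nm (p.1 - x) <= r / 2 -> nm p.2 <= r / 2 ->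
    nm ('d f (p.1) (p.2) - (D (p - (x, 0))).2) <= e / 3 * (r / 2).
  move=> p1 p2.
  have np : nm (p - (x, 0)) <= r / 2.
    by case: p p1 p2 => a b /= p1 p2; rewrite nm_pair_le p1 subr0.
  have := rH p (le_lt_trans np _); rewrite ltr_pdivrMr// => /(_ ltac:(lra)).
  move=> /(le_trans (nm_snd _)) /=; rewrite linear0 subr0 => /le_trans; apply.
  by apply: ler_wpM2l np; exact: ltW.
have nyx : nm (y - x) <= r / 2 by exact: ltW.
have w2 : nm w <= r / 2 by rewrite nw.
have r20 : 0 <= r / 2 by rewrite divr_ge0// ltW.
(* The linear [D] is compared with ['d f] at [(y, w)], [(y, 0)] and [(x, w)]. Its arguments add up,
   so [D] cancels and each comparison costs a third of [e]. *)
have H1 := H (y, w) nyx w2.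
have H2 := H (y, 0) nyx; rewrite /= nm0 linear0 sub0r nmN in H2.
have {}H2 := H2 r20.
have H3 := H (x, w); rewrite /= subrr nm0 in H3; have {}H3 := H3 r20 w2.
have DE : D ((y, w) - (x, 0)) = D ((y, 0) - (x, 0)) + D ((x, w) - (x, 0)).
  rewrite -linearD; congr (D _); congr (_, _) => /=.
    by rewrite subrr addr0.
  by rewrite !subr0 add0r.
rewrite DE in H1.
have H4 : nm ('d f y w - 'd f x w) <= e * (r / 2).
  set a := 'd f y w in H1 *; set b := 'd f x w in H3 *.
  set p := D _ in H1 H2; set q := D _ in H1 H3.
  have -> : a - b = (a - (p + q).2) + (p.2 - (b - q.2)).
    by rewrite sndD; abel.
  apply: le_trans (nmD _ _) _; apply: le_trans (lerD H1 (nmB _ _)) _.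
  lra.
rewrite -(ler_pM2l c0) mulrCA cv; apply: le_trans H4.
by rewrite /w !linearZZ -scalerDr nmZ gtr0_norm.
Qed.

Lemma below2 (a b : reals S) : 0 < a -> 0 < b ->
  exists2 e, 0 < e & e <= a /\ e <= b.
Proof.
move=> a0 b0; exists (Num.min a b); first by rewrite lt_min a0.
by rewrite !ge_min !lexx orbT.
Qed.

Lemma diff_tmap1 E F (f : E -> F) (p q : E * E) : differentiable f (p.1) ->
  differentiable (tmap f) p -> ('d (tmap f) p q).1 = 'd f (p.1) (q.1).
Proof.
move=> df dT; have := diff_comp dT (diff_fst _).1; rewrite (diff_fst _).2.
move=> /(congr1 (@^~ q)) /= <-.
have := diff_comp (diff_fst p).1 df.
by rewrite (diff_fst _).2 => /(congr1 (@^~ q)) /= <-.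
Qed.

(** With [diff_tmap1] this makes the derivative of [tmap f] block triangular, with ['d f x] in both
    diagonal blocks. *)
Lemma diff_tmap2 E F (f : E -> F) (x v b : E) : differentiable f x ->
  differentiable (tmap f) (x, v) -> ('d (tmap f) (x, v) (0, b)).2 = 'd f x b.
Proof.
move=> df dT; have [dj jE] := has_diff_inr x v.
rewrite -(jE b); have := diff_comp dj dT => /(congr1 (@^~ b)) /= <-.
have dTj := differentiable_comp dj dT.
have := diff_comp dTj (diff_snd _).1; rewrite (diff_snd _).2 => /(congr1 (@^~ b)) /= <-.
by rewrite (@diff_lin _ _ _ ('d f x)) //; exact: diff_continuous df.
Qed.

Lemma half_pow_small (c e : reals S) : 0 < e -> exists n, c * 2^-1 ^+ n < e.
Proof.
move=> e0; have [n cn] : exists n, c / e < 2 ^+ n.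
  by exists (Num.bound (c / e)); apply: upper_nthrootP.
exists n; rewrite exprVn ltr_pdivrMr ?exprn_gt0// mulrC -ltr_pdivrMr//.
Qed.

Lemma perturbed_identity (X : completeNormedModType S) (g : X -> X) x (r : reals S) :
  0 < r ->
  (forall a b, nm (a - x) < r -> nm (b - x) < r ->
     nm ((g a - g b) - (a - b)) <= nm (a - b) / 2) ->
  (forall a b, nm (a - x) < r -> nm (b - x) < r -> nm (a - b) <= 2 * nm (g a - g b)) /\
  (forall y, nm (y - g x) < r / 2 -> exists2 a, nm (a - x) < r & g a = y).
Proof.
move=> r0 H; split=> [a b ar br|y yr].
  have := H a b ar br; have := nm_split (a - b) (g a - g b).
  by rewrite nmC; lra.
(* Solutions of [g a = y] are the fixed points of [T], which contracts by one half. The iterates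
   from [x] stay within [2 * d], hence the radius [r / 2] for [y]. *)
pose T z := z - g z + y.
have TH a b : nm (a - x) < r -> nm (b - x) < r -> nm (T a - T b) <= nm (a - b) / 2.
  move=> ar br; apply: le_trans (H a b ar br); rewrite -nmN.
  by rewrite (_ : - (T a - T b) = g a - g b - (a - b)) // /T; abel.
pose u n := iter n T x.
pose d := nm (y - g x); rewrite -/d in yr.
have d0 : 0 <= d by exact: nm_ge0.
pose p n : reals S := 2^-1 ^+ n.
have p0 n : 0 < p n by rewrite exprn_gt0 // invr_gt0.
have pS n : p n.+1 = p n / 2 by rewrite /p exprS mulrC.
have pd n : 0 <= d * p n by rewrite mulr_ge0// ltW.
have uH n : nm (u n - x) <= 2 * d * (1 - p n) /\ nm (u n.+1 - u n) <= d * p n.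
  elim: n => [|n [IH1 IH2]].
    rewrite /u /= /T subrr nm0 /p expr0 subrr mulr0 mulr1 lexx; split=> //.
    by rewrite (_ : x - g x + y - x = y - g x) //; abel.
  have E1 : nm (u n.+1 - x) <= 2 * d * (1 - p n.+1).
    by apply: le_trans (nm_tri (u n) _ _) _; rewrite pS; lra.
  split=> //; rewrite pS; have pdn := pd n.
  have un : nm (u n - x) < r by lra.
  have un1 : nm (u n.+1 - x) < r.
    by apply: le_lt_trans E1 _; rewrite pS; lra.
  by apply: le_trans (TH _ _ un1 un) _; lra.
have ur n : nm (u n - x) <= 2 * d by have := (uH n).1; have := pd n; lra.
have [|e e0|l lH] := @nested_limit S X u (fun n => 2 * d * p n).
- move=> n m /subnK <-.
  have uu k : nm (u (k + n)%N - u n) <= 2 * d * (p n - p (k + n)%N).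
    elim: k => [|k IH]; first by rewrite add0n !subrr nm0 mulr0.
    rewrite addSn; apply: le_trans (nm_tri (u (k + n)%N) _ _) _.
    by have := (uH (k + n)%N).2; rewrite pS; lra.
  by apply: le_trans (uu _) _; have := pd (m - n + n)%N; lra.
- exact: half_pow_small.
have lx : nm (l - x) <= 2 * d by have := lH 0; rewrite /p expr0 mulr1.
have lr : nm (l - x) < r by lra.
exists l => //; apply/eqP; rewrite eq_sym -subr_eq0 -nm_eq0 eq_le nm_ge0 andbT.
have -> : y - g l = T l - l by rewrite /T; abel.
apply/ler_addgt0Pr => e e0; rewrite add0r.
have [n ne] : exists n, 2 * d * p n < e := half_pow_small _ e0.
apply: le_trans (nm_tri (T (u n)) _ _) _.
have unr : nm (u n - x) < r by have := ur n; lra.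
have H1 := TH l (u n) lr unr; have H2 : nm (l - u n) <= 2 * d * p n := lH n.
have : nm (l - T (u n)) <= 2 * d * p n.+1 := lH n.+1.
by rewrite pS [nm (l - T _)]nmC; lra.
Qed.

(** The bound on the inverse is part of the data, so no open mapping theorem is called upon. *)
Definition invertible E F (D : E -> F) :=
  exists (L : F -> E) (C : reals S),
    [/\ cancel D L, cancel L D, 0 < C & forall w, nm (L w) <= C * nm w].

Lemma invertible_lin E F (D : {linear E -> F}) : invertible D ->
  exists (L : {linear F -> E}) (C : reals S),
    [/\ cancel D L, cancel L D, 0 < C & forall w, nm (L w) <= C * nm w].
Proof.
move=> [L [C [DL LD C0 LC]]].
have lL : linear L by apply: can2_linear DL LD.
by exists (mklin lL), C.
Qed.

Lemma invertible_comp E F G (D : E -> F) (D' : F -> G) :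
  invertible D -> invertible D' -> invertible (D' \o D).
Proof.
move=> [L [C [DL LD C0 LC]]] [L' [C' [DL' LD' C0' LC']]].
exists (L \o L'), (C * C'); split=> [x|y||w] /=.
- by rewrite DL' DL.
- by rewrite LD LD'.
- exact: mulr_gt0.
- by apply: le_trans (LC _) _; rewrite -mulrA ler_pM2l.
Qed.

Lemma inverse_continuity E F (U : set E) (f : E -> F) x :
  open U -> smooth_on U f -> U x -> forall (L : {linear F -> E}) (C : reals S),
  cancel 'd f x L -> 0 < C -> (forall w, nm (L w) <= C * nm w) ->
  forall e : reals S, 0 < e ->
  exists2 r : reals S, 0 < r & forall y, nm (y - x) < r ->
    forall u, nm (u - L ('d f y u)) <= e * nm u.
Proof.
move=> oU sf Ux L C DL C0 LC e e0.
have [|r r0 rH] := derivative_continuous oU sf Ux (e := e / C); first exact: divr_gt0.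
exists r => // y /rH[_ yH] u.
have -> : u - L ('d f y u) = L ('d f x u - 'd f y u) by rewrite linearB DL.
apply: le_trans (LC _) _; rewrite nmC.
have := yH u; rewrite -(ler_pM2l C0) => /le_trans; apply.
by rewrite mulrA [C * _]mulrC divfK ?gt_eqF.
Qed.

(** Induction through tangent maps: [tmap g] inverts [tmap f]. Each round needs that [g] is
    differentiable, that [tmap g] is continuous, and that the block triangular derivative of
    [tmap f] is invertible. Smoothness of [f] is assumed to all orders because it has to survive the
    passage to [tmap f]. *)
Lemma Ck_inverse n E F (f : E -> F) (g : F -> E) (U : set E) (V : set F) :
  open U -> open V -> smooth_on U f ->
  (forall x, U x -> V (f x)) -> (forall y, V y -> U (g y)) ->
  (forall x, U x -> g (f x) = x) -> (forall y, V y -> f (g y) = y) ->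
  (forall y, V y -> {for y, continuous g}) ->
  (forall x, U x -> invertible ('d f x)) -> Ck n V g.
Proof.
elim: n E F f g U V => [|n IH] E F f g U V oU oV sf UV VU gf fg cg df //=.
have dg y : V y -> differentiable g y /\ forall L : {linear F -> E}, cancel 'd f (g y) L -> cancel L ('d f (g y)) ->
    'd g y = L :> (F -> E).
  move=> Vy; have Ux := VU y Vy.
  suff H (L : {linear F -> E}) (C : reals S) : cancel 'd f (g y) L ->
      cancel L ('d f (g y)) -> 0 < C -> (forall w, nm (L w) <= C * nm w) ->
      differentiable g y /\ 'd g y = L :> (F -> E).
    have [L [C [DL LD C0 LC]]] := invertible_lin (df _ Ux).
    have [d1 d2] := H L C DL LD C0 LC; split=> // L' DL' LD'.
    by rewrite d2; apply/funext => w; rewrite -{1}(LD' w) DL.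
  move=> DL LD C0 LC; apply: nm_diff; first exact: bound_lin LC.
  move=> e e0.
  (* The first bound makes [g] Lipschitz at [y] with constant [2 * C]; the second turns the
     remainder of [f] into that of [g] with tolerance [e]. *)
  have [|//|e' e'0 [e'1 e'2]] := @below2 (1 / (2 * C)) (e / (2 * C * C)).
  - by rewrite divr_gt0 // mulr_gt0.
  - by rewrite divr_gt0 // !mulr_gt0.
  have {e'1}Ce1 : C * e' <= 1 / 2.
    by move: e'1; rewrite ler_pdivlMr ?mulr_gt0 //; lra.
  have {e'2}Ce2 : C * e' * (2 * C) <= e.
    by move: e'2; rewrite ler_pdivlMr ?mulr_gt0 //; lra.
  have [r1 r10 r1H] := diff_nm (smooth_on_diff sf Ux) e'0.
  have [r2 r20 r2H] := (continuous_nm g y).1 (cg y Vy) _ r10.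
  have [r3 r30 r3H] := (open_nm V).1 oV y Vy.
  exists (Num.min r2 r3) => [|z]; first by rewrite lt_min r20.
  rewrite lt_min => /andP[zr2 zr3]; have Vz := r3H z zr3.
  have := r1H (g z) (r2H z zr2); rewrite !fg // => H1.
  have H2 : nm (g z - g y - L (z - y)) <= C * e' * nm (g z - g y).
    rewrite -{1}(DL (g z - g y)) -linearB; apply: le_trans (LC _) _.
    by rewrite -mulrA ler_pM2l // [leLHS]nmC.
  have H3 : nm (g z - g y) <= 2 * C * nm (z - y).
    have := nm_split (g z - g y) (L (z - y)); have := LC (z - y).
    have := nm_ge0 (g z - g y); nra.
  apply: le_trans H2 _; apply: le_trans (_ : C * e' * (2 * C) * nm (z - y) <= _).
    by rewrite -[leRHS]mulrA ler_wpM2l // mulr_ge0 // ltW.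
  by rewrite ler_wpM2r // nm_ge0.
split=> [y /dg[]//|].
have df1 x : U x -> differentiable f x by exact: smooth_on_diff.
have Tgf p : (U `*` setT) p -> tmap g (tmap f p) = p.
  case: p => x v [/= Ux _]; rewrite /tmap /= gf //; congr (_, _).
  have [L [C [DL LD _ _]]] := invertible_lin (df _ Ux).
  by have [_ /(_ L)] := dg _ (UV x Ux); rewrite gf // => ->.
have dfg y w : V y -> 'd f (g y) ('d g y w) = w.
  move=> Vy; have [L [C [DL LD _ _]]] := invertible_lin (df _ (VU y Vy)).
  by have [_ /(_ _ DL LD) ->] := dg _ Vy.
have Tfg p : (V `*` setT) p -> tmap f (tmap g p) = p.
  by case: p => y w [/= Vy _]; rewrite /tmap /= fg // dfg.
apply: (IH _ _ (tmap f) (tmap g) (U `*` setT)) => //.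
- by apply: open_setX => //; exact: openT.
- by apply: open_setX => //; exact: openT.
- exact: smooth_on_tmap.
- by move=> [x v] [/= /UV].
- by move=> [y w] [/= /VU].
- move=> [y0 w0] [/= Vy0 _]; have Ux0 := VU _ Vy0.
  have [L [C [DL LD C0 LC]]] := invertible_lin (df _ Ux0).
  apply/continuous_nm => e e0.
  have n0 : 0 < nm w0 + 1 by rewrite ltr_wpDl // nm_ge0.
  (* [1 / 2] bounds ['d g y w] by [2 * C * nm w]. The second bound leaves half of [e] for moving [y]
     when [w] has norm at most [nm w0 + 1]; moving [w] takes the other half. *)
  have [||e' e'0 [e'1 e'2]] := @below2 (1 / 2) (e / (4 * C * (nm w0 + 1))).
  - by rewrite divr_gt0.
  - by rewrite divr_gt0 // !mulr_gt0.
  move: e'2; rewrite ler_pdivlMr ?mulr_gt0 // => e'2.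
  have [r1 r10 r1H] := inverse_continuity oU sf Ux0 DL C0 LC e'0.
  have [r2 r20 r2H] := (continuous_nm g y0).1 (cg _ Vy0) _ (r10 : 0 < r1).
  have [r3 r30 r3H] := (continuous_nm g y0).1 (cg _ Vy0) _ e0.
  have [r4 r40 r4H] := (open_nm V).1 oV y0 Vy0.
  have [||r5 r50 [r51 r52]] := @below2 1 (e / (2 * C)) => //.
    by rewrite divr_gt0 // mulr_gt0.
  exists (Num.min (Num.min r2 r3) (Num.min r4 r5)) => [|[y w]].
    by rewrite !lt_min r20 r30 r40.
  rewrite nm_pair_lt /= !lt_min => /andP[/andP[/andP[yr2 yr3] /andP[yr4 _]]].
  move=> /andP[_ /andP[_ wr5]].
  have wr1 := lt_le_trans wr5 r51.
  have := lt_le_trans wr5 r52.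
  rewrite ltr_pdivlMr ?mulr_gt0 // => wr2; rewrite nm_pair_lt /= r3H //=.
  have Vy := r4H y yr4; have := r1H (g y) (r2H y yr2) ('d g y w).
  rewrite dfg //; have [_ /(_ _ DL LD) ->] := dg _ Vy0; set u := 'd g y w => H1.
  have H2 : nm u <= 2 * C * nm w.
    have := nm_split u (L w); have := LC w; have := nm_ge0 u; nra.
  have H3 : nm w <= nm w0 + 1 by have := nm_split w w0; lra.
  have H4 : e' * nm u <= e' * (2 * C * (nm w0 + 1)).
    rewrite ler_pM2l //; apply: le_trans H2 _.
    by rewrite ler_pM2l // mulr_gt0.
  have := nm_tri (L w) u (L w0); rewrite -linearB; have := LC (w - w0).
  have := H1; have := e'2; lra.
- move=> [x v] [/= Ux _].
  have [L [C [DL LD C0 LC]]] := invertible_lin (df _ Ux).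
  have dT : differentiable (tmap f) (x, v).
    exact: (smooth_on_diff (smooth_on_tmap sf)).
  set P := 'd (tmap f) (x, v).
  have P1 q : (P q).1 = 'd f x q.1.
    by apply: diff_tmap1 => //; exact: df1.
  have P2 b : (P (0, b)).2 = 'd f x b.
    by apply: diff_tmap2 => //; exact: df1.
  (* Back substitution in the block triangular system: the first component is solved, its
     contribution to the second is subtracted. *)
  pose Q q := (L q.1, L (q.2 - (P (L q.1, 0)).2)).
  have Pq q : P q = ('d f x q.1, (P (q.1, 0)).2 + 'd f x q.2).
    case: q => a b; rewrite [LHS]surjective_pairing P1; congr (_, _) => /=.
    by rewrite -P2 -sndD -linearD; congr ((P (_, _)).2) => /=; rewrite ?addr0 ?add0r.
  have [B B0 BP] := lin_bound (diff_continuous dT).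
  exists Q, (C + C * (1 + B * C)); split.
  + by move=> [a b]; rewrite (Pq (a, b)) /Q /= DL [_ + _ - _]addrAC subrr add0r DL.
  + by move=> [a b]; rewrite Pq /Q /= !LD subrKC.
  + by rewrite ltr_pwDl // mulr_ge0 ?addr_ge0 ?mulr_ge0 ?ltW.
  + move=> [a b]; rewrite /Q /=.
    have H1 := LC a; have H2 := LC (b - (P (L a, 0)).2).
    have H3 := nmB b (P (L a, 0)).2; have H4 := nm_snd (P (L a, 0)).
    have N0 : nm (L a, 0 : E) = nm (L a) by rewrite nm_pair nm0 max_l ?nm_ge0.
    have := BP (L a, 0); rewrite -/P N0 => H5.
    have := nm_fst (a, b); have := nm_snd (a, b) => /= H6 H7.
    have H8 : B * nm (L a) <= B * C * nm a by rewrite -mulrA ler_pM2l.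
    have H9 : nm (b - (P (L a, 0)).2) <= (1 + B * C) * nm (a, b).
      have : B * C * nm a <= B * C * nm (a, b) by rewrite ler_pM2l ?mulr_gt0.
      lra.
    have H10 : C * nm (b - (P (L a, 0)).2) <= C * ((1 + B * C) * nm (a, b)).
      by rewrite ler_pM2l.
    have H11 : C * nm a <= C * nm (a, b) by rewrite ler_pM2l.
    have H12 := nm_ge0 (a, b).
    have H13 : 0 <= C * nm (a, b) by rewrite mulr_ge0 // ltW.
    have H14 : 0 <= C * ((1 + B * C) * nm (a, b)).
      apply: mulr_ge0 (ltW C0) _; apply: mulr_ge0 H12.
      by rewrite addr_ge0 // mulr_ge0 // ltW.
    by rewrite nm_pair_le; apply/andP; split; lra.
Qed.

End Inverse.

Section InverseFunction.
Context {S : scalars} {X : completeNormedModType S}.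

Lemma near_id_invertible (D : {linear X -> X}) :
  (forall v, nm (D v - v) <= nm v / 2) -> invertible D.
Proof.
move=> DH.
have H (r : reals S) (a b : X) : nm (a - 0) < r -> nm (b - 0) < r ->
    nm ((D a - D b) - (a - b)) <= nm (a - b) / 2.
  by move=> _ _; rewrite -linearB.
have DL y : exists a, D a = y.
  (* The estimate holds on balls of every radius; this one is large enough for its half to contain
     [y]. *)
  have r0 : 0 < 2 * nm y + 1 by rewrite ltr_wpDl // mulr_ge0 // nm_ge0.
  have [_ /(_ y)[|a _ <-]] := perturbed_identity r0 (H _); last by exists a.
  by rewrite linear0 subr0; lra.
have [L LP] := choice DL.
have nD v : nm v <= 2 * nm (D v).
  by have := nm_split v (D v); rewrite nmC; have := DH v; lra.
have Dinj : injective D.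
  move=> a b Dab; apply/eqP; rewrite -subr_eq0 -nm_eq0 eq_le nm_ge0 andbT.
  by have := nD (a - b); rewrite linearB Dab subrr nm0 mulr0.
exists L, 2; split=> // [v|w]; first by apply: Dinj; rewrite LP.
by have := nD (L w); rewrite LP.
Qed.

(** The bound on ['d f x v - v] over the whole ball, with a prescribed [e], is kept in the
    conclusion because the tangency of D to the plaques is read off from it. *)
Lemma local_inverse (f : X -> X) (U : set X) x0 :
  open U -> smooth_on U f -> U x0 -> (forall v, 'd f x0 v = v) ->
  forall e : reals S, 0 < e ->
  exists (r : reals S) (g : X -> X) (V : set X),
  [/\ 0 < r, open V /\ smooth_on V g,
      (forall x, nm (x - x0) < r -> [/\ U x, V (f x), g (f x) = x &
         forall v, nm ('d f x v - v) <= e * nm v]) &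
      forall y, V y -> nm (g y - x0) < r /\ f (g y) = y].
Proof.
move=> oU sf Ux0 f0 e0 e00.
have [||e ee0 [ee e2]] := @below2 S e0 (1 / 2) => //.
have [r r0 rH] := derivative_continuous oU sf Ux0 ee0.
have dH x v : nm (x - x0) < r -> nm ('d f x v - v) <= e * nm v.
  by move=> /rH[_ /(_ v)]; rewrite f0.
have dH2 x v : nm (x - x0) < r -> nm ('d f x v - v) <= nm v / 2.
  move=> xr; apply: le_trans (dH x v xr) _.
  by rewrite [leRHS]mulrC ler_wpM2r ?nm_ge0 //; lra.
pose k x := f x - x.
have kH x : nm (x - x0) < r -> differentiable k x /\
    forall v, nm ('d k x v) <= 1 / 2 * nm v.
  move=> xr; have df := smooth_on_diff sf (rH x xr).1.
  have dk : differentiable k x by exact: differentiableB.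
  split=> // v; rewrite (_ : 'd k x v = 'd f x v - v); first by have := dH2 x v xr; lra.
  have did : differentiable (@id X) x by [].
  have /(congr1 (@^~ v)) := diffB df did.
  by rewrite /= diff_val.
have fH x s : nm (x - x0) + s <= r -> forall a b, nm (a - x) < s -> nm (b - x) < s ->
    nm ((f a - f b) - (a - b)) <= nm (a - b) / 2.
  move=> xs a b ax bx.
  rewrite (_ : f a - f b - (a - b) = k a - k b); last by rewrite /k; abel.
  rewrite [leRHS]mulrC -[2^-1]mul1r; apply: mean_value => t /andP[t0 t1].
  apply: kH.
  rewrite (_ : _ - x0 = (io S (1 - t) *: (b - x) + io S t *: (a - x)) + (x - x0)); last first.
    rewrite rmorphB rmorph1 scalerBl scale1r !scalerBr; abel.
  apply: le_lt_trans (nmD _ _) _; apply: le_lt_trans (lerD (nmD _ _) (lexx _)) _.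
  rewrite !nmZ !ger0_norm ?subr_ge0 //.
  have : (1 - t) * nm (b - x) + t * nm (a - x) < s; last lra.
  (* At least one of the weights [t], [1 - t] is bounded below by one half, which makes the convex
     combination strictly smaller than [s]. *)
  by have [t12|t12] := leP t (1 / 2); nra.
have r0' : nm (x0 - x0) + r <= r by rewrite subrr nm0 add0r.
have [finj _] := perturbed_identity r0 (fH x0 r r0').
pose B := [set x | nm (x - x0) < r].
pose V := f @` B.
have oV : open V.
  apply/open_nm => _ [x /= xr <-].
  have s0 : 0 < r - nm (x - x0) by rewrite subr_gt0.
  have [|_ sH] := perturbed_identity s0 (fH x _ _); first by rewrite subrKC.
  exists ((r - nm (x - x0)) / 2) => [|y /sH[a ax <-]]; first by rewrite divr_gt0.
  by exists a => //; rewrite /B /=; have := nm_tri x a x0; lra.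
have fI a b : B a -> B b -> f a = f b -> a = b.
  move=> Ba Bb fab; apply/eqP; rewrite -subr_eq0 -nm_eq0 eq_le nm_ge0 andbT.
  by have := finj a b Ba Bb; rewrite fab subrr nm0 mulr0.
have [g gP] : exists g, forall y, V y -> B (g y) /\ f (g y) = y.
  have /choice[g gP] : forall y, exists x, V y -> B x /\ f x = y.
    move=> y; have [[x Bx fx]|nV] := pselect (V y); first by exists x.
    by exists x0 => /nV.
  by exists g.
have gf x : B x -> g (f x) = x.
  by move=> Bx; have [|Bg fg] := gP (f x); [by exists x|exact: fI].
have oB : open B by exact: open_ball_nm.
have sfB : smooth_on B f by apply: smooth_on_sub sf => x /rH[].
exists r, g, V; split=> //.
  split=> // n; apply: (@Ck_inverse S n X X f g B V) => //.
  - by move=> x Bx; exists x.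
  - by move=> y /gP[].
  - by move=> y /gP[].
  - move=> y Vy; apply/continuous_nm => d d0.
    have [s s0 sV] := (open_nm V).1 oV y Vy.
    have [||q q0 [qs qd]] := @below2 S s (d / 2) => //; first by rewrite divr_gt0.
    exists q => // z zq; have Vz := sV z (lt_le_trans zq qs).
    have [Bz fz] := gP z Vz; have [By fy] := gP y Vy.
    by have := finj _ _ Bz By; rewrite fz fy; lra.
  - by move=> x Bx; apply: near_id_invertible => v; exact: dH2.
move=> x Bx; split=> //; [by case: (rH x Bx)|by exists x|exact: gf|].
by move=> v; apply: le_trans (dH x v Bx) _; rewrite ler_wpM2r ?nm_ge0.
Qed.

End InverseFunction.

(** Continuity is bundled with the map because the completeness of [kernel_space f], a canonical
    instance on that type, depends on it. Such kernels serve as the models of leaves and of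
    transversals. *)
Record clin (K : numFieldType) (E F : normedModType K) := Clin {
  clin_fun :> {linear E -> F};
  clin_cont : continuous clin_fun }.

Section KernelSpace.
Context {K : numFieldType} {X : completeNormedModType K} (f : clin X X).

Record kernel_space := KernelSpace {
  kval : X;
  kvalP : f kval == 0 }.

HB.instance Definition _ := [isSub for kval].
HB.instance Definition _ := [Choice of kernel_space by <:].

Fact kernel_submod_closed : submod_closed [pred x | f x == 0].
Proof.
split=> [|a x y]; rewrite !inE ?linear0// => /eqP fx /eqP fy.
by rewrite linearP fx fy scaler0 addr0.
Qed.

HB.instance Definition _ :=
  GRing.SubChoice_isSubLmodule.Build K X [pred x | f x == 0] kernel_space
    kernel_submod_closed.

Let knorm (x : kernel_space) := `|kval x|.

Fact knormD x y : knorm (x + y) <= knorm x + knorm y.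
Proof. exact: ler_normD. Qed.

Fact knormZ (l : K) x : knorm (l *: x) = `|l| * knorm x.
Proof. exact: normrZ. Qed.

Fact knorm_eq0 x : knorm x = 0 -> x = 0.
Proof. by move=> /normr0_eq0 x0; exact: val_inj. Qed.

HB.instance Definition _ := @Lmodule_isNormed.Build K kernel_space knorm
  knormD knormZ knorm_eq0.

Fact kernel_cauchy_cvg (G : set_system kernel_space) :
  ProperFilter G -> cauchy G -> cvg G.
Proof.
move=> PG /cauchyP Gc.
have cG : cauchy (kval @ G).
  apply: cauchy_exP => e e0; have [x Gx] := Gc e e0; exists (kval x).
  suff : G [set y | ball (kval x) e (kval y)] by [].
  apply: filterS Gx => y xy; have {}xy : ball x e y := xy; rewrite -ball_normE in xy.
  by rewrite /= -ball_normE; exact: xy.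
have /cvg_ex[l Gl] : cvg (kval @ G) by exact: cauchy_cvg cG.
have fl : f l == 0.
  have c1 : f \o kval @ G --> f l by apply: cvg_comp Gl _; exact: clin_cont.
  have c2 : f \o kval @ G --> (0 : X).
    rewrite (_ : f \o kval = cst 0); first exact: cvg_cst.
    by apply/funext => x /=; apply/eqP; exact: kvalP.
  by apply/eqP; apply: cvg_unique c1 c2; exact: norm_hausdorff.
apply/cvg_ex; exists (KernelSpace fl); apply/cvgrPdist_lt => e e0.
by move/cvgrPdist_lt : Gl; exact.
Qed.
HB.instance Definition _ := Uniform_isComplete.Build kernel_space kernel_cauchy_cvg.

Lemma kval_lin : linear (kval : kernel_space -> X). Proof. by []. Qed.

Lemma kvalE (x : kernel_space) : f (kval x) = 0.
Proof. exact/eqP/kvalP. Qed.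

Lemma kval_inj : injective kval.
Proof. exact: val_inj. Qed.
End KernelSpace.

(** * The algebra in charts *)

Section ChartCalculus.
Context {K : numFieldType}.
Implicit Types M N : atlas K.

Lemma open_dom M (i : index M) : open (dom (chart_of i) : set M).
Proof. by move=> j; case: (atlas_compat j i). Qed.

Lemma transition_smooth M (i j : index M) :
  smooth_on (cod (chart_of i) `&` bwd (chart_of i) @^-1` dom (chart_of j))
    (fwd (chart_of j) \o bwd (chart_of i)).
Proof. by case: (atlas_compat i j). Qed.

Lemma open_chart_preimage M (i : index M) (O : set M) : open O ->
  open (cod (chart_of i) `&` bwd (chart_of i) @^-1` O).
Proof. by move=> oO; exact: (oO i). Qed.

Lemma chart_open_image M (i : index M) (A : set (model i)) :
  open A -> A `<=` cod (chart_of i) -> open (bwd (chart_of i) @` A : set M).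
Proof.
move=> oA AC; rewrite open_atlasE => j.
have -> : cod (chart_of j) `&` bwd (chart_of j) @^-1` (bwd (chart_of i) @` A) =
    (cod (chart_of j) `&` bwd (chart_of j) @^-1` dom (chart_of i)) `&`
      (fwd (chart_of i) \o bwd (chart_of j)) @^-1` A.
  apply/seteqP; split=> [y [yj [x Ax /= xy]]|y [[yj yi] /= Ay]].
    by rewrite /= -xy; split; [split=> //=; exact/bwd_dom/AC|rewrite bwdK//; exact: AC].
  by split=> //; exists (fwd (chart_of i) (bwd (chart_of j) y)); rewrite ?fwdK.
have [oji sji] := atlas_compat j i.
rewrite openE => y [yji Ay]; apply: filterI; first exact: open_nbhs_nbhs.
by apply: (smooth_on_cont sji yji); exact: open_nbhs_nbhs.
Qed.

Lemma smooth_map_rep_open M N (f : M -> N) (i : index M) (j : index N) :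
  smooth_map f -> open (cod (chart_of i) `&` bwd (chart_of i) @^-1`
    (f @^-1` dom (chart_of j))).
Proof.
move=> [cf _]; apply: open_chart_preimage.
by apply: open_comp; [move=> x _; exact: cf|exact: open_dom].
Qed.

Lemma smooth_map_rep M N (f : M -> N) (i : index M) (j : index N) :
  smooth_map f -> smooth_on (cod (chart_of i) `&` bwd (chart_of i) @^-1`
    (f @^-1` dom (chart_of j))) (fwd (chart_of j) \o f \o bwd (chart_of i)).
Proof. by move=> [_ /(_ i j)]; rewrite setTI. Qed.

(** Tangent maps are defined through the preferred charts; the chain rule lets them be computed in
    any charts [i] and [j]. *)
Lemma chart_chain M N (f : M -> N) (i k : index M) (m j : index N) (p : M) :
  smooth_map f -> dom (chart_of i) p -> dom (chart_of k) p ->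
  dom (chart_of m) (f p) -> dom (chart_of j) (f p) -> forall v,
  'd (fwd (chart_of j) \o bwd (chart_of m)) (fwd (chart_of m) (f p))
    ('d (fwd (chart_of m) \o f \o bwd (chart_of k)) (fwd (chart_of k) p)
      ('d (fwd (chart_of k) \o bwd (chart_of i)) (fwd (chart_of i) p) v)) =
  'd (fwd (chart_of j) \o f \o bwd (chart_of i)) (fwd (chart_of i) p) v.
Proof.
move=> sf pi pk fm fj v.
have d1 : differentiable (fwd (chart_of k) \o bwd (chart_of i)) (fwd (chart_of i) p).
  by apply: (smooth_on_diff (transition_smooth i k)); split;
    [exact: fwd_cod|rewrite /= fwdK].
have E1 : (fwd (chart_of k) \o bwd (chart_of i)) (fwd (chart_of i) p) =
  fwd (chart_of k) p by rewrite /= fwdK.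
have d2 : differentiable (fwd (chart_of m) \o f \o bwd (chart_of k))
    ((fwd (chart_of k) \o bwd (chart_of i)) (fwd (chart_of i) p)).
  rewrite E1; apply: (smooth_on_diff (smooth_map_rep k m sf)); split;
    [exact: fwd_cod|by rewrite /= fwdK].
have E2 : (fwd (chart_of m) \o f \o bwd (chart_of k))
  ((fwd (chart_of k) \o bwd (chart_of i)) (fwd (chart_of i) p)) =
  fwd (chart_of m) (f p) by rewrite E1 /= fwdK.
have d3 : differentiable (fwd (chart_of j) \o bwd (chart_of m))
   ((fwd (chart_of m) \o f \o bwd (chart_of k))
    ((fwd (chart_of k) \o bwd (chart_of i)) (fwd (chart_of i) p))).
  rewrite E2; apply: (smooth_on_diff (transition_smooth m j)); split;
    [exact: fwd_cod|by rewrite /= fwdK].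
have d21 := differentiable_comp d1 d2.
have C2 : 'd (fwd (chart_of m) \o f \o bwd (chart_of k)) (fwd (chart_of k) p)
      ('d (fwd (chart_of k) \o bwd (chart_of i)) (fwd (chart_of i) p) v) =
   'd ((fwd (chart_of m) \o f \o bwd (chart_of k)) \o
       (fwd (chart_of k) \o bwd (chart_of i))) (fwd (chart_of i) p) v.
  by rewrite (diff_comp d1 d2) /= fwdK.
rewrite C2 -E2.
have -> : 'd (fwd (chart_of j) \o bwd (chart_of m))
    ((fwd (chart_of m) \o f \o bwd (chart_of k))
       ((fwd (chart_of k) \o bwd (chart_of i)) (fwd (chart_of i) p)))
    ('d ((fwd (chart_of m) \o f \o bwd (chart_of k)) \o
         (fwd (chart_of k) \o bwd (chart_of i))) (fwd (chart_of i) p) v) =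
    'd ((fwd (chart_of j) \o bwd (chart_of m)) \o
     ((fwd (chart_of m) \o f \o bwd (chart_of k)) \o
       (fwd (chart_of k) \o bwd (chart_of i)))) (fwd (chart_of i) p) v.
  by rewrite (diff_comp d21 d3).
have d321 := differentiable_comp d21 d3.
suff fg : {near fwd (chart_of i) p,
    ((fwd (chart_of j) \o bwd (chart_of m)) \o
     ((fwd (chart_of m) \o f \o bwd (chart_of k)) \o
       (fwd (chart_of k) \o bwd (chart_of i)))) =1
    fwd (chart_of j) \o f \o bwd (chart_of i)}.
  by have [_ ->] := near_eq_diff fg d321.
pose W := (cod (chart_of i) `&` bwd (chart_of i) @^-1` dom (chart_of k)) `&`
   (cod (chart_of i) `&` bwd (chart_of i) @^-1` (f @^-1` dom (chart_of m))).
apply: (@open_nbhs_eq _ _ W).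
- by apply: openI; [case: (atlas_compat i k)|exact: smooth_map_rep_open].
- by move=> y [[yi yk] [_ ym]]; rewrite /= !fwdK.
- by split; split; rewrite /= ?fwdK //; exact: fwd_cod.
Qed.

End ChartCalculus.

Section AlgebraInCharts.
Context {K : numFieldType} {M : atlas K}.
Variable (h : tangent_bundle M -> M).
Hypothesis alg_h : tangent_algebra h.

Let smooth_h : smooth_map h. Proof. by case: alg_h. Qed.

Definition hloc (i : index M) (q : model i * model i) : M := h (tangent_bwd q).
Arguments hloc : clear implicits.

(** Two charts are needed, since [h (x, v)] may lie far away from [x]. *)
Definition hrep (i j : index M) (q : model i * model i) : model j :=
  fwd (chart_of j) (hloc i q).
Arguments hrep : clear implicits.

Definition hdom (i j : index M) : set (model i * model i) :=
  [set q | cod (chart_of i) q.1 /\ dom (chart_of j) (hloc i q)].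
Arguments hdom : clear implicits.

Lemma hdomE i j : hdom i j = @cod K _ _ (@chart_of K (tangent_bundle M) i) `&`
   bwd (@chart_of K (tangent_bundle M) i) @^-1` (h @^-1` dom (chart_of j)).
Proof. by apply/seteqP; split=> [[x v] [? ?]|[x v] [[? _] ?]]. Qed.

Lemma open_hdom i j : open (hdom i j).
Proof. by rewrite hdomE; exact: (@smooth_map_rep_open K (tangent_bundle M) M h i j). Qed.

Lemma hrep_smooth i j : smooth_on (hdom i j) (hrep i j).
Proof. by rewrite hdomE; exact: (@smooth_map_rep K (tangent_bundle M) M h i j). Qed.

Lemma hloc0 i (x : model i) : cod (chart_of i) x -> hloc i (x, 0) = bwd (chart_of i) x.
Proof.
case: alg_h => _ h0 _ xi; rewrite -[RHS]h0 /hloc /tangent_bwd /=.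
by rewrite /tangent_vector linear0.
Qed.

Lemma diff_bwd_proj (i k : index M) (x v u u' : model i) : cod (chart_of i) x ->
  dom (chart_of k) (bwd (chart_of i) x) ->
  ('d (tangent_fwd k \o tangent_bwd (i := i)) (x, v) (u, u')).1 =
  'd (fwd (chart_of k) \o bwd (chart_of i)) x u.
Proof.
move=> xi xk; set T := tangent_fwd k \o tangent_bwd (i := i).
have Txv : (cod (@chart_of K (tangent_bundle M) i) `&`
    bwd (@chart_of K (tangent_bundle M) i) @^-1`
    dom (@chart_of K (tangent_bundle M) k)) (x, v) by [].
have dT : differentiable T (x, v).
  exact: (smooth_on_diff (@transition_smooth K (tangent_bundle M) i k) Txv).
have := diff_comp dT (diff_fst _).1; rewrite (diff_fst _).2.
move=> /(congr1 (@^~ (u, u'))) /= <-.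
have dt : differentiable (fwd (chart_of k) \o bwd (chart_of i)) (x, v).1.
  by apply: (smooth_on_diff (transition_smooth i k)).
have := diff_comp (diff_fst (x, v)).1 dt; rewrite (diff_fst _).2.
by move=> /(congr1 (@^~ (u, u'))) /= <-.
Qed.

(** This is the algebra law at the vector of T(TM) over [(x, v)] with coordinates [(u, u')]. The
    derivative of the projection returns [u], so [tangent_mu] adds [u] to [v], whatever [u'] is. *)
Lemma hloc_algebra (i j : index M) (q : model i * model i) (u u' : model i) : hdom i j q ->
  hloc j (hrep i j q, 'd (hrep i j) q (u, u')) = hloc i (q.1, q.2 + u).
Proof.
case: q => x v [/= xi xj]; have [_ _ hh] := alg_h.
pose p : tangent_bundle M := tangent_bwd (x, v).
pose k := chart_at (bwd (chart_of i) x).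
have xk : dom (chart_of k) (bwd (chart_of i) x) by exact: chart_at_dom.
pose z : tangent_space p := 'd (tangent_fwd k \o tangent_bwd (i := i)) (x, v) (u, u').
pose xi_ : tangent_bundle (tangent_bundle M) := tangent_pt z.
have := hh xi_.
have -> : tangent_mu xi_ = tangent_bwd (x, v + u).
  rewrite /tangent_mu /tangent_bwd /tangent_pt /=; congr existT.
  rewrite /tangent_vector linearD; congr (_ + _).
  rewrite -(diff_bwd_proj v u u' xi xk) -/z.
  have [dfst fstE] := diff_fst (tangent_fwd k p).
  have fg : {near tangent_fwd k p, @fst (model k) (model k) =1
      fwd (chart_of k) \o @tangent_proj K M \o tangent_bwd (i := k)}.
    apply: (@open_nbhs_eq _ _ (cod (chart_of k) `*` setT)).
    - exact: tangent_cod_open.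
    - by move=> [a b] [/= ak _]; rewrite bwdK.
    - by split=> //; exact: fwd_cod.
  have [_ fgE] := near_eq_diff fg dfst.
  transitivity ('d (@fst (model k) (model k)) (tangent_fwd k p) z).
    exact: (congr1 (@^~ z) fgE).
  exact: (congr1 (@^~ z) fstE).
move=> hE; apply: etrans hE; rewrite /hloc; congr h.
have P1 : dom (chart_of j) (h p) by [].
have := tangent_fwdK (i := j) (p := tangent_map h xi_) P1.
move=> <-; congr (tangent_bwd _); rewrite /tangent_fwd; congr (_, _).
have /(_ (u, u')) := @chart_chain K (tangent_bundle M) M h i k
  (chart_at (h p)) j p smooth_h (bwd_dom xi) xk (chart_at_dom _) P1.
have E : @fwd K _ _ (@chart_of K (tangent_bundle M) i) p = (x, v).
  exact: (@tangent_bwdK K M i (x, v)).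
by rewrite E => <-.
Qed.

Lemma accessible_hloc i m : dom (chart_of i) m ->
  accessible_set h m = range (fun v => hloc i (fwd (chart_of i) m, v)).
Proof.
move=> mi; apply/seteqP; split=> [_ [w _ <-]|_ [v _ <-]].
  exists (tangent_coord i (w : tangent_space m)) => //.
  by rewrite /hloc /algebra_fiber; congr h; exact: (@tangent_fwdK K M i (tangent_pt w)).
rewrite /hloc /tangent_bwd /=; set y := bwd _ _.
(* The vector lies over [y], which equals [m] only propositionally, so it is transported along this
   equality. *)
have : y = m by rewrite /y fwdK.
move: (tangent_vector _ _); rewrite -/y => w ym; case: _ / ym w => w.
by exists w.
Qed.

Lemma tangent_bwd_chart_at (m : M) (v : tangent_space m) :
  tangent_bwd (fwd (chart_of (chart_at m)) m, v) = tangent_pt v :> tangent_bundle M.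
Proof.
rewrite -[RHS](@tangent_fwdK K M (chart_at m)) //=; last exact: chart_at_dom.
congr (tangent_bwd (_, _)) => /=.
by rewrite /tangent_coord transition_id //; exact: chart_at_dom.
Qed.

Lemma fiber_hloc (m : M) (v : tangent_space m) :
  algebra_fiber h v = hloc (chart_at m) (fwd (chart_of (chart_at m)) m, v).
Proof. by rewrite /hloc tangent_bwd_chart_at. Qed.

Lemma hrep_diff0 (i j : index M) (x : model i) u : hdom i j (x, 0) ->
  'd (hrep i j) (x, 0) (u, 0) = 'd (fwd (chart_of j) \o bwd (chart_of i)) x u.
Proof.
move=> ijx; have [dl lE] := has_diff_inl x (0 : model i).
have dh := smooth_on_diff (hrep_smooth i j) ijx.
have xi : cod (chart_of i) x by case: ijx.
rewrite -(lE u); apply: etrans (esym (congr1 (@^~ u) (diff_comp dl dh))) _.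
have dc := differentiable_comp dl dh.
have fg : {near x, hrep i j \o (fun a => (a, 0)) =1
    fwd (chart_of j) \o bwd (chart_of i)}.
  apply: (open_nbhs_eq (cod_open (chart_of i))) => // y yi.
  by rewrite /= /hrep hloc0.
by have [_ fgE] := near_eq_diff fg dc; exact/esym/(congr1 (@^~ u) fgE).
Qed.

Definition anchor (i : index M) (x u : model i) : model i :=
  'd (hrep i i) (x, 0) (0, u).
Arguments anchor : clear implicits.

Lemma hdom0 (i j : index M) x : cod (chart_of i) x ->
  dom (chart_of j) (bwd (chart_of i) x) -> hdom i j (x, 0).
Proof. by move=> xi xj; split=> //=; rewrite hloc0. Qed.

Lemma hdom00 (i : index M) x : cod (chart_of i) x -> hdom i i (x, 0).
Proof. by move=> xi; apply: hdom0 => //; exact: bwd_dom. Qed.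

Lemma algebra_anchorE (m : M) u :
  algebra_anchor h m u = anchor (chart_at m) (fwd (chart_of (chart_at m)) m) u.
Proof.
pose c := chart_at m; pose x := fwd (chart_of c) m.
have xc : cod (chart_of c) x by apply/fwd_cod/chart_at_dom.
have [dr rE] := has_diff_inr x (0 : model c).
have dh := smooth_on_diff (hrep_smooth c c) (hdom00 xc).
rewrite /anchor -(rE u); apply: etrans (congr1 (@^~ u) (diff_comp dr dh)).
rewrite /algebra_anchor; congr ('d _ _ _); apply/funext => v /=.
by rewrite /hrep -fiber_hloc.
Qed.

(** The anchor is the derivative of the submersion followed by that of the immersion. A right
    inverse of the former composed with a left inverse of the latter is a generalized inverse, and
    it is through [G] that tameness enters the proof. *)
Lemma tame_split (m : M) : tame h ->
  exists2 G : {linear tangent_space m -> tangent_space m}, continuous G &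
    forall u, algebra_anchor h m (G (algebra_anchor h m u)) = algebra_anchor h m u.
Proof.
case/(_ m)=> O [P] [s] [im] [[oO O0] [ss subs] [si imi] fE].
have E : im (s 0) = m.
  by rewrite -fE //; case: alg_h => _ h0 _; exact: h0.
pose c := chart_at m; pose k := chart_at (s 0).
have [t ct tK] := subs 0 O0; have := imi (s 0).
rewrite /immersion_at /tangent_at E -/c -/k => -[r cr rK].
have sk : dom (chart_of k) (s 0) by exact: chart_at_dom.
have sO : open_nbhs (0 : banach_atlas (tangent_space m)) O by [].
have cs : {for (0 : banach_atlas (tangent_space m)), continuous s} by exact: ss.1.
have : nbhs (0 : banach_atlas (tangent_space m)) (O `&` s @^-1` dom (chart_of k)).
  apply: filterI; first exact: open_nbhs_nbhs.
  by apply: cs; apply: open_nbhs_nbhs; split=> //; exact: open_dom.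
rewrite nbhsE => -[U [oU U0] UO].
have {}oU : open (U : set (model c)).
  have := oU tt; rewrite /= preimage_id setTI; exact.
have dS : differentiable (fwd (chart_of k) \o s) (0 : model c).
  exact: (smooth_on_diff (ss.2 tt k)).
have dI : differentiable (fwd (chart_of c) \o im \o bwd (chart_of k))
    ((fwd (chart_of k) \o s) 0).
  apply: (smooth_on_diff (smooth_map_rep k c si)); split => /=.
    exact: fwd_cod.
  by rewrite fwdK // E; exact: chart_at_dom.
have AE u : algebra_anchor h m u =
    'd (fwd (chart_of c) \o im \o bwd (chart_of k)) (fwd (chart_of k) (s 0))
      ('d (fwd (chart_of k) \o s) (0 : model c) u).
  apply: etrans (congr1 (@^~ u) (diff_comp dS dI)).
  have fg : {near (0 : model c),
      (fwd (chart_of c) \o im \o bwd (chart_of k)) \o (fwd (chart_of k) \o s) =1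
      fwd (chart_of c) \o algebra_fiber h (x := m)}.
    by apply: (open_nbhs_eq oU) => // y /UO[Oy sy]; rewrite /= fwdK // fE.
  have [_ fgE] := near_eq_diff fg (differentiable_comp dS dI).
  exact: (congr1 (@^~ u) fgE).
pose G := t \o r.
have lG : linear G by move=> a x y; rewrite /G /= !linearP.
exists (mklin lG) => [x|u]; first by apply: continuous_comp; [exact: cr|exact: ct].
rewrite !AE.
have GE : mklin lG ('d (fwd (chart_of c) \o im \o bwd (chart_of k))
    (fwd (chart_of k) (s 0)) ('d (fwd (chart_of k) \o s) (0 : model c) u)) =
    t ('d (fwd (chart_of k) \o s) (0 : model c) u) := congr1 t (rK _).
rewrite GE; congr ('d _ _ _); exact: tK.
Qed.

End AlgebraInCharts.

Arguments hloc {K M} h i q.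
Arguments hrep {K M} h i j q.
Arguments hdom {K M} h i j _.
Arguments anchor {K M} h i x u.

Lemma hrepE (K : numFieldType) (M : atlas K) (h : tangent_bundle M -> M)
    (i j : index M) q : hrep h i j q = fwd (chart_of j) (hloc h i q).
Proof. by []. Qed.

Lemma anchorE (K : numFieldType) (M : atlas K) (h : tangent_bundle M -> M)
    (i : index M) x u : anchor h i x u = 'd (hrep h i i) (x, 0) (0, u).
Proof. by []. Qed.

Section LocalAlgebra.
Context {S : scalars} {M : atlas S}.
Variable (h : tangent_bundle M -> M).
Hypothesis alg_h : tangent_algebra h.

Local Notation hloc := (hloc h).
Local Notation hrep := (hrep h).
Local Notation hdom := (hdom h).
Local Notation anchor := (anchor h).

Lemma hrep_diff i j q : hdom i j q -> differentiable (hrep i j) q.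
Proof. exact: (smooth_on_diff (hrep_smooth alg_h i j)). Qed.

Lemma hrep0 i x : cod (chart_of i) x -> hrep i i (x, 0) = x.
Proof. by move=> xi; rewrite !hrepE hloc0 // bwdK. Qed.

Lemma hrep_diff_id i x w : cod (chart_of i) x -> 'd (hrep i i) (x, 0) (w, 0) = w.
Proof.
move=> xi; rewrite hrep_diff0 //; last exact: hdom00.
by have := transition_id (bwd_dom xi) w; rewrite bwdK.
Qed.

(** Both sides are derivatives at [v = 0] in direction [u] of the two members of [hloc_algebra],
    with [v] as the added vector; the left member moves in the fibre over [h q]. *)
Lemma anchor_partial i j q u : hdom i j q ->
  anchor j (hrep i j q) ('d (hrep i j) q (u, 0)) = 'd (hrep i j) q (0, u).
Proof.
move=> qij; have [qi qj] := qij; pose y := hrep i j q.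
have yD : hdom j j (y, 0) by apply: hdom00 => //; exact: fwd_cod.
have dh := has_diffP (hrep_diff qij); have dy := has_diffP (hrep_diff yD).
have lD : linear (fun u : model i => 'd (hrep i j) q (u, 0)).
  by move=> a u1 u2; rewrite -linearP -(inl_lin _ a u1 u2).
have cD : continuous (mklin lD).
  move=> v; apply: (@continuous_comp _ _ _ (fun u => (u, 0)) ('d (hrep i j) q)).
    exact: continuous_inl.
  exact: diff_continuous dh.1 _.
have e0 : (pair y \o mklin lD) 0 = (y, 0) := congr1 (pair y) (linear0 (mklin lD)).
have d1 := has_diff_comp (has_diff_comp (has_diff_lin 0 cD) (linear0 _)
  (has_diff_inr y 0)) e0 dy.
have d2 : has_diff (hrep i j \o (fun v => (q.1, q.2 + v))) 0
    (fun v => 'd (hrep i j) q (0, v)).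
  apply: (has_diff_comp (has_diff_comp (has_diff_addl q.2 0) (addr0 _)
    (has_diff_inr q.1 q.2))) dh.
  by rewrite /= addr0 -surjective_pairing.
move: d1; rewrite (_ : hrep j j \o _ = hrep i j \o (fun v => (q.1, q.2 + v))).
  by move=> d1; exact: has_diff_uniq d1 d2.
apply/funext => v; rewrite /= !hrepE; congr (fwd _ _).
exact: (hloc_algebra alg_h v 0 qij).
Qed.

(** The mixed second derivative of [hrep i i] at [(x, 0)] in the directions [(0, u)] and [(w, 0)],
    read off from the tangent map of its tangent map. *)
Definition remainder i (x w u : model i) : model i :=
  ('d (tmap (hrep i i)) ((x, 0), (w, 0)) ((0, u), (0, 0))).2.
Arguments remainder : clear implicits.

Lemma remainder_lin i x w : linear (remainder i x w).
Proof.
move=> a u v; rewrite /remainder.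
have -> : ((0, a *: u + v), (0, 0)) = a *: ((0, u), (0, 0)) + ((0, v), (0, 0)) :>
    (model i * model i) * (model i * model i).
  transitivity ((a *: (0 : model i) + 0, a *: u + v),
    (a *: (0 : model i) + 0, a *: (0 : model i) + 0)) => //.
  by rewrite scaler0 addr0.
by rewrite linearP.
Qed.

(* Differentiating [h (h (x, v)) (d_x h (x, v) w) = h (x, v + w)] in [v] at
   [v = 0]. *)
Lemma anchor_transport i j x w u : cod (chart_of i) x -> hdom i j (x, w) ->
  'd (hrep i j) (x, w) (anchor i x u, 0) =
  'd (hrep i j) (x, w) (0, u - remainder i x w u).
Proof.
move=> xi xwj; have xD := hdom00 alg_h xi.
have dT : differentiable (tmap (hrep i i)) ((x, 0), (w, 0)).
  by apply: (smooth_on_diff (smooth_on_tmap (hrep_smooth alg_h i i))).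
have T0 : tmap (hrep i i) ((x, 0), (w, 0)) = (x, w).
  by rewrite /tmap /= hrep0 // hrep_diff_id.
have d1 := has_diff_comp (has_diff_comp (has_diff_pair (has_diff_inr x (0 : model i))
  (has_diff_cst (w, 0 : model i) (0 : model i))) erefl (has_diffP dT)) T0
  (has_diffP (hrep_diff xwj)).
have d2 : has_diff (hrep i j \o (fun v => (x, w + v))) 0
    (fun v => 'd (hrep i j) (x, w) (0, v)).
  apply: (has_diff_comp (has_diff_comp (has_diff_addl w 0) (addr0 _)
    (has_diff_inr x w))) (has_diffP (hrep_diff xwj)).
  by rewrite /= addr0.
have oU : open [set v | hdom i i (x, v)].
  apply: (@open_comp _ _ (fun v => (x, v)) (hdom i i)); last exact: open_hdom.
  by move=> v _; exact: continuous_inr.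
have /= E := has_diff_uniq u d2 (has_diff_near oU xD (_ : forall v, _ -> _ = _) d1).
have {}E : 'd (hrep i j) (x, w) (0, u) =
    'd (hrep i j) (x, w) (anchor i x u, remainder i x w u).
  rewrite E; last first.
    move=> v xv; rewrite /= !hrepE; congr (fwd _ _).
    by rewrite addrC; exact: (hloc_algebra alg_h w 0 xv).
  congr ('d _ _ _); rewrite [LHS]surjective_pairing; congr (_, _).
  by apply: diff_tmap1 => //; exact: hrep_diff.
have -> : (0, u - remainder i x w u) = (0, u) - (0, remainder i x w u) :> model i * model i.
  by congr (_, _); rewrite subr0.
rewrite [RHS]linearB E -linearB; congr ('d _ _ _).
by congr (_, _); rewrite /= ?subr0 ?subrr.
Qed.

Lemma remainder0 i (x0 u : model i) : cod (chart_of i) x0 -> remainder i x0 0 u = 0.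
Proof.
move=> x0i; have sh := hrep_smooth alg_h i i; have xD := hdom00 alg_h x0i.
have TD : (hdom i i `*` [set: model i * model i]) ((x0, 0), (0, 0)) by [].
have dT : differentiable (tmap (hrep i i)) ((x0, 0), (0, 0)).
  by apply: (smooth_on_diff (smooth_on_tmap sh)).
have d1 := has_diff_comp (has_diff_comp (has_diff_pair
  (has_diff_inr x0 (0 : model i))
  (has_diff_cst (0 : model i * model i) (0 : model i))) erefl (has_diffP dT)) erefl
  (has_diff_snd _).
have d2 := has_diff_cst (0 : model i) (0 : model i).
apply: (has_diff_uniq u d1); rewrite (_ : _ \o _ = (fun=> 0)) //.
by apply/funext => v; rewrite /= linear0.
Qed.

(* Near [(x0, 0)] the partial derivative of [h] in the base point is close to
   the identity and the remainder above is small. *)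
Lemma local_estimates i (x0 : model i) (e : reals S) : cod (chart_of i) x0 -> 0 < e ->
  exists2 r : reals S, 0 < r & forall x w, nm (x - x0) < r -> nm w < r ->
    [/\ cod (chart_of i) x, hdom i i (x, w),
     forall u, nm ('d (hrep i i) (x, w) (u, 0) - u) <= e * nm u &
     forall u, nm (remainder i x w u) <= e * nm u].
Proof.
move=> x0i e0; have xD := hdom00 alg_h x0i.
have sh := hrep_smooth alg_h i i; have oh := @open_hdom _ _ _ alg_h i i.
have [r1 r10 r1H] := derivative_continuous oh sh xD e0.
have oT : open (hdom i i `*` [set: model i * model i]).
  by apply: open_setX => //; exact: openT.
have TD : (hdom i i `*` [set: model i * model i]) ((x0, 0), (0, 0)) by [].
have [r2 r20 r2H] := derivative_continuous oT (smooth_on_tmap sh) TD e0.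
have [||r r0 [r1r r2r]] := @below2 S r1 r2 => //.
exists r => // x w xr wr.
have xw : nm ((x, w) - (x0, 0)) < r1.
  by rewrite nm_pair_lt /= subr0 !(lt_le_trans _ r1r).
have [hxw E1] := r1H _ xw; split; [by case: hxw|exact: hxw|move=> u|move=> u].
  rewrite -[X in _ - X](hrep_diff_id u x0i); apply: le_trans (E1 (u, 0)) _.
  by rewrite nm_pair nm0 max_l ?nm_ge0.
have Q0 := remainder0 u x0i.
have T2 : nm (((x, 0), (w, 0)) - ((x0, 0), (0, 0)) :
    (model i * model i) * (model i * model i)) < r2.
  by rewrite !nm_pair_lt /= !subr0 nm0 !(lt_le_trans _ r2r).
have [_ E2] := r2H _ T2.
rewrite -[remainder i x w u]subr0 -Q0.
apply: le_trans (nm_snd ('d (tmap (hrep i i)) ((x, 0), (w, 0)) ((0, u), (0, 0)) -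
  'd (tmap (hrep i i)) ((x0, 0), (0, 0)) ((0, u), (0, 0)))) _.
apply: le_trans (E2 _) _; rewrite ler_pM2l //.
by rewrite !nm_pair !nm0 !ge_max !nm_ge0 lexx.
Qed.

End LocalAlgebra.

Arguments remainder {S M} h i x w u.

(** * Continuity of the distribution along an accessible set *)

Section Accessible.
Context {K : numFieldType} {M : atlas K} {h : tangent_bundle M -> M}.
Hypothesis alg_h : tangent_algebra h.

Lemma accessible_refl (m : M) : accessible_set h m m.
Proof. by case: alg_h => _ h0 _; exists (0 : tangent_space m) => //; exact: h0. Qed.

(** With [m' = h (m, v)], the algebra law reaches [h (m, w)] from [m'] by the image of [w - v] under
    the partial derivative in the base point. The vectors need not be small. *)
Lemma accessible_back (m m' : M) : accessible_set h m m' ->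
  accessible_set h m `<=` accessible_set h m'.
Proof.
pose i := chart_at m; pose j := chart_at m'.
have mi : dom (chart_of i) m by exact: chart_at_dom.
have mj : dom (chart_of j) m' by exact: chart_at_dom.
rewrite (accessible_hloc h mi) (accessible_hloc h mj) => -[v _ vm] _ [w _ <-].
pose q := (fwd (chart_of i) m, v).
have qij : hdom h i j q by split; [exact: fwd_cod|rewrite vm].
exists ('d (hrep h i j) q (w - v, 0)) => //.
rewrite -vm; have := hloc_algebra alg_h (w - v) 0 qij.
by rewrite /hrep /q /= subrKC.
Qed.

Lemma accessible_eq (m m' : M) : accessible_set h m m' ->
  accessible_set h m' = accessible_set h m.
Proof.
move=> mm'; apply/seteqP; split; last exact: accessible_back.
by apply: accessible_back; exact: accessible_back mm' _ (accessible_refl m).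
Qed.

Lemma accessible_hlocE (m : M) i (x w : model i) : cod (chart_of i) x ->
  accessible_set h m (hloc h i (x, w)) <-> accessible_set h m (bwd (chart_of i) x).
Proof.
move=> xi; have acc : accessible_set h (bwd (chart_of i) x) (hloc h i (x, w)).
  by rewrite (accessible_hloc h (bwd_dom xi)); exists w => //; rewrite bwdK.
split=> H; last by rewrite -(accessible_eq H).
rewrite -(accessible_eq H) (accessible_eq acc); exact: accessible_refl.
Qed.

End Accessible.

Section GoodPoints.
Context {S : scalars} {M : atlas S} {h : tangent_bundle M -> M}.
Hypothesis alg_h : tangent_algebra h.
Variable m0 : M.

Local Notation L := (accessible_set h m0).
Local Notation hloc := (hloc h).
Local Notation hrep := (hrep h).
Local Notation hdom := (hdom h).
Local Notation anchor := (anchor h).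

Lemma transition_invertible (i j : index M) (y : model i) : cod (chart_of i) y ->
  dom (chart_of j) (bwd (chart_of i) y) ->
  invertible ('d (fwd (chart_of j) \o bwd (chart_of i)) y).
Proof.
move=> yi yj; pose m := bwd (chart_of i) y; have mi := bwd_dom yi.
have E (k l : index M) : dom (chart_of k) m -> dom (chart_of l) m -> forall u,
    'd (fwd (chart_of k) \o bwd (chart_of l)) (fwd (chart_of l) m)
     ('d (fwd (chart_of l) \o bwd (chart_of k)) (fwd (chart_of k) m) u) = u.
  by move=> mk ml u; rewrite transition_chain // transition_id.
have dji : differentiable (fwd (chart_of i) \o bwd (chart_of j)) (fwd (chart_of j) m).
  apply: (smooth_on_diff (transition_smooth j i)); split; first exact: fwd_cod.
  by rewrite /= fwdK.
have [C C0 HC] := lin_bound (diff_continuous dji).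
exists ('d (fwd (chart_of i) \o bwd (chart_of j)) (fwd (chart_of j) m)), C.
split=> // u.
  by have := E i j mi yj u; rewrite /m (bwdK yi).
by have := E j i yj mi u; rewrite /m (bwdK yi).
Qed.

Lemma hrep_partial_transition i j (q : model i * model i) u :
  hdom i i q -> hdom i j q ->
  'd (hrep i j) q (u, 0) =
  'd (fwd (chart_of j) \o bwd (chart_of i)) (hrep i i q) ('d (hrep i i) q (u, 0)).
Proof.
move=> qi qj; have yi : cod (chart_of i) (hrep i i q) by exact: (fwd_cod qi.2).
have yE : bwd (chart_of i) (hrep i i q) = hloc i q by exact: (fwdK qi.2).
have dt : differentiable (fwd (chart_of j) \o bwd (chart_of i)) (hrep i i q).
  apply: (smooth_on_diff (transition_smooth i j)); split=> //=.
  by rewrite yE; case: qj.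
have d1 := has_diff_comp (has_diffP (hrep_diff alg_h qi)) erefl (has_diffP dt).
have d2 := has_diffP (hrep_diff alg_h qj).
apply/esym; apply: (has_diff_uniq _ (has_diff_near (U := hdom i i `&` hdom i j)
  _ _ _ d1) d2).
- by apply: openI; exact: open_hdom.
- by [].
- by move=> p [[pi pj] _]; rewrite /= !hrepE fwdK.
Qed.

(* Continuity at [y] of the distribution along the accessible set: each vector of
   [D_z] is relatively close to [D_y]. *)
Definition good (i : index M) (y : model i) := forall e : reals S, 0 < e ->
  exists2 r : reals S, 0 < r & forall z, nm (z - y) < r -> cod (chart_of i) z ->
    L (bwd (chart_of i) z) -> forall u, exists u',
    nm (anchor i z u - anchor i y u') <= e * nm (anchor i z u).
Arguments good : clear implicits.

(** The estimates are taken with constant 1/2, which makes both the partial derivative and the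
    identity minus [remainder] invertible. The box is chosen in chart [i] alone; another target
    chart [j] only adds a coordinate change. *)
Lemma transport_box i (x0 : model i) : cod (chart_of i) x0 ->
  exists2 r : reals S, 0 < r & forall x w, nm (x - x0) < r -> nm w < r ->
  [/\ cod (chart_of i) x, hdom i i (x, w) & forall j, hdom i j (x, w) ->
    [/\ invertible (fun u => 'd (hrep i j) (x, w) (u, 0)),
     forall u, exists v, 'd (hrep i j) (x, w) (anchor i x u, 0) =
       anchor j (hrep i j (x, w)) v &
     forall v, exists u, 'd (hrep i j) (x, w) (anchor i x u, 0) =
       anchor j (hrep i j (x, w)) v]].
Proof.
move=> x0i; have e0 : 0 < 1 / 2 :> reals S by [].
have [r r0 rH] := local_estimates alg_h x0i e0.
exists r => // x w xr wr; have [xi xw phi rem] := rH x w xr wr.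
split=> // j xwj.
have lphi : linear (fun u : model i => 'd (hrep i i) (x, w) (u, 0)).
  by move=> a u1 u2; rewrite -linearP -(inl_lin _ a u1 u2).
have lrem : linear (fun u : model i => u - remainder h i x w u).
  by move=> a u v; rewrite remainder_lin scalerBr; abel.
have inv1 : invertible (mklin lphi).
  by apply: near_id_invertible => v; have := phi v; rewrite /=; lra.
have [R [_ [_ RK _ _]]] : invertible (mklin lrem).
  apply: near_id_invertible => v; have := rem v; rewrite /=.
  by rewrite [_ - _ - v]addrAC subrr add0r nmN; lra.
have yi : cod (chart_of i) (hrep i i (x, w)) by exact: (fwd_cod xw.2).
have yE : bwd (chart_of i) (hrep i i (x, w)) = hloc i (x, w).
  by exact: (fwdK xw.2).
have inv2 : invertible (fun u => 'd (hrep i j) (x, w) (u, 0)).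
  rewrite (_ : (fun u => _) = 'd (fwd (chart_of j) \o bwd (chart_of i))
     (hrep i i (x, w)) \o mklin lphi).
    apply: invertible_comp inv1 (transition_invertible yi _).
    by rewrite yE; case: xwj.
  by apply/funext => u; rewrite /= hrep_partial_transition.
split=> // [u|v].
  exists ('d (hrep i j) (x, w) (u - remainder h i x w u, 0)).
  by rewrite anchor_partial // anchor_transport.
have [P [_ [_ PK _ _]]] := inv2.
(* [P] inverts the partial derivative and [R] inverts the identity minus [remainder], so
   [anchor_transport] and [anchor_partial] lead back to [v]. *)
exists (R (P v)); rewrite anchor_transport //.
have := RK (P v) => /= ->.
by rewrite -anchor_partial // PK.
Qed.

End GoodPoints.

Arguments good {S M} h m0 i y.

Section AllGood.
Context {S : scalars} {M : atlas S} {h : tangent_bundle M -> M}.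
Hypothesis alg_h : tangent_algebra h.

Local Notation hloc := (hloc h).
Local Notation hrep := (hrep h).
Local Notation hdom := (hdom h).
Local Notation anchor := (anchor h).

Lemma nm_inl (E F : normedModType S) (u : E) : nm (u, 0 : F) = nm u.
Proof. by rewrite nm_pair nm0 max_l ?nm_ge0. Qed.

Lemma nm_inr (E F : normedModType S) (u : F) : nm (0 : E, u) = nm u.
Proof. by rewrite nm_pair nm0 max_r ?nm_ge0. Qed.

Lemma anchor_continuous i y (e : reals S) : cod (chart_of i) y -> 0 < e ->
  exists2 r : reals S, 0 < r & forall z, nm (z - y) < r ->
    cod (chart_of i) z /\ forall u, nm (anchor i z u - anchor i y u) <= e * nm u.
Proof.
move=> yi e0; have yD := hdom00 alg_h yi.
have [r r0 rH] := derivative_continuous (@open_hdom _ _ _ alg_h i i)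
  (hrep_smooth alg_h i i) yD e0.
exists r => // z zr; have zr' : nm ((z, 0) - (y, 0 : model i)) < r.
  by rewrite nm_pair_lt /= zr subr0 nm0.
have [[zi _] zH] := rH _ zr'; split=> // u.
by apply: le_trans (zH (0, u)) _; rewrite nm_inr.
Qed.

Lemma anchor_lin i y : linear (anchor i y).
Proof.
move=> a u v; rewrite !anchorE -linearP; congr ('d _ _ _).
exact: inr_lin.
Qed.

Lemma anchorB i y u v : anchor i y (u - v) = anchor i y u - anchor i y v.
Proof. exact: (linearB (mklin (@anchor_lin i y))). Qed.

Lemma anchor_bound i y : cod (chart_of i) y ->
  exists2 B : reals S, 0 < B & forall u, nm (anchor i y u) <= B * nm u.
Proof.
move=> yi; have [B B0 BH] := lin_bound (diff_continuous (hrep_diff alg_h (hdom00 alg_h yi))).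
by exists B => // u; apply: le_trans (BH (0, u)) _; rewrite nm_inr.
Qed.

(** Here [za] and [xa] are the images of [a] under nearby isomorphisms, [xb] is that of [b] under
    the second one, and [C] bounds its inverse. Half of [e] pays for the change of isomorphism, half
    for the distance between the images. *)
Lemma transfer_estimate (E F : normedModType S) (a b : E) (za xa xb : F)
    (B C e e1 e2 : reals S) :
  0 < C -> 0 < e1 -> e2 <= 1 -> C * e2 <= e / 2 -> C * (e1 * (B + 1)) = e / 2 ->
  nm (za - xa) <= e2 * nm a -> nm xa <= B * nm a -> nm (za - xb) <= e1 * nm za ->
  nm (a - b) <= C * nm (xa - xb) -> nm (a - b) <= e * nm a.
Proof.
move=> C0 e10 e21 H6 H7 H1 H2 H3 H4.
have H5 : nm za <= (B + 1) * nm a.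
  have := nm_split za xa; have : e2 * nm a <= 1 * nm a by rewrite ler_wpM2r ?nm_ge0.
  lra.
have := nm_tri za xa xb; rewrite [nm (xa - za)]nmC => H8.
have H9 : C * (e2 * nm a) <= e / 2 * nm a by rewrite mulrA ler_wpM2r ?nm_ge0.
have H10 : C * (e1 * nm za) <= e / 2 * nm a.
  by rewrite -H7 -!mulrA ler_pM2l // ler_pM2l.
have H11 : C * nm (xa - xb) <= C * (e2 * nm a + e1 * nm za).
  by rewrite ler_pM2l //; lra.
lra.
Qed.

(** The same [w] is used at [x] and at the nearby [z]: the partial derivatives at [(z, w)] and
    [(x, w)] carry D_z and D_x to D at the image points, and they are close to each other. *)
Lemma good_transfer (m0 : M) i (x0 : model i) : cod (chart_of i) x0 ->
  exists2 r : reals S, 0 < r & forall x w, nm (x - x0) < r -> nm w < r ->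
    forall j, hdom i j (x, w) -> good h m0 j (hrep i j (x, w)) -> good h m0 i x.
Proof.
move=> /(transport_box alg_h)[r r0 rH]; exists r => // x w xr wr j xwj gy e e0.
have [xi xw /(_ j xwj)[inv _ T2]] := rH x w xr wr.
have lphi : linear (fun u : model i => 'd (hrep i j) (x, w) (u, 0)).
  by move=> a u1 u2; rewrite -linearP -(inl_lin _ a u1 u2).
have [P [C [DP PD C0 PC]]] := @invertible_lin _ _ _ (mklin lphi) inv.
have [B B0 BH] := lin_bound (diff_continuous (hrep_diff alg_h xwj)).
have [||e2 e20 [e21 e22]] := @below2 S 1 (e / (2 * C)) => //.
  by rewrite divr_gt0 // mulr_gt0.
have e10 : 0 < e / (2 * C * (B + 1)) by rewrite divr_gt0 // !mulr_gt0 // addr_gt0.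
set e1 := e / _ in e10.
have [r1 r10 r1H] := derivative_continuous (@open_hdom _ _ _ alg_h i j)
  (hrep_smooth alg_h i j) xwj e20.
have [r2 r20 r2H] := gy _ e10.
have cT := smooth_on_cont (hrep_smooth alg_h i j) xwj.
have [r3 r30 r3H] := (continuous_nm _ _).1 cT _ r20.
have r40 : 0 < r - nm (x - x0) by rewrite subr_gt0.
have [||r5 r50 [r51 r52]] := @below2 S r1 r3 => //.
have [||d d0 [d1 d2]] := @below2 S (r - nm (x - x0)) r5 => //.
exists d => // z zx zi Lz u.
have zr : nm (z - x0) < r by have := nm_tri x z x0; lra.
have zw : nm ((z, w) - (x, w)) < r5.
  by rewrite nm_pair_lt /= subrr nm0 r50 andbT (lt_le_trans zx).
have [zwj zD] := r1H _ (lt_le_trans zw r51).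
have [_ _ /(_ j zwj)[_ T1 _]] := rH z w zr wr.
have [v vE] := T1 u.
have zy := r3H _ (lt_le_trans zw r52).
have Lz' : accessible_set h m0 (bwd (chart_of j) (hrep i j (z, w))).
  by rewrite !hrepE fwdK; [apply/accessible_hlocE|case: zwj].
have [v' v'E] := r2H _ zy (fwd_cod zwj.2) Lz' v.
have [u' u'E] := T2 v'; exists u'.
rewrite -vE -u'E in v'E.
set a := anchor i z u in v'E *; set b := anchor i x u' in v'E *.
have H1 : nm ('d (hrep i j) (z, w) (a, 0) - 'd (hrep i j) (x, w) (a, 0)) <= e2 * nm a.
  by rewrite -[nm a](nm_inl (model i)); exact: zD.
have H2 : nm ('d (hrep i j) (x, w) (a, 0)) <= B * nm a.
  by rewrite -[nm a](nm_inl (model i)); exact: BH.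
have {}v'E : nm ('d (hrep i j) (z, w) (a, 0) - 'd (hrep i j) (x, w) (b, 0)) <=
  e1 * nm ('d (hrep i j) (z, w) (a, 0)) := v'E.
have H3 : nm (a - b) <= C * nm ('d (hrep i j) (x, w) (a, 0) - 'd (hrep i j) (x, w) (b, 0)).
  have -> : 'd (hrep i j) (x, w) (a, 0) - 'd (hrep i j) (x, w) (b, 0) =
      mklin lphi (a - b) by rewrite linearB.
  by rewrite -{1}(DP (a - b)).
apply: (transfer_estimate C0 e10 e21 _ _ H1 H2 v'E H3).
  by move: e22; rewrite ler_pdivlMr ?mulr_gt0 //; nlra.
by rewrite /e1; field; rewrite !gt_eqF ?addr_gt0.
Qed.

(** The indicator function of a clopen set has derivative zero everywhere, so the mean value
    inequality makes it constant. *)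
Lemma clopen_all (E : normedModType S) (A : set E) : open A -> open (~` A) ->
  forall a b, A a -> A b.
Proof.
move=> oA oA' a b Aa.
pose f v : S^o := if `[< A v >] then 0 else 1.
have df v : differentiable f v /\ forall u, 'd f v u = 0.
  have [Av|nAv] := pselect (A v).
    apply: (@has_diff_near _ _ _ A (fun=> 0 : S^o)) => //; last exact: has_diff_cst.
    by move=> y Ay; rewrite /f; case: asboolP.
  apply: (@has_diff_near _ _ _ (~` A) (fun=> 1 : S^o)) => //; last exact: has_diff_cst.
  by move=> y Ay; rewrite /f; case: asboolP.
have H : nm (f b - f a) <= 0 * nm (b - a).
  apply: mean_value => t _; have [d1 E0] := df (a + io S t *: (b - a)).
  by split=> // u; rewrite E0 nm0 mul0r.
rewrite mul0r in H; apply: contrapT => nAb.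
have : f b - f a = 1 by rewrite /f; do 2 case: asboolP => //; rewrite subr0.
have : nm (f b - f a) == 0 by rewrite eq_le H nm_ge0.
by rewrite nm_eq0 => /eqP -> /eqP; rewrite eq_sym oner_eq0.
Qed.

End AllGood.

(** * A Baire argument for the continuity of the distribution *)

Section GoodPoint.
Context {S : scalars} {M : atlas S} {h : tangent_bundle M -> M}.
Hypothesis alg_h : tangent_algebra h.

Local Notation hloc := (hloc h).
Local Notation hrep := (hrep h).
Local Notation hdom := (hdom h).
Local Notation anchor := (anchor h).

Lemma perturb_small (E F : normedModType S) (a b : F) (u : E) (B r : reals S) :
  nm (a - b) <= 1 * nm u -> nm b <= B * nm u -> (B + 1) * nm u < r -> nm a < r.
Proof. by have := nm_split a b; lra. Qed.

(* The set of [v] with [P (h (m, v))] is open and closed in [T_m M]. *)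
Lemma leaf_induction (P : M -> Prop) :
  (forall i x0, cod (chart_of i) x0 -> exists2 r : reals S, 0 < r &
     forall x w, nm (x - x0) < r -> nm w < r -> cod (chart_of i) x ->
       P (hloc i (x, w)) -> P (bwd (chart_of i) x)) ->
  forall m m', accessible_set h m m' -> P m -> P m'.
Proof.
move=> H m m'; pose i := chart_at m; pose x := fwd (chart_of i) m.
have mi : dom (chart_of i) m by exact: chart_at_dom.
have xi : cod (chart_of i) x by exact: fwd_cod.
rewrite (accessible_hloc h mi) => -[v' _ <-]; rewrite -/x.
rewrite -{1}[m](fwdK mi) -/x -(hloc0 alg_h xi).
suff [oA oA'] : open [set v | P (hloc i (x, v))] /\ open (~` [set v | P (hloc i (x, v))]).
  exact: (clopen_all oA oA').
have key v : exists2 r : reals S, 0 < r & forall u, nm u < r ->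
    (P (hloc i (x, v)) -> P (hloc i (x, v + u))) /\
    (P (hloc i (x, v + u)) -> P (hloc i (x, v))).
  pose j := chart_at (hloc i (x, v)); pose q := (x, v).
  have qij : hdom i j q by split=> //; exact: chart_at_dom.
  have [r r0 rH] := H j (hrep i j q) (fwd_cod qij.2).
  have [B B0 BH] := lin_bound (diff_continuous (hrep_diff alg_h qij)).
  have [r1 r10 r1H] := derivative_continuous (@open_hdom _ _ _ alg_h i j)
    (hrep_smooth alg_h i j) qij ltr01.
  have [r2 r20 r2H] := (continuous_nm _ _).1
    (smooth_on_cont (hrep_smooth alg_h i j) qij) _ r0.
  have r30 : 0 < r / (B + 1) by rewrite divr_gt0 // addr_gt0.
  have [||r4 r40 [r41 r42]] := @below2 S r1 r2 => //.
  have [||d d0 [d1 d2]] := @below2 S r4 (r / (B + 1)) => //.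
  exists d => // u ud; pose q' := (x, v + u).
  have uB : (B + 1) * nm u < r.
    by rewrite mulrC -ltr_pdivlMr ?addr_gt0 // (lt_le_trans ud).
  have q'q : nm (q' - q) < r4.
    by rewrite nm_pair_lt /= subrr nm0 r40 [v + u]addrC addrK (lt_le_trans ud).
  have [q'ij q'D] := r1H _ (lt_le_trans q'q r41).
  have q'x := r2H _ (lt_le_trans q'q r42).
  have bE (p : model i * model i) : hdom i j p ->
      bwd (chart_of j) (hrep i j p) = hloc i p by move=> pij; exact: (fwdK pij.2).
  (* [h (x, v)] and [h (x, v + u)] are reached from each other by the images of [-u] and [u]. Taking
     either of them as the base point turns the one-way hypothesis into an equivalence. *)
  split=> PP.
    rewrite -[(x, v + u)]/q' -bE //; apply: (rH _ ('d (hrep i j) q' (- u, 0)) q'x).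
    - by apply: (perturb_small (q'D (- u, 0)) (BH _)); rewrite nm_inl nmN.
    - exact: (fwd_cod q'ij.2).
    - by rewrite (hloc_algebra alg_h _ _ q'ij) /= addrK.
  rewrite -[(x, v)]/q -bE //; apply: (rH _ ('d (hrep i j) q (u, 0))).
  - by rewrite subrr nm0.
  - apply: le_lt_trans (BH _) _; rewrite nm_inl; apply: le_lt_trans uB.
    by rewrite ler_wpM2r ?nm_ge0 // lerDl.
  - exact: (fwd_cod qij.2).
  - by rewrite (hloc_algebra alg_h _ _ qij).
split; apply/open_nm => v /= Pv; have [r r0 rH] := key v; exists r => // w wv.
  by have := (rH (w - v) wv).1 Pv; rewrite subrKC.
by apply: contra_not Pv => Pw; apply: (rH (w - v) wv).2; rewrite subrKC.
Qed.

(* The anchor at [z] is open onto its image with constant [c]. *)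
Definition bounded_by (c : reals S) i z := forall v, exists w,
  anchor i z w = anchor i z v /\ nm w <= c * nm (anchor i z v).

Lemma tame_bounded i z : tame h -> cod (chart_of i) z ->
  exists2 c, 0 < c & bounded_by c z.
Proof.
move=> tm zi; pose m := bwd (chart_of i) z; pose c := chart_at m.
have mc : dom (chart_of c) m by exact: chart_at_dom.
have zic : hdom i c (z, 0) by apply: hdom0.
have [G cG GH] := tame_split alg_h m tm.
have [g g0 gH] := lin_bound cG.
pose y := fwd (chart_of c) m.
have yE : hrep i c (z, 0) = y by rewrite !hrepE hloc0.
(* The generalized inverse lives in the preferred chart at [m]. By [hrep_diff0], [t] is the
   derivative of the coordinate change, and it intertwines the two anchors. *)
pose t u := 'd (hrep i c) (z, 0) (u, 0).
have tE u : t (anchor i z u) = anchor c y (t u).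
  by rewrite /t anchor_transport // remainder0 // subr0 -yE anchor_partial.
have [P [C [tP Pt C0 PC]]] : invertible t.
  have [r r0 rH] := transport_box alg_h zi.
  by have [||_ _ /(_ c zic)[]] := rH z 0; rewrite ?subrr ?nm0.
have [B B0 BH] : exists2 B : reals S, 0 < B & forall u, nm (t u) <= B * nm u.
  have [B B0 BH] := lin_bound (diff_continuous (hrep_diff alg_h zic)).
  by exists B => // u; apply: le_trans (BH _) _; rewrite nm_inl.
exists (C * (g * B)) => [|v]; first by rewrite !mulr_gt0.
exists (P (G (t (anchor i z v)))); split.
  apply: (can_inj tP); rewrite tE Pt tE.
  by have := GH (t v); rewrite !(algebra_anchorE alg_h).
apply: le_trans (PC _) _; rewrite -mulrA ler_pM2l // -mulrA.
by apply: le_trans (gH _) _; rewrite ler_pM2l.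
Qed.

(** A vector of D_z has a preimage [w] bounded by [c] times its norm, and the anchor at [y] applied
    to the same [w] is close because the anchor is continuous. *)
Lemma good_of_bound m0 i y (c r : reals S) : cod (chart_of i) y -> 0 < c -> 0 < r ->
  (forall z, nm (z - y) < r -> cod (chart_of i) z ->
    accessible_set h m0 (bwd (chart_of i) z) -> bounded_by c z) ->
  good h m0 i y.
Proof.
move=> yi c0 r0 H e e0.
have [|d d0 dH] := anchor_continuous alg_h yi (e := e / c); first exact: divr_gt0.
have [||s s0 [sr sd]] := @below2 S r d => //.
exists s => // z zs zi Lz u.
have [w [wu wc]] := H z (lt_le_trans zs sr) zi Lz u.
exists w; rewrite -wu in wc *.
apply: le_trans ((dH z (lt_le_trans zs sd)).2 w) _.
by rewrite -mulrA ler_pM2l // ler_pdivrMl.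
Qed.

(** A short solution [w] of [A' w = A' v] would make [A (w - v)] small; the constant [K] at [A] then
    corrects [w] by a small [n] to an exact solution of [A (w - n) = A v], shorter than
    [2 * c * nm (A v)]. *)
Lemma unbounded_perturbation (E F : normedModType S) (A : {linear E -> F}) (v : E)
    (c K : reals S) :
  0 < c -> 0 < K -> (forall u : E, exists w : E, A w = A u /\ nm w <= K * nm (A u)) ->
  (forall w : E, A w = A v -> 2 * c * nm (A v) < nm w) ->
  exists2 e : reals S, 0 < e & forall A' : {linear E -> F},
    (forall u : E, nm (A' u - A u) <= e * nm u) ->
    forall w : E, A' w = A' v -> c * nm (A' v) < nm w.
Proof.
move=> c0 K0 KH vH; set a := A v in vH.
have a0 : 0 < nm a.
  rewrite nm_gt0; apply/eqP => a0.
  by have := vH 0; rewrite linear0 a0 !nm0 mulr0 ltxx => /(_ erefl).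
(* [W] bounds the norm of a short solution, and [e * T] collects all error terms plus [e]. They have
   to fit into the margin between [c] and [2 * c]. *)
pose W := c * (nm a + nm v); pose T := c * nm v + K * (W + nm v) + 1.
have W0 : 0 <= W by rewrite mulr_ge0 ?addr_ge0 ?nm_ge0 // ltW.
have T0 : 0 < T.
  by rewrite ltr_wpDl // addr_ge0 // mulr_ge0 ?addr_ge0 ?nm_ge0 // ltW.
have [||e e0 [e1 e2]] := @below2 S 1 (c * nm a / T) => //.
  by rewrite divr_gt0 // mulr_gt0.
have eT : e * T <= c * nm a by rewrite -ler_pdivlMr.
exists e => // A' AA' w wv; rewrite ltNge; apply/negP => wc.
have [n [nE nK]] := KH (w - v).
have : 2 * c * nm a < nm (w - n) by apply: vH; rewrite linearB nE linearB subKr.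
have H1 : nm (A' v) <= nm a + e * nm v.
  by have := nm_split (A' v) a; have := AA' v; rewrite -/a; lra.
have H2 : nm w <= c * (nm a + e * nm v) by apply: le_trans wc _; rewrite ler_pM2l.
have H3 : e * nm v <= nm v by rewrite ler_piMl ?nm_ge0.
have H4 : nm w <= W by apply: le_trans H2 _; rewrite ler_pM2l // lerD2l.
have H5 : nm (A (w - v)) <= e * (W + nm v).
  have : nm (A (w - v)) <= e * nm (w - v).
    by have := AA' (w - v); rewrite [A' _]linearB wv subrr sub0r nmN.
  move=> /le_trans; apply; rewrite ler_pM2l //.
  by apply: le_trans (nmB _ _) _; rewrite lerD2r.
have H6 : nm n <= K * (e * (W + nm v)) by apply: le_trans nK _; rewrite ler_pM2l.
have H9 : e * T = c * (e * nm v) + K * (e * (W + nm v)) + e by rewrite /T; ring.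
rewrite H9 in eT; have H7 := nmB w n; clearbody W.
by move: H7 H2 H6 e0 eT; nlra.
Qed.

Lemma unbounded_open i z (c : reals S) : tame h -> cod (chart_of i) z -> 0 < c ->
  ~ bounded_by (2 * c) z ->
  exists2 r : reals S, 0 < r & forall z', nm (z' - z) < r -> ~ bounded_by c z'.
Proof.
move=> tm zi c0 /existsNP[v vH]; have [K K0 KH] := tame_bounded tm zi.
have [|e e0 eH] := @unbounded_perturbation _ _ (mklin (@anchor_lin _ _ h i z)) v
  c K c0 K0 KH.
  by move=> w wv; rewrite ltNge; apply/negP => wc; apply: vH; exists w.
have [r r0 rH] := anchor_continuous alg_h zi e0.
exists r => // z' /rH[_ zz'] /(_ v)[w [wv]]; apply/negP; rewrite -ltNge.
exact: (eH (mklin (@anchor_lin _ _ h i z'))).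
Qed.

Lemma not_good_step m0 i z (c r : reals S) : tame h -> cod (chart_of i) z ->
  ~ good h m0 i z -> 0 < c -> 0 < r ->
  exists (z' : model i) (r' : reals S), [/\ nm (z' - z) + r' <= r, 0 < r' <= c^-1,
    accessible_set h m0 (bwd (chart_of i) z') &
    forall x, nm (x - z') <= r' -> cod (chart_of i) x /\ ~ bounded_by c x].
Proof.
move=> tm zi ng c0 r0; have r20 : 0 < r / 2 by rewrite divr_gt0.
have c20 : 0 < 2 * c by rewrite mulr_gt0.
have [z' [z'z z'i Lz' bz']] : exists z', [/\ nm (z' - z) < r / 2,
    cod (chart_of i) z', accessible_set h m0 (bwd (chart_of i) z') &
    ~ bounded_by (2 * c) z'].
  apply: contrapT => nz; apply: ng; apply: (good_of_bound zi c20 r20) => z' z'r z'i Lz'.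
  by apply: contrapT => bz'; apply: nz; exists z'.
have [r1 r10 r1H] := unbounded_open tm z'i c0 bz'.
have [r2 r20' r2H] := (open_nm _).1 (cod_open (chart_of i)) z' z'i.
have [||r3 r30 [r31 r32]] := @below2 S r1 r2 => //.
(* Half of [r3] puts the closed ball around [z'] into the open one, half of [r] keeps it inside the
   previous ball. *)
have [||r4 r40 [r41 r42]] := @below2 S (r3 / 2) (r / 2) => //.
  by rewrite divr_gt0.
have [||r5 r50 [r51 r52]] := @below2 S r4 c^-1 => //; first by rewrite invr_gt0.
exists z', r5; split; [|by rewrite r50|exact: Lz'|].
  by move: z'z r51 r42; nlra.
move=> x xr; split; [apply: r2H|apply: r1H].
  by move: xr r51 r41 r30 r32; nlra.
by move: xr r51 r41 r30 r31; nlra.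
Qed.

(* Otherwise nested balls around points of the leaf, on which the anchor is less
   and less open, would shrink to a point where tameness fails. *)
Lemma exists_good m0 : tame h ->
  exists (i : index M) (z : model i), [/\ cod (chart_of i) z,
    accessible_set h m0 (bwd (chart_of i) z) & good h m0 i z].
Proof.
move=> tm; apply: contrapT => ng; pose i := chart_at m0.
have {}ng z : cod (chart_of i) z -> accessible_set h m0 (bwd (chart_of i) z) ->
    ~ good h m0 i z by move=> zi Lz gz; apply: ng; exists i, z.
have mi : dom (chart_of i) m0 by exact: chart_at_dom.
pose ok (p : model i * reals S) := [/\ cod (chart_of i) p.1,
  accessible_set h m0 (bwd (chart_of i) p.1) & 0 < p.2].
have /choice[f fP] : forall np : nat * (model i * reals S),
    exists p', ok np.2 -> [/\ ok p', nm (p'.1 - np.2.1) + p'.2 <= np.2.2,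
      p'.2 <= np.1.+1%:R^-1 & forall x, nm (x - p'.1) <= p'.2 ->
        cod (chart_of i) x /\ ~ bounded_by np.1.+1%:R x].
  move=> [n p] /=; have [[pi Lp p0]|nok] := pselect (ok p); last by exists p.
  have n0 : 0 < n.+1%:R :> reals S by rewrite ltr0n.
  have [z' [r' [H1 /andP[r'0 H2] H3 H4]]] := not_good_step tm pi (ng _ pi Lp) n0 p0.
  exists (z', r') => _; split=> //; split=> //=.
  by apply: (H4 z' _).1; rewrite subrr nm0 ltW.
pose u := fix u n := if n is n'.+1 then f (n', u n') else (fwd (chart_of i) m0, 1).
have uok n : ok (u n).
  elim: n => [|n IH] /=; last by case: (fP (n, u n) IH).
  split=> //=; first exact: fwd_cod.
  by rewrite fwdK //; exact: accessible_refl.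
have uP n := fP (n, u n) (uok n).
have us n m : (n <= m)%N -> nm ((u m).1 - (u n).1) + (u m).2 <= (u n).2.
  move=> /subnK <-; elim: (m - n)%N => [|k IH].
    by rewrite add0n subrr nm0 add0r.
  rewrite addSn; have [_ H _ _] := uP (k + n)%N.
  have := nm_tri (u (k + n)%N).1 (u (k + n).+1).1 (u n).1.
  by move: IH H => /=; nlra.
(* The sequence starts at index 1: the initial ball has radius 1 and none of the required
   properties. *)
have [n m nm_|d d0|l lH] := @nested_limit S _ (fun n => (u n.+1).1) (fun n => (u n.+1).2).
- by have := us n.+1 m.+1 nm_; case: (uok m.+1) => _ _; nlra.
- exists (Num.bound d^-1); have [_ _ H _] := uP (Num.bound d^-1).
  apply: le_lt_trans H _ => /=; rewrite invf_plt ?posrE ?ltr0n //.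
  apply: lt_le_trans (archi_boundP _) _; first by rewrite invr_ge0 ltW.
  by rewrite ler_nat.
have lP n : cod (chart_of i) l /\ ~ bounded_by n.+1%:R l.
  by have [_ _ _] := uP n; apply; exact: lH.
(* The limit [l] may lie off the leaf, but tameness holds there and contradicts the failure of every
   bound. *)
have [K K0 KH] := tame_bounded tm (lP 0).1.
have [_] := lP (Num.bound K); apply => v; have [w [wv wK]] := KH v.
exists w; split=> //; apply: le_trans wK _; rewrite ler_wpM2r ?nm_ge0 //.
apply: le_trans (ltW (archi_boundP (ltW K0))) _.
by rewrite ler_nat.
Qed.

Lemma all_good m0 i y : tame h -> cod (chart_of i) y ->
  accessible_set h m0 (bwd (chart_of i) y) -> good h m0 i y.
Proof.
move=> tm yi Ly.
have [j [z [zj Lz gz]]] := exists_good m0 tm.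
pose P m := exists k (x : model k), [/\ cod (chart_of k) x, bwd (chart_of k) x = m &
  good h m0 k x].
have step k (x0 : model k) : cod (chart_of k) x0 -> exists2 r : reals S, 0 < r &
    forall x w, nm (x - x0) < r -> nm w < r -> cod (chart_of k) x ->
    P (hloc k (x, w)) -> good h m0 k x.
  move=> x0k; have [r r0 rH] := good_transfer alg_h m0 x0k.
  exists r => // x w xr wr xk [l [x' [x'l x'E gx']]].
  have xwl : hdom k l (x, w) by split=> //=; rewrite -x'E; exact: bwd_dom.
  by apply: (rH x w xr wr l xwl); rewrite !hrepE -x'E bwdK.
have PH : P (bwd (chart_of i) y).
  apply: (@leaf_induction P _ (bwd (chart_of j) z) (bwd (chart_of i) y)).
  - move=> k x0 x0k; have [r r0 rH] := step k x0 x0k.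
    by exists r => // x w xr wr xk Px; exists k, x; split=> //; exact: rH Px.
  - by rewrite (accessible_eq alg_h Lz).
  - by exists j, z.
(* [P] provides goodness in some chart; the transfer along the zero vector converts it to chart
   [i]. *)
have [r r0 rH] := step i y yi.
by apply: (rH y 0); rewrite ?subrr ?nm0 // hloc0.
Qed.

End GoodPoint.

Lemma open_preimage_on (T1 T2 : topologicalType) (U : set T1) (f : T1 -> T2)
    (V : set T2) : open U -> (forall x, U x -> {for x, continuous f}) -> open V ->
  open (U `&` f @^-1` V).
Proof.
move=> oU cf oV; rewrite openE => x [Ux Vx]; apply: filterI.
  exact: open_nbhs_nbhs.
by apply: (cf x Ux); exact: open_nbhs_nbhs.
Qed.

(** * Foliated charts *)

Section KernelLift.
Context {S : scalars} {X : completeNormedModType S}.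

Lemma nm_kval (f : clin X X) (x : kernel_space f) : nm (kval x) = nm x.
Proof. exact: nm_inj. Qed.

Definition kernel_lift (f : clin X X) (g : {linear X -> X})
  (fg : forall x, f (g x) == 0) (x : X) : kernel_space f := KernelSpace (fg x).

Lemma kernel_lift_lin (f : clin X X) (g : {linear X -> X})
  (fg : forall x, f (g x) == 0) : linear (@kernel_lift f g fg).
Proof. by move=> a x y; apply: kval_inj; rewrite kval_lin /= linearP. Qed.

Lemma kernel_lift_cont (f : clin X X) (g : {linear X -> X})
  (fg : forall x, f (g x) == 0) : continuous g -> continuous (@kernel_lift f g fg).
Proof.
move=> /lin_bound[C _ CH].
apply: (@bound_lin _ _ _ (mklin (@kernel_lift_lin f g fg)) C) => x.
by rewrite -nm_kval; exact: CH.
Qed.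

Lemma kval_cont (f : clin X X) : continuous (@kval S X f).
Proof.
apply: (@bound_lin _ _ _ (mklin (@kval_lin S X f)) 1) => x.
by rewrite mul1r /= nm_kval.
Qed.

End KernelLift.

Section Transversal.
Context {S : scalars}.

(** [d] is close to [f] in the kernel of [P] and to [v] in its image, so [v = P (v - f)] is small
    compared with [f], and hence so is [f] itself. The constant 4 in the bound on [e] leaves room
    for these comparisons. *)
Lemma transversal_zero (X : normedModType S) (P : {linear X -> X}) (B e : reals S)
    (f d v : X) :
  (forall x, nm (P x) <= B * nm x) -> 0 <= B -> e * (4 * (1 + B)) <= 1 -> 0 < e ->
  P f = 0 -> P v = v -> nm (d - f) <= e * nm f -> nm (d - v) <= e * nm d -> f = 0.
Proof.
move=> PB B0 eB e0 Pf Pv df dv.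
have e1 : e * B <= 1 / 4 - e by move: eB; nlra.
have e4 : e <= 1 / 4 by have := mulr_ge0 (ltW e0) B0; move: e1; nlra.
have d2 : nm d <= 2 * nm f.
  have := nm_split d f; have : e * nm f <= 1 * nm f.
    by rewrite ler_wpM2r ?nm_ge0 //; move: e4; nlra.
  by move: df; nlra.
have H1 : e * nm d <= 2 * (e * nm f) by rewrite mulrCA ler_pM2l.
have H2 : nm (v - f) <= 3 * (e * nm f).
  by have := nm_tri d v f; rewrite [nm (v - d)]nmC; move: df dv H1; nlra.
have H3 : nm v <= B * (3 * (e * nm f)).
  rewrite -{1}Pv -[P v]subr0 -Pf -linearB; apply: le_trans (PB _) _.
  exact: ler_wpM2l.
have H4 := nm_split f v; rewrite nmC in H4.
have H5 : B * (e * nm f) <= (1 / 4 - e) * nm f.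
  by rewrite mulrA [B * e]mulrC ler_wpM2r ?nm_ge0.
have H6 : e * nm f <= 1 / 4 * nm f by rewrite ler_wpM2r ?nm_ge0.
apply/eqP; rewrite -nm_eq0 eq_le nm_ge0 andbT.
by move: H2 H3 H4 H5 H6; nlra.
Qed.

End Transversal.

Lemma open_ball0 (S : scalars) (E : normedModType S) (r : reals S) :
  open [set x : E | nm x < r].
Proof.
by have := open_ball_nm (0 : E) r; under eq_set do rewrite subr0.
Qed.

(** [sE] plays the image and [sF] the kernel of a projection [p]. The inclusions are isometric, so
    balls in the factors are controlled by balls in [X]. *)
Record splitting (S : scalars) (X : completeNormedModType S) (p : X -> X) := Splitting {
  sE : completeNormedModType S;
  sF : completeNormedModType S;
  jE : {linear sE -> X};
  jF : {linear sF -> X};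
  pE : {linear X -> sE};
  pF : {linear X -> sF};
  jE_cont : continuous jE;
  jF_cont : continuous jF;
  pE_cont : continuous pE;
  pF_cont : continuous pF;
  nm_jE : forall a, nm (jE a) = nm a;
  nm_jF : forall b, nm (jF b) = nm b;
  jEK : cancel jE pE;
  jFK : cancel jF pF;
  pEjF : forall b, pE (jF b) = 0;
  pFjE : forall a, pF (jE a) = 0;
  jpE : forall x, jE (pE x) = p x;
  jpF : forall x, jF (pF x) = x - p x }.

Lemma projection_splitting (S : scalars) (X : completeNormedModType S)
    (p : {linear X -> X}) :
  continuous p -> (forall x, p (p x) = p x) -> inhabited (splitting p).
Proof.
move=> cp pp.
(* The image of [p] is obtained as the kernel of the complementary projection, so that both factors
   are complete as kernels. *)
have ql : linear (fun u => u - p u) by move=> a u v; rewrite linearP scalerBr; abel.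
have cq : continuous (mklin ql).
  by move=> u; apply: cvgB; [exact: cvg_id|exact: cp].
pose P := Clin cp; pose Q := Clin cq.
have Qp x : Q (p x) == 0 by rewrite /= pp subrr.
have Pq x : P (mklin ql x) == 0 by rewrite /= linearB pp subrr.
have Qk (a : kernel_space Q) : p (kval a) = kval a.
  by apply/esym/eqP; rewrite -subr_eq0; exact: (@kvalP S X Q a).
have Pk (b : kernel_space P) : p (kval b) = 0 by exact: (@kvalE S X P b).
split; apply: (@Splitting S X p (kernel_space Q) (kernel_space P)
  (mklin (@kval_lin S X Q)) (mklin (@kval_lin S X P))
  (mklin (kernel_lift_lin Qp)) (mklin (kernel_lift_lin Pq))).
- exact: kval_cont.
- exact: kval_cont.
- exact: kernel_lift_cont.
- exact: kernel_lift_cont.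
- exact: nm_kval.
- exact: nm_kval.
- by move=> a; apply: kval_inj; exact: Qk.
- by move=> b; apply: kval_inj; rewrite /= Pk subr0.
- by move=> b; apply: kval_inj; exact: Pk.
- by move=> a; apply: kval_inj; rewrite /= Qk subrr.
- by [].
- by [].
Qed.

Section LocalModel.
Context {S : scalars} {X : completeNormedModType S}.
Variables (H : X * X -> X) (Om : set (X * X)) (x0 : X) (A G : {linear X -> X}).
Hypotheses (oOm : open Om) (sH : smooth_on Om H) (Om0 : Om (x0, 0)).
Hypotheses (H0 : H (x0, 0) = x0) (dH0 : forall u v, 'd H (x0, 0) (u, v) = u + A v).
Hypotheses (cA : continuous A) (cG : continuous G).
Hypothesis AGA : forall u, A (G (A u)) = A u.
Variable s : splitting (A \o G).

Definition chart_arg (z : X) := (x0 + jF s (pF s z), G (jE s (pE s z))).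

Definition chart_map z := H (chart_arg z).

Definition chart_arg_diff (v : X) := (jF s (pF s v), G (jE s (pE s v))).

Lemma has_diff_chart_arg z : has_diff chart_arg z chart_arg_diff.
Proof.
apply: has_diff_pair.
  exact: (has_diff_comp (has_diff_comp (has_diff_lin z (@pF_cont _ _ _ s)) erefl
    (has_diff_lin _ (@jF_cont _ _ _ s))) erefl (has_diff_addl x0 _)).
exact: (has_diff_comp (has_diff_comp (has_diff_lin z (@pE_cont _ _ _ s)) erefl
  (has_diff_lin _ (@jE_cont _ _ _ s))) erefl (has_diff_lin _ cG)).
Qed.

Lemma chart_arg_smooth : smooth_on setT chart_arg.
Proof.
apply: smooth_on_pair; first exact: openT.
  apply: smooth_on_add; [exact: openT|exact: smooth_on_cst|].
  apply: (@smooth_on_comp _ _ _ _ _ setT (pF s) (jF s)) => //.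
  - exact: openT.
  - by apply: smooth_on_lin; [exact: openT|exact: pF_cont].
  - by apply: smooth_on_lin; [exact: openT|exact: jF_cont].
apply: (@smooth_on_comp _ _ _ _ _ setT (jE s \o pE s) G) => //.
- exact: openT.
- apply: (@smooth_on_comp _ _ _ _ _ setT (pE s) (jE s)) => //.
  + exact: openT.
  + by apply: smooth_on_lin; [exact: openT|exact: pE_cont].
  + by apply: smooth_on_lin; [exact: openT|exact: jE_cont].
- by apply: smooth_on_lin => //; exact: openT.
Qed.

Lemma chart_arg0 : chart_arg 0 = (x0, 0).
Proof. by rewrite /chart_arg !linear0 addr0. Qed.

Lemma open_chart_arg : open [set z | Om (chart_arg z)].
Proof.
rewrite -[X in open X]setTI; apply: (@open_preimage_on _ _ setT chart_arg) => //.
- exact: openT.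
- by move=> z _; apply: (smooth_on_cont chart_arg_smooth).
Qed.

Lemma chart_map_smooth : smooth_on [set z | Om (chart_arg z)] chart_map.
Proof.
apply: (@smooth_on_comp _ _ _ _ _ Om chart_arg H) => //.
- exact: open_chart_arg.
- by apply: smooth_on_sub chart_arg_smooth.
Qed.

Lemma has_diff_chart_map z : Om (chart_arg z) ->
  has_diff chart_map z (fun v => 'd H (chart_arg z) (chart_arg_diff v)).
Proof.
move=> Oz; apply: (has_diff_comp (has_diff_chart_arg z) erefl).
by apply: has_diffP; exact: (smooth_on_diff sH Oz).
Qed.

(** With [p = A \o G], the transverse part contributes [v - p v] and the leaf part
    [p (p v) = p v]. *)
Lemma diff_chart_map0 v : 'd chart_map 0 v = v.
Proof.
have [] := @has_diff_chart_map 0; first by rewrite chart_arg0.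
move=> _ ->; rewrite chart_arg0 dH0 jpF jpE /=.
by rewrite AGA subrK.
Qed.

Lemma chart_arg_diffE a : chart_arg_diff (jE s a) = (0, G (jE s a)).
Proof. by rewrite /chart_arg_diff pFjE linear0 jEK. Qed.

Lemma diff_chart_map_E z a : Om (chart_arg z) ->
  'd chart_map z (jE s a) = 'd H (chart_arg z) (0, G (jE s a)).
Proof.
move=> Oz; have [_ /(_ (jE s a)) E] := has_diff_chart_map Oz.
by rewrite E; congr ('d _ _ _); exact: chart_arg_diffE.
Qed.

End LocalModel.

Section FoliatedChart.
Context {S : scalars} {M : atlas S} (h : tangent_bundle M -> M).

(* In [fch] accessible sets are unions of plaques [b = const], and the
   distribution is tangent to the plaques at the points accessible from [y]. *)
Record foliated (y : M) := Foliated {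
  fE : completeNormedModType S;
  fF : completeNormedModType S;
  fch : chart (fE * fF)%type M;
  frad : reals S;
  frad_gt0 : 0 < frad;
  fcodE : cod fch = [set a | nm a < frad] `*` [set b | nm b < frad];
  fatlas : atlas_chart fch;
  fdom_center : dom fch y;
  ffwd_center : fwd fch y = (0, 0);
  fdom_sub : dom fch `<=` dom (chart_of (chart_at y));
  fplaque : forall m p, cod fch p -> accessible_set h m (bwd fch p) <->
    accessible_set h m (bwd fch (0, p.2));
  ftangent : forall z, dom fch z -> accessible_set h y z -> forall u,
    'd (snd \o fwd fch \o bwd (chart_of (chart_at y))) (fwd (chart_of (chart_at y)) z)
       (anchor h (chart_at y) (fwd (chart_of (chart_at y)) z) u) = 0;
  fincl : exists (f : {linear fE -> tangent_space y})
      (r : {linear tangent_space y -> fE}),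
    [/\ continuous r, cancel f r,
     has_diff (fun a => fwd (chart_of (chart_at y)) (bwd fch (a, 0))) 0 f &
     range f = induced_distribution h y] }.

Hypothesis alg_h : tangent_algebra h.
Hypothesis tame_h : tame h.

Lemma foliated_exists y : inhabited (foliated y).
Proof.
pose i := chart_at y; pose X := model i; pose x0 : X := fwd (chart_of i) y.
have yi : dom (chart_of i) y by exact: chart_at_dom.
have x0i : cod (chart_of i) x0 by exact: fwd_cod.
pose A : {linear X -> X} := mklin (@anchor_lin _ _ h i x0).
have AE u : A u = algebra_anchor h y u by rewrite (algebra_anchorE alg_h).
have [G cG AGA'] := tame_split alg_h y tame_h.
have AGA u : A (G (A u)) = A u by rewrite !AE.
have cA : continuous A.
  by have [C _ CH] := anchor_bound alg_h x0i; exact: (@bound_lin _ _ _ A C CH).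
have pl : linear (A \o G).
  by move=> a u v; rewrite -[LHS]/(A (G (a *: u + v))) !linearP.
have cp : continuous (mklin pl).
  by move=> u; apply: continuous_comp; [exact: cG|exact: cA].
(* [A G A = A] makes [A \o G] a projection with the same image as [A], that is onto D_y. *)
have [s] := projection_splitting cp (fun u => AGA (G u)).
have [B B0 BP] := lin_bound cp.
have B1 : 0 < 4 * (1 + B) by rewrite mulr_gt0 // addr_gt0.
(* The tolerance of [transversal_zero], used both for the continuity of D and for the derivative of
   the chart map. *)
pose e := (4 * (1 + B))^-1; have e0 : 0 < e by rewrite invr_gt0.
have eB : e * (4 * (1 + B)) <= 1 by rewrite mulVf // gt_eqF.
have Lx0 : accessible_set h y (bwd (chart_of i) x0).
  by rewrite fwdK //; exact: accessible_refl.
have [rg rg0 rgH] := all_good alg_h tame_h x0i Lx0 e0.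
have oH := @open_hdom _ _ _ alg_h i i; have sH := hrep_smooth alg_h i i.
have xD := hdom00 alg_h x0i.
have H0 : hrep h i i (x0, 0) = x0 by exact: hrep0.
have dH0 u v : 'd (hrep h i i) (x0, 0) (u, v) = u + A v.
  rewrite -[in RHS](hrep_diff_id alg_h u x0i) -[A v]/('d (hrep h i i) (x0, 0) (0, v)).
  rewrite -linearD; congr ('d _ _ _).
  by rewrite -[RHS]/(u + 0, 0 + v) addr0 add0r.
pose arg := chart_arg x0 s; pose psi := chart_map (hrep h i i) x0 s.
have oU : open [set z | hdom h i i (arg z)] by exact: open_chart_arg.
have spsi : smooth_on [set z | hdom h i i (arg z)] psi by exact: chart_map_smooth.
have arg0 : arg 0 = (x0, 0) by exact: chart_arg0.
have psi0 : psi 0 = x0 by rewrite /psi /chart_map -/arg arg0.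
(* The second condition keeps the chart inside the ball on which D along the leaf is close to
   D_y. *)
pose U := [set z | hdom h i i (arg z)] `&` psi @^-1` [set z | nm (z - x0) < rg].
have oUg : open U.
  apply: open_preimage_on => //; last exact: open_ball_nm.
  by move=> z; exact: (smooth_on_cont spsi).
have U0 : U 0 by split; rewrite /= ?psi0 ?subrr ?nm0 // arg0.
have sU : smooth_on U psi by apply: smooth_on_sub spsi => z [].
have dpsi0 : forall v, 'd psi 0 v = v by exact: diff_chart_map0.
have [r [g [V [r0 [oV sgV] rH gH]]]] := local_inverse oUg sU U0 dpsi0 e0.
(* Two components of norm below [rho] have a sum of norm below [r]. *)
pose rho := r / 2; have rho0 : 0 < rho by rewrite divr_gt0.
pose sg (p : sE s * sF s) := jE s p.1 + jF s p.2.
pose bw p := bwd (chart_of i) (psi (sg p)).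
pose pr q := (pE s q, pF s q).
pose fw m := pr (g (fwd (chart_of i) m)).
pose cd := [set a : sE s | nm a < rho] `*` [set b : sF s | nm b < rho].
pose dm := [set m | [/\ dom (chart_of i) m, V (fwd (chart_of i) m) & cd (fw m)]].
have ocd : open cd by apply: open_setX; exact: open_ball0.
have prsg p : pr (sg p) = p.
  case: p => a b; rewrite /pr /sg /=; congr (_, _).
    by rewrite linearD jEK pEjF addr0.
  by rewrite linearD jFK pFjE add0r.
have sgpr q : sg (pr q) = q by rewrite /sg /pr /= jpE jpF subrKC.
have sgr p : cd p -> nm (sg p - 0) < r.
  case: p => a b [/= ar br]; rewrite subr0 /sg /=; apply: le_lt_trans (nmD _ _) _.
  by rewrite nm_jE nm_jF; move: ar br; rewrite /rho; nlra.
have psi_cod q : U q -> cod (chart_of i) (psi q).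
  by move=> [Uq _]; exact: (fwd_cod Uq.2).
have psi_hloc q : U q -> bwd (chart_of i) (psi q) = hloc h i (arg q).
  by move=> [Uq _]; exact: (fwdK Uq.2).
have cdU p : cd p -> [/\ U (sg p), V (psi (sg p)) & g (psi (sg p)) = sg p].
  by move=> /sgr /rH[].
have fwbw p : cd p -> fw (bw p) = p.
  move=> cp'; have [Up Vp gp] := cdU p cp'.
  by rewrite /fw /bw bwdK; [rewrite gp prsg|exact: psi_cod].
have dmbw p : cd p -> dm (bw p).
  move=> cp'; have [Up Vp gp] := cdU p cp'; split.
  - exact/bwd_dom/psi_cod.
  - by rewrite /bw bwdK //; exact: psi_cod.
  - by rewrite fwbw.
have bwfw m : dm m -> bw (fw m) = m.
  by move=> [mi Vm _]; rewrite /bw /fw sgpr (gH _ Vm).2 fwdK.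
pose c := @Chart S _ M dm cd fw bw ocd (fun m mH => let: And3 _ _ mc := mH in mc)
  dmbw bwfw fwbw.
have ssg : smooth_on setT sg.
  apply: smooth_on_add; first exact: openT.
    apply: (@smooth_on_comp _ _ _ _ _ setT fst (jE s)) => //; first exact: openT.
      exact: smooth_on_fst.
    by apply: smooth_on_lin; [exact: openT|exact: jE_cont].
  apply: (@smooth_on_comp _ _ _ _ _ setT snd (jF s)) => //; first exact: openT.
    exact: smooth_on_snd.
  by apply: smooth_on_lin; [exact: openT|exact: jF_cont].
have spr : smooth_on setT pr.
  apply: smooth_on_pair; first exact: openT.
    by apply: smooth_on_lin; [exact: openT|exact: pE_cont].
  by apply: smooth_on_lin; [exact: openT|exact: pF_cont].
have spsg : smooth_on cd (psi \o sg).
  apply: (@smooth_on_comp _ _ _ _ _ U) => //.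
  - by move=> p /cdU[].
  - exact: smooth_on_sub ssg.
have sprg : smooth_on V (pr \o g).
  by apply: (@smooth_on_comp _ _ _ _ _ setT g pr).
have atl : atlas_chart c.
  move=> j; split; rewrite /smooth_transition /=.
    pose W := cod (chart_of i) `&` bwd (chart_of i) @^-1` dom (chart_of j).
    have oW : open W by case: (atlas_compat i j).
    have -> : cd `&` bw @^-1` dom (chart_of j) = cd `&` (psi \o sg) @^-1` W.
      apply/seteqP; split=> p [cp' /= pj]; split=> //; last by case: pj.
      by split=> //; apply: psi_cod; case: (cdU p cp').
    have oP : open (cd `&` (psi \o sg) @^-1` W).
      by apply: open_preimage_on => // p; exact: (smooth_on_cont spsg).
    split=> //.
    apply: (@smooth_on_comp _ _ _ _ _ W (psi \o sg)
      (fwd (chart_of j) \o bwd (chart_of i))) => //.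
    - by move=> p [].
    - by apply: smooth_on_sub spsg => p [].
    - exact: transition_smooth.
  pose W := cod (chart_of j) `&` bwd (chart_of j) @^-1` dom (chart_of i).
  have oW : open W by case: (atlas_compat j i).
  pose t := fwd (chart_of i) \o bwd (chart_of j).
  have st : smooth_on W t by exact: transition_smooth.
  have oV' : open (V `&` (pr \o g) @^-1` cd).
    by apply: open_preimage_on => // z; exact: (smooth_on_cont sprg).
  have -> : cod (chart_of j) `&` bwd (chart_of j) @^-1` dm =
      W `&` t @^-1` (V `&` (pr \o g) @^-1` cd).
    by apply/seteqP; split=> z; [case=> zj [zi Vz cz]|case=> [[zj zi] [Vz cz]]].
  have oP : open (W `&` t @^-1` (V `&` (pr \o g) @^-1` cd)).
    by apply: open_preimage_on => // z; exact: (smooth_on_cont st).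
  split=> //; apply: (@smooth_on_comp _ _ _ _ _ V t (pr \o g)) => //.
  - by move=> z [_ []].
  - by apply: smooth_on_sub st => z [].
have Vx0 : V x0 by rewrite -psi0; case: (rH 0) => //; rewrite subrr nm0.
have gx0 : g x0 = 0.
  by rewrite -psi0; case: (rH 0) => //; rewrite subrr nm0.
have dc : dm y.
  by split=> //; rewrite /fw /pr -/x0 gx0 !linear0; split; rewrite /= nm0.
have fc : fw y = (0, 0) by rewrite /fw /pr -/x0 gx0 !linear0.
(* All points with transverse coordinate [b] have the form [h (x0 + b, G a)], so they are accessible
   from the one point [x0 + b]. *)
have plq m p : cd p -> accessible_set h m (bw p) <-> accessible_set h m (bw (0, p.2)).
  have acc q : cd q -> accessible_set h m (bw q) <->
      accessible_set h m (bwd (chart_of i) (x0 + jF s q.2)).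
    move=> cq; have [[Uq _] _ _] := cdU q cq.
    rewrite /bw psi_hloc; last by case: (cdU q cq).
    have aE : arg (sg q) = (x0 + jF s q.2, G (jE s q.1)).
      have e1 : pE s (sg q) = q.1 := congr1 fst (prsg q).
      have e2 : pF s (sg q) = q.2 := congr1 snd (prsg q).
      by rewrite /arg /chart_arg e1 e2.
    rewrite aE; apply: accessible_hlocE => //.
    by have [] := Uq; rewrite aE.
  move=> cp'; have cp0 : cd (0, p.2) by case: cp' => _ ?; split=> //=; rewrite nm0.
  by apply: iff_trans (acc p cp') _; apply: iff_sym; exact: acc (0, p.2) cp0.
split; apply: (@Foliated y (sE s) (sF s) c rho) => //.
- by move=> m [].
- move=> z [zi Vz cz] Lz u; rewrite -/i; set w := fwd (chart_of i) z in Vz *.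
  have [gr pg] := gH w Vz; set q := g w in gr pg.
  have [[Uq psr] _ _ est] := rH q gr.
  have wi : cod (chart_of i) w by exact: fwd_cod.
  have dg := has_diffP (smooth_on_diff sgV Vz); rewrite -/q in dg.
  have dq := has_diffP (smooth_on_diff spsi Uq).
  have d1 : has_diff (snd \o fw \o bwd (chart_of i)) w (pF s \o 'd g w).
    have := has_diff_comp dg erefl (has_diff_lin (g w) (@pF_cont _ _ _ s)).
    apply: (has_diff_near (U := V `&` cod (chart_of i))) => //.
    - by apply: openI => //; exact: cod_open.
    - by move=> v [Vv vi]; rewrite /= bwdK.
  have [_ ->] := d1; rewrite /=; set d := 'd g w _.
  have pd : 'd psi q d = anchor h i w u.
    have d2 : has_diff (psi \o g) w id.
      apply: (has_diff_near (U := V) (f := id)) (has_diff_id w) => //.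
      by move=> v /gH[_].
    have := has_diff_uniq (anchor h i w u) (has_diff_comp dg erefl dq) d2.
    exact.
  (* The transverse part of [d]. The plaque part is mapped into D_z by [anchor_partial], hence so is
     [f]. Its image is close to [f] by the inverse function estimate and to D_y by continuity, which
     forces [f = 0]. *)
  pose f := jF s (pF s d).
  have [u1 u1E] : exists u1, 'd psi q (jE s (pE s d)) = anchor h i w u1.
    have argw : hrep h i i (arg q) = w by exact: pg.
    exists ('d (hrep h i i) (arg q) (G (jE s (pE s d)), 0)).
    have E1 : 'd psi q (jE s (pE s d)) = 'd (hrep h i i) (arg q) (0, G (jE s (pE s d))).
      exact: diff_chart_map_E.
    apply: (etrans E1); apply: (etrans (esym (anchor_partial alg_h _ Uq))).
    exact: (congr1 (fun t => anchor h i t _) argw).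
  have pf : 'd psi q f = anchor h i w (u - u1).
    rewrite anchorB -pd -u1E -linearB; congr ('d _ _ _).
    by rewrite /f jpE jpF.
  have [u' u'E] : exists u', nm (anchor h i w (u - u1) - A u') <=
      e * nm (anchor h i w (u - u1)).
    by apply: rgH => //; [move: psr; rewrite /= pg|rewrite fwdK].
  suff f0 : f = 0 by rewrite -(jFK (s := s) (pF s d)) -/f f0 linear0.
  apply: (@transversal_zero _ _ (mklin pl) B e f (anchor h i w (u - u1)) (A u')) => //.
  - exact: ltW.
  - by apply: etrans (esym (jpE s f)) _; rewrite /f pEjF linear0.
  - exact: AGA.
  - by rewrite -pf.
- exists (jE s), (pE s); split.
  + exact: pE_cont.
  + exact: jEK.
  + have dp : has_diff psi 0 id by split=> //; exact: (smooth_on_diff sU U0).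
    have := has_diff_comp (has_diff_lin 0 (@jE_cont _ _ _ s)) (linear0 _) dp.
    apply: (has_diff_near (U := [set a | nm a < rho])).
    * exact: open_ball0.
    * by rewrite /= nm0.
    * move=> a /= ar; rewrite /bw -/i /sg /= linear0 addr0 bwdK //; apply: psi_cod.
      have [|+ _ _] := cdU (a, 0); first by split; rewrite /= ?nm0.
      by rewrite /sg /= linear0 addr0.
  + apply/seteqP; split=> [_ [a _ <-]|_ [u _ <-]].
      exists (G (jE s a)); first exact: I.
      apply: etrans (esym (AE _)) _; apply: etrans (esym (jpE s (jE s a))) _.
      by rewrite jEK.
    exists (pE s (algebra_anchor h y u)); first exact: I.
    by apply: etrans (jpE s _) _; apply: etrans (AE _) _; exact: AGA'.
Qed.

End FoliatedChart.

(** * Paracompactness and countably valued maps *)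

Section Paracompact.
Context {T : topologicalType}.

Lemma nbhs_bigcap_finite (I : choiceType) (D : set I) (f : I -> set T) (x : T) :
  finite_set D -> (forall i, D i -> nbhs x (f i)) -> nbhs x (\bigcap_(i in D) f i).
Proof. by move=> /finite_fsetP[X ->] H; apply: filter_bigI => i iX; exact: H. Qed.

Lemma closed_bigcup_finite (I : choiceType) (D : set I) (f : I -> set T) :
  finite_set D -> (forall i, D i -> closed (f i)) -> closed (\bigcup_(i in D) f i).
Proof.
move=> fD H; rewrite -openC setC_bigcup openE => x Hx.
apply: nbhs_bigcap_finite => // i Di; apply: open_nbhs_nbhs; split; last exact: Hx.
by rewrite openC; exact: H.
Qed.

(** Refine the cover by the complement of [C] and the open sets missing a neighbourhood of [x]. The
    members that meet [C] are of the second kind, and only finitely many of them come near [x], so a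
    neighbourhood of [x] avoids their union. *)
Lemma paracompact_separation (C : set T) (x : T) :
  hausdorff_space T -> paracompact T -> closed C -> ~ C x ->
  exists (U V : set T), [/\ open U, open V, U x, C `<=` V & U `&` V = set0].
Proof.
move=> hT pT clC nCx.
pose I := [set A : set T | open A /\ exists2 N, nbhs x N & A `&` N = set0].
pose O := [set A | A = ~` C \/ I A].
have [|D [[oD cD] lfD DO]] := pT O.
  split=> [A [->|[]//]|]; first exact: closed_openC.
  apply/seteqP; split=> // z _; have [Cz|nCz] := pselect (C z); last first.
    by exists (~` C) => //; left.
  have xz : x != z by apply: contra_notN nCx => /eqP ->.
  have := hT; rewrite open_hausdorff => /(_ x z xz)[[P Q] [/= Px Qz] [oP oQ PQ]].
  exists Q => //; last by rewrite inE in Qz.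
  right; split=> //; exists P; last by rewrite setIC; exact/eqP.
  by rewrite inE in Px; exact: open_nbhs_nbhs.
pose W := [set A | D A /\ A `&` C !=set0].
have WI A : W A -> exists2 N, nbhs x N & A `&` N = set0.
  move=> [DA [z [Az Cz]]]; have [B [->|[oB [N xN BN]]] AB] := DO A DA.
    by have := AB z Az.
  by exists N => //; apply/seteqP; split=> // w [Aw Nw]; rewrite -BN; split=> //; exact: AB.
have [N0 xN0 fN0] := lfD x.
have [N xN NW] : exists2 N, nbhs x N & forall A, W A -> A `&` N = set0.
  pose FW := [set A | D A /\ A `&` N0 !=set0] `&` W.
  have fFW : finite_set FW by apply: sub_finite_set fN0 => A [].
  have /choice[f fP] : forall A, exists N, W A -> nbhs x N /\ A `&` N = set0.
    move=> A; have [WA|nWA] := pselect (W A); last by exists setT.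
    by have [N xN AN] := WI A WA; exists N.
  exists (N0 `&` \bigcap_(A in FW) f A).
    by apply: filterI => //; apply: nbhs_bigcap_finite => // A [_ /fP[]].
  move=> A WA; apply/seteqP; split=> // z [Az [N0z bz]].
  have FA : FW A by split=> //; case: WA => DA _; split=> //; exists z.
  by have [_ <-] := fP A WA; split=> //; exact: bz.
have [U [oU Ux] UN] : exists2 U, open_nbhs x U & U `<=` N by move: xN; rewrite nbhsE.
exists U, (\bigcup_(A in W) A); split=> //.
- by apply: bigcup_open => A [/oD].
- move=> z Cz; have [A DA Az] : (\bigcup_(A in D) A) z by rewrite cD.
  by exists A => //; split=> //; exists z.
- apply/seteqP; split=> // z [Uz [A WA Az]].
  by rewrite -(NW A WA); split=> //; exact: UN.
Qed.

(* Subtracting from each member of a countable refinement the closures of the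
   earlier, smaller, members makes it locally finite. *)
Lemma regular_lindelof_paracompact :
  (forall (x : T) (O : set T), open O -> O x ->
     exists U, [/\ open U, U x & closure U `<=` O]) ->
  (forall N : T -> set T, (forall x, nbhs x (N x)) ->
     exists2 C : set T, countable C & forall x, exists2 c, C c & N c x) ->
  paracompact T.
Proof.
move=> rT lT C [oC cC].
have /choice[f fP] : forall x, exists UA : set T * set T,
    [/\ open UA.1, UA.1 x, closure UA.1 `<=` UA.2 & C UA.2].
  move=> x; have [A CA Ax] : (\bigcup_(A in C) A) x by rewrite cC.
  by have [U [oU Ux UA]] := rT x A (oC A CA) Ax; exists (U, A).
have [D cD DP] := lT (fun x => (f x).1) (fun x => let: And4 oU Ux _ _ := fP x in
  open_nbhs_nbhs (conj oU Ux)).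
have /countable_injP[g gI] := cD.
pose V c := (f c).2 `\` \bigcup_(d in [set d | D d /\ (g d < g c)%N]) closure (f d).1.
have fin n : finite_set [set d | D d /\ (g d < n)%N].
  set A := [set d | _]; have /eq_finite_set <- : (g @` A #= A)%card.
    by apply: inj_card_eq => a b; rewrite !inE => -[Da _] [Db _]; apply: gI; rewrite inE.
  by apply: sub_finite_set (finite_II n) => _ [d [_ gd] <-].
exists (V @` D); split.
- split.
    move=> _ [c Dc <-]; rewrite /V setDE; apply: openI.
      by case: (fP c) => _ _ _ /oC.
    apply: closed_openC; apply: closed_bigcup_finite => //.
    by move=> d _; exact: closed_closure.
  apply/seteqP; split=> // x _.
  (* For the least index whose smaller closure contains [x], none of the subtracted closures
     does. *)
  pose P n := `[< exists2 c, D c & g c = n /\ closure (f c).1 x >].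
  have exP : exists n, P n.
    have [c Dc cx] := DP x; exists (g c); apply/asboolP; exists c => //.
    by split=> //; exact: subset_closure.
  case: (ex_minnP exP) => n /asboolP[c Dc [gc cx]] nmin.
  exists (V c); first by exists c.
  split; first by case: (fP c) => _ _ + _; exact.
  move=> [d [Dd gd] dx]; have : P (g d) by apply/asboolP; exists d.
  by move/nmin; rewrite leqNgt -gc gd.
- move=> x; have [c Dc cx] := DP x; exists (f c).1.
    by apply: open_nbhs_nbhs; split=> //; case: (fP c).
  apply: (@sub_finite_set _ _ (V @` [set d | D d /\ (g d < (g c).+1)%N])); last first.
    exact: finite_image.
  move=> _ [[d Dd <-] [z [Vz cz]]]; exists d => //; split=> //.
  rewrite ltnS leqNgt; apply/negP => gcd; case: Vz => _; apply.
  by exists c => //; exact: subset_closure.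
- by move=> _ [c Dc <-]; exists (f c).2; [case: (fP c)|exact: subDsetl].
Qed.

End Paracompact.

Section CountableValues.
Context {S : scalars}.

Lemma countable_image (T U : Type) (A : set T) (f : T -> U) :
  countable A -> countable (f @` A).
Proof. by apply: sub_countable; exact: card_image_le. Qed.

Lemma countable_segment (R : realType) (C : set R) (v : R) : countable C ->
  (forall t, 0 <= t <= v -> C t) -> v <= 0.
Proof.
move=> cC vC; rewrite leNgt; apply/negP => v0.
have cI : countable `[0, v]%classic.
  apply: sub_countable cC; apply: subset_card_le => t /=.
  by rewrite in_itv /=; exact: vC.
have := countable_lebesgue_measure0 cI.
rewrite lebesgue_measure_itv /= lte_fin v0 -EFinB subr0 => /eqP.
by rewrite eqe gt_eqF.
Qed.

(* The norm of [f - f x] along a segment takes countably many values, hence none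
   but [0] by the intermediate value theorem. *)
Lemma countable_constant (E F : normedModType S) (f : E -> F) (x : E)
    (r : reals S) (C : set F) : countable C ->
  (forall y, nm (y - x) < r -> {for y, continuous f} /\ C (f y)) ->
  forall y, nm (y - x) < r -> f y = f x.
Proof.
move=> cC fC y yr.
pose l (t : reals S) := x + io S t *: (y - x).
pose phi t := nm (f (l t) - f x).
have lr t : 0 <= t <= 1 -> nm (l t - x) < r.
  move=> /andP[t0 t1]; rewrite /l addrAC subrr add0r nmZ ger0_norm //.
  by apply: le_lt_trans yr; rewrite ler_piMl // nm_ge0.
have l0 : l 0 = x by rewrite /l rmorph0 scale0r addr0.
have l1 : l 1 = y by rewrite /l rmorph1 scale1r subrKC.
have phi0 : phi 0 = 0 by rewrite /phi l0 subrr nm0.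
have cphi : {within `[0, 1], continuous phi}.
  apply: continuous_in_subspaceT => t; rewrite inE /= in_itv /= => t01.
  have [/continuous_nm cf _] := fC (l t) (lr t t01).
  apply/cvgrPdist_lt => e e0; have [d d0 dH] := cf e e0.
  have n0 : 0 < nm (y - x) + 1 by rewrite ltr_wpDl // nm_ge0.
  apply/nbhs_ballP; exists (d / (nm (y - x) + 1)) => /=; first exact: divr_gt0.
  move=> s st; have {st}sd : `|s - t| * (nm (y - x) + 1) < d.
    by rewrite -ltr_pdivlMr // distrC.
  have lst : l s - l t = io S (s - t) *: (y - x).
    by rewrite /l opprD addrACA subrr add0r -scalerBl rmorphB.
  have /dH H1 : nm (l s - l t) < d.
    rewrite lst nmZ; apply: le_lt_trans sd; apply: ler_wpM2l => //.
    by rewrite lerDl.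
  rewrite distrC; apply: le_lt_trans H1; rewrite ler_norml /phi.
  have := nm_tri (f (l t)) (f (l s)) (f x); have := nm_tri (f (l s)) (f (l t)) (f x).
  by rewrite [nm (f (l t) - f (l s))]nmC => H1 H2; apply/andP; split; lra.
have : phi 1 <= 0.
  apply: (countable_segment (countable_image (fun c => nm (c - f x)) cC)) => t t1.
  have p1 : phi 0 <= phi 1 by rewrite phi0; exact: nm_ge0.
  have [|s] := @IVT _ phi 0 1 t ler01 cphi.
    by rewrite min_l // max_r // phi0.
  rewrite in_itv /= => s01 <-; exists (f (l s)) => //.
  by have [] := fC (l s) (lr s s01).
rewrite /phi l1 => H; apply/eqP; rewrite -subr_eq0 -nm_eq0 eq_le H nm_ge0 //.
Qed.

Lemma separable_lindelof (E : normedModType S) (N : E -> set E) : separable E ->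
  (forall x, nbhs x (N x)) -> exists2 C : set E, countable C &
    forall x, exists2 c, C c & N c x.
Proof.
move=> [D cD dD] NH.
pose B (p : E * nat) := [set y : E | nm (y - p.1) < 2^-1 ^+ p.2].
(* One centre [v] is chosen for every ball of a countable base that fits into some [N v']. *)
have /choice[f fP] : forall p : E * nat, exists v,
    (exists v', B p v' /\ B p `<=` N v') -> B p v /\ B p `<=` N v.
  move=> p; have [[v H]|H] := pselect (exists v', B p v' /\ B p `<=` N v').
    by exists v.
  by exists 0 => /H.
exists (f @` (D `*` [set: nat])).
  by apply: countable_image; apply: countableX => //; exact: countableP.
move=> x; have [r r0 rH] := (nbhs_nm x (N x)).1 (NH x).
have [n nr] := half_pow_small 2 r0.
have p0 : 0 < 2^-1 ^+ n :> reals S by rewrite exprn_gt0 // invr_gt0.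
have [||d [dx Dd]] := dD [set y | nm (y - x) < 2^-1 ^+ n].
- by exists x; rewrite /= subrr nm0.
- exact: open_ball_nm.
have Bx : B (d, n) x by rewrite /B /= nmC.
have [_ BN] : B (d, n) (f (d, n)) /\ B (d, n) `<=` N (f (d, n)).
  apply: fP; exists x; split=> // y yd; apply: rH.
  by rewrite /B /= in yd; move: (nm_tri d y x) yd dx nr p0 => /=; nlra.
by exists (f (d, n)); [exists (d, n)|exact: BN].
Qed.

(** Each value is already attained on the countable dense set. *)
Lemma locally_constant_countable (E : normedModType S) (T : Type) (f : E -> T)
    (O : set E) : separable E ->
  (forall x, O x -> nbhs x [set y | O y /\ f y = f x]) -> countable (f @` O).
Proof.
move=> [D cD dD] H; apply: sub_countable (countable_image f cD).
apply: subset_card_le => _ [x Ox <-].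
have [r r0 rH] := (nbhs_nm x _).1 (H x Ox).
have [||d [dx Dd]] := dD [set y | nm (y - x) < r].
- by exists x; rewrite /= subrr nm0.
- exact: open_ball_nm.
by exists d => //; have [] := rH d dx.
Qed.

End CountableValues.

(** * Leaves *)

Section SmoothInto.
Context {K : numFieldType} {M : atlas K}.

(** Smooth maps from an open subset of a normed space, without making that subset a manifold:
    plaques and chart representatives are of this kind. *)
Definition smooth_into (E : normedModType K) (U : set E) (g : E -> M) :=
  [/\ open U, forall x, U x -> {for x, continuous g} &
      forall j : index M, smooth_on (U `&` g @^-1` dom (chart_of j))
        (fwd (chart_of j) \o g)].

Lemma smooth_into_fwd (E F : normedModType K) (U : set E) (g : E -> M)
    (c : chart F M) : atlas_chart c -> smooth_into U g ->
  smooth_on (U `&` g @^-1` dom c) (fwd c \o g).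
Proof.
move=> ac [oU cg sg]; apply: smooth_on_local => x [Ux cx].
pose j := chart_at (g x); have gj : dom (chart_of j) (g x) by exact: chart_at_dom.
have [_ [oj sj]] := ac j.
have oD : open (U `&` g @^-1` dom (chart_of j)).
  by apply: open_preimage_on => //; exact: open_dom.
pose t := fwd (chart_of j) \o g.
pose W := cod (chart_of j) `&` bwd (chart_of j) @^-1` dom c.
have oW : open ((U `&` g @^-1` dom (chart_of j)) `&` t @^-1` W).
  by apply: open_preimage_on => // y; exact: (smooth_on_cont (sg j)).
exists ((U `&` g @^-1` dom (chart_of j)) `&` t @^-1` W).
  split=> //; split; first exact: fwd_cod.
  by rewrite /preimage /mkset /t /comp fwdK.
apply: (@smooth_on_ext _ _ _ _ ((fwd c \o bwd (chart_of j)) \o t)) => //.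
  by move=> y [[_ yj] _]; rewrite /= fwdK.
apply: (smooth_on_comp (V := W)) => //; first by move=> y [].
by apply: smooth_on_sub (sg j) => y [].
Qed.

Lemma atlas_chart_open_dom (E : normedModType K) (c : chart E M) :
  atlas_chart c -> open (dom c : set M).
Proof. by move=> ac; rewrite open_atlasE => j; case: (ac j) => _ []. Qed.

Lemma atlas_chart_bwd (E : normedModType K) (c : chart E M) :
  atlas_chart c -> smooth_into (cod c) (bwd c).
Proof.
move=> ac; split; [exact: cod_open| |by move=> j; case: (ac j) => -[]].
move=> p cp A; rewrite nbhsE => -[B [oB Bp] BA]; apply: (filterS BA).
pose j := chart_at (bwd c p); have [[oj sj] _] := ac j.
have oW : open ((cod c `&` bwd c @^-1` dom (chart_of j)) `&`
    (fwd (chart_of j) \o bwd c) @^-1` (cod (chart_of j) `&` bwd (chart_of j) @^-1` B)).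
  apply: open_preimage_on => //; first by move=> y; exact: (smooth_on_cont sj).
have pj : dom (chart_of j) (bwd c p) by exact: chart_at_dom.
have : nbhs p ((cod c `&` bwd c @^-1` dom (chart_of j)) `&`
    (fwd (chart_of j) \o bwd c) @^-1` (cod (chart_of j) `&` bwd (chart_of j) @^-1` B)).
  apply: open_nbhs_nbhs; split=> //; split=> //; split; first exact: fwd_cod.
  by rewrite /preimage /mkset /comp fwdK.
by apply: filterS => y [[_ yj] [_]]; rewrite /preimage /mkset /comp fwdK.
Qed.

Lemma atlas_chart_fwd_cont (E : normedModType K) (c : chart E M) m :
  atlas_chart c -> dom c m -> {for m, continuous (fwd c)}.
Proof.
move=> ac cm A; rewrite nbhsE => -[B [oB Bm] BA].
change (nbhs m (fwd c @^-1` A)).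
pose j := chart_at m; have [_ [oj sj]] := ac j.
have mj : dom (chart_of j) m by exact: chart_at_dom.
pose W := (cod (chart_of j) `&` bwd (chart_of j) @^-1` dom c) `&`
    (fwd c \o bwd (chart_of j)) @^-1` B.
have oW : open W by apply: open_preimage_on => // y; exact: (smooth_on_cont sj).
have : nbhs m (bwd (chart_of j) @` W).
  apply: open_nbhs_nbhs; split; first by apply: chart_open_image => // y [[]].
  exists (fwd (chart_of j) m); last by rewrite fwdK.
  split; [split; first exact: fwd_cod|];
    by rewrite /preimage /mkset /comp fwdK.
by apply: filterS => _ [y [_ By] <-]; exact: BA.
Qed.

Lemma smooth_into_rep (N : atlas K) (g : N -> M) (i : index N) :
  smooth_map g -> smooth_into (cod (chart_of i)) (g \o bwd (chart_of i)).
Proof.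
move=> sg; split; [exact: cod_open| |by move=> j; exact: (smooth_map_rep i j sg)].
move=> x xi; have [cg _] := sg.
apply: continuous_comp; last exact: cg.
move=> A; rewrite nbhsE => -[B [oB Bx] BA]; apply: (filterS BA).
have : nbhs x (cod (chart_of i) `&` bwd (chart_of i) @^-1` B).
  by apply: open_nbhs_nbhs; split; first exact: open_chart_preimage.
by apply: filterS => y [].
Qed.

Lemma smooth_into_comp (E F : normedModType K) (U : set E) (V : set F)
    (f : E -> F) (g : F -> M) :
  open U -> smooth_on U f -> (forall x, U x -> V (f x)) -> smooth_into V g ->
  smooth_into U (g \o f).
Proof.
move=> oU sf UV [oV cg sg]; split=> //.
  move=> x Ux; apply: continuous_comp; first exact: (smooth_on_cont sf).
  exact/cg/UV.
move=> j; have oW : open (V `&` g @^-1` dom (chart_of j)).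
  by apply: open_preimage_on => //; exact: open_dom.
have -> : U `&` (g \o f) @^-1` dom (chart_of j) =
    U `&` f @^-1` (V `&` g @^-1` dom (chart_of j)).
  by apply/seteqP; split=> x [Ux xj]; split=> //; [split=> //; exact: UV|case: xj].
apply: (@smooth_on_comp _ _ _ _ _ (V `&` g @^-1` dom (chart_of j)) f
  (fwd (chart_of j) \o g)) => //.
- by apply: open_preimage_on => // x; exact: (smooth_on_cont sf).
- by move=> x [].
- by apply: smooth_on_sub sf => x [].
Qed.

Lemma smooth_map_from_reps (N : atlas K) (g : N -> M) :
  (forall i : index N, smooth_into (cod (chart_of i)) (g \o bwd (chart_of i))) ->
  smooth_map g.
Proof.
move=> H; split=> [x _|i j]; last by rewrite setTI; case: (H i) => _ _ /(_ j).
pose i := chart_at x; have xi : dom (chart_of i) x by exact: chart_at_dom.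
move=> A; rewrite nbhsE => -[B [oB Bx] BA].
change (nbhs x (g @^-1` A)).
have [oi ci _] := H i.
have oP : open (cod (chart_of i) `&` (g \o bwd (chart_of i)) @^-1` B).
  by apply: open_preimage_on.
have : nbhs x (bwd (chart_of i) @`
    (cod (chart_of i) `&` (g \o bwd (chart_of i)) @^-1` B)).
  apply: open_nbhs_nbhs; split; first by apply: chart_open_image => // y [].
  exists (fwd (chart_of i) x); last by rewrite fwdK.
  by split; [exact: fwd_cod|rewrite /preimage /mkset /comp fwdK].
by apply: filterS => _ [y [_ By] <-]; exact: BA.
Qed.

End SmoothInto.

Section LeafGeometry.
Context {S : scalars} {M : atlas S} (h : tangent_bundle M -> M).
Hypothesis sepM : modelled_on_separable M.
Hypothesis alg_h : tangent_algebra h.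
Variable ch : forall y, foliated h y.
Variable m0 : M.
Local Notation L := (accessible_set h m0).

Definition leaf_point (v : model (chart_at m0)) : M :=
  hloc h (chart_at m0) (fwd (chart_of (chart_at m0)) m0, v).

Lemma range_leaf_point : L = range leaf_point.
Proof. by rewrite (accessible_hloc h (chart_at_dom m0)). Qed.

Lemma leaf_point_smooth : smooth_into setT leaf_point.
Proof.
have m0i := fwd_cod (chart_at_dom m0).
have -> : leaf_point = (h \o bwd (@chart_of S (tangent_bundle M) (chart_at m0))) \o
    pair (fwd (chart_of (chart_at m0)) m0) by [].
apply: (smooth_into_comp (V := cod (@chart_of S (tangent_bundle M) (chart_at m0)))).
- exact: openT.
- apply: smooth_on_pair; [exact: openT|exact: smooth_on_cst|].
  by move=> n; apply: Ck_id; exact: openT.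
- by move=> v _; split.
- by apply: smooth_into_rep; case: alg_h.
Qed.

Lemma open_fdom k : open (dom (fch (ch k)) : set M).
Proof. exact: atlas_chart_open_dom (fatlas (ch k)). Qed.

(* Along the leaf the transverse coordinate has derivative zero, since the
   derivative of [leaf_point] takes values in the distribution. *)
Lemma leaf_point_transverse k v : L k -> dom (fch (ch k)) (leaf_point v) -> forall u,
  'd (snd \o fwd (fch (ch k)) \o leaf_point) v u = 0.
Proof.
move=> Lk vk u; pose i := chart_at m0; pose x := fwd (chart_of i) m0.
pose j := chart_at k; pose c := fch (ch k).
have vj : dom (chart_of j) (leaf_point v) by exact: (fdom_sub vk).
have xv : hdom h i j (x, v) by split=> //=; exact/fwd_cod/chart_at_dom.
have d1 := has_diff_comp (has_diff_inr x v) erefl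
  (has_diffP (smooth_on_diff (hrep_smooth alg_h i j) xv)).
have [_ [oj sj]] := fatlas (ch k) j.
have d2 : has_diff (snd \o fwd c \o bwd (chart_of j)) (hrep h i j (x, v))
    ('d (snd \o fwd c \o bwd (chart_of j)) (hrep h i j (x, v))).
  apply: has_diffP; apply: (@smooth_on_diff _ _ _
    (cod (chart_of j) `&` bwd (chart_of j) @^-1` dom c)).
    apply: (@smooth_on_comp _ _ _ _ _ setT (fwd c \o bwd (chart_of j)) snd) => //.
    exact: smooth_on_snd.
  split; first exact: fwd_cod.
  by rewrite /preimage /mkset /hrep fwdK.
have d3 := has_diff_comp d1 erefl d2.
have [_ ->] : has_diff (snd \o fwd c \o leaf_point) v
    ('d (snd \o fwd c \o bwd (chart_of j)) (hrep h i j (x, v)) \o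
      ('d (hrep h i j) (x, v) \o pair 0)).
  apply: (has_diff_near (U := leaf_point @^-1` dom (chart_of j))) d3 => //.
  - have [_ cl _] := leaf_point_smooth.
    by rewrite -[X in open X]setTI; apply: open_preimage_on; [exact: openT| |exact: open_dom].
  - by move=> w wj; rewrite /comp /hrep fwdK.
have Lk' : accessible_set h k (leaf_point v).
  by rewrite (accessible_eq alg_h Lk) range_leaf_point; exists v.
have := ftangent vk Lk' ('d (hrep h i j) (x, v) (u, 0)).
by move=> T; apply: etrans T; congr ('d _ _ _); exact/esym/(anchor_partial alg_h).
Qed.

Definition transversals k := [set (fwd (fch (ch k)) z).2 | z in L `&` dom (fch (ch k))].
Arguments transversals : clear implicits.

(** By the mean value inequality the transverse coordinate of [leaf_point] is locally constant where
    defined. That open set may have many components, and separability leaves only countably many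
    values. *)
Lemma countable_transversals k : L k -> countable (transversals k).
Proof.
move=> Lk; pose c := fch (ch k); pose f := snd \o fwd c \o leaf_point.
have -> : transversals k = f @` (leaf_point @^-1` dom c).
  apply/seteqP; split=> [_ [z [+ zc] <-]|_ [v vc <-]].
    by rewrite range_leaf_point => -[v _ vz]; exists v; rewrite /preimage /mkset /f /= vz.
  by exists (leaf_point v) => //; split=> //; rewrite range_leaf_point; exists v.
apply: locally_constant_countable; first exact: sepM.
have sl := leaf_point_smooth; have sf := smooth_into_fwd (fatlas (ch k)) sl.
have oc : open (leaf_point @^-1` dom c).
  have [_ cl _] := sl; rewrite -[X in open X]setTI.
  by apply: open_preimage_on; [exact: openT| |exact: open_fdom].
move=> v vc; apply/nbhs_nm; have [r r0 rH] := (open_nm _).1 oc v vc.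
exists r => // w wr; split; first exact: rH.
apply/eqP; rewrite -subr_eq0 -nm_eq0 eq_le nm_ge0 andbT.
rewrite -(mul0r (nm (w - v))); apply: mean_value => t /andP[t0 t1].
have tc : dom c (leaf_point (v + io S t *: (w - v))).
  apply: rH; rewrite addrAC subrr add0r nmZ ger0_norm //.
  by apply: le_lt_trans wr; rewrite ler_piMl // nm_ge0.
split; last by move=> u; rewrite leaf_point_transverse // nm0 mul0r.
apply: (@smooth_on_diff _ _ _ (setT `&` leaf_point @^-1` dom c)); last by split.
apply: (@smooth_on_comp _ _ _ _ _ setT (fwd c \o leaf_point) snd) => //.
  by rewrite setTI.
exact: smooth_on_snd.
Qed.

(** A map continuous into [M] with values in the leaf cannot jump between plaques: its transverse
    coordinate is continuous with countably many values. Both the atlas of the leaf and initiality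
    rest on this. *)
Lemma leaf_plaque (E : normedModType S) (U : set E) (f : E -> M) k x :
  open U -> (forall y, U y -> {for y, continuous f} /\ L (f y)) -> L k -> U x ->
  dom (fch (ch k)) (f x) ->
  \forall y \near x, dom (fch (ch k)) (f y) /\
    (fwd (fch (ch k)) (f y)).2 = (fwd (fch (ch k)) (f x)).2.
Proof.
move=> oU fU Lk Ux xk; pose c := fch (ch k).
have oV : open (U `&` f @^-1` dom c).
  by apply: open_preimage_on => //; [move=> y /fU[]|exact: open_fdom].
have [r r0 rH] := (open_nm _).1 oV x (conj Ux xk).
apply/nbhs_nm; exists r => // y yr; split; first by have [] := rH y yr.
apply: (countable_constant (f := snd \o fwd c \o f) (countable_transversals Lk)) yr.
move=> z /rH[Uz zc]; have [cz Lz] := fU z Uz; split.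
  apply: continuous_comp => //; apply: continuous_comp; last exact: cvg_snd.
  exact: atlas_chart_fwd_cont (fatlas (ch k)) zc.
by exists (f z).
Qed.

End LeafGeometry.

Arguments leaf_point {S M} h m0 v.

Lemma smooth_into_ext (K : numFieldType) (M : atlas K) (E : normedModType K)
    (U : set E) (f g : E -> M) :
  (forall x, U x -> f x = g x) -> smooth_into U f -> smooth_into U g.
Proof.
move=> fg [oU cf sf]; split=> //.
  move=> x Ux; rewrite /prop_for /continuous_at -(fg _ Ux).
  by apply: cvg_trans (cf x Ux); apply: near_eq_cvg; exact: open_nbhs_eq fg Ux.
move=> j; have UE : U `&` g @^-1` dom (chart_of j) = U `&` f @^-1` dom (chart_of j).
  by apply/seteqP; split=> x [Ux xj]; split=> //; move: xj; rewrite /preimage /mkset fg.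
have oW : open (U `&` f @^-1` dom (chart_of j)).
  by apply: open_preimage_on => //; exact: open_dom.
rewrite UE; apply: (smooth_on_ext oW) (sf j) => x [Ux _].
exact: (congr1 _ (fg x Ux)).
Qed.

Section Leaf.
Context {S : scalars} {M : atlas S} (h : tangent_bundle M -> M).
Hypothesis sepM : modelled_on_separable M.
Hypothesis alg_h : tangent_algebra h.
Variable ch : forall y, foliated h y.
Variable m0 : M.
Local Notation L := (accessible_set h m0).

Definition leaf_points := {z : M | L z}.
Implicit Types k : leaf_points.

(* Returns the irrelevant point [k] when [z] is off the leaf. *)
Definition to_leaf k (z : M) : leaf_points :=
  if pselect (L z) is left Lz then exist _ z Lz else k.

Lemma to_leafK k z : L z -> sval (to_leaf k z) = z.
Proof. by rewrite /to_leaf; case: pselect. Qed.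

Lemma leaf_points_inj : injective (@sval M L).
Proof. by move=> [x Lx] [y Ly] /= xy; exact: eq_exist. Qed.

Local Notation c k := (fch (ch (sval k))).

Definition plaque k (a : fE (ch (sval k))) : M := bwd (c k) (a, 0).

Lemma plaque_cod k (a : fE (ch (sval k))) :
  nm a < frad (ch (sval k)) -> cod (c k) (a, 0).
Proof. by move=> ar; rewrite fcodE; split=> //=; rewrite nm0 frad_gt0. Qed.

Lemma plaque_leaf k (a : fE (ch (sval k))) : nm a < frad (ch (sval k)) -> L (plaque a).
Proof.
move=> /plaque_cod ac; apply/(fplaque m0 ac) => /=.
by rewrite -(ffwd_center (ch (sval k))) fwdK; [exact: proj2_sig|exact: fdom_center].
Qed.

(** The leaf may meet the chart in countably many further plaques; only the one through [k] is
    kept. *)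
Definition plaque_dom k : set leaf_points :=
  [set z | dom (c k) (sval z) /\ (fwd (c k) (sval z)).2 = 0].

Definition plaque_cod_set k : set (fE (ch (sval k))) :=
  [set a | nm a < frad (ch (sval k))].
Arguments plaque_cod_set : clear implicits.

Definition plaque_fwd k (z : leaf_points) := (fwd (c k) (sval z)).1.

Definition plaque_bwd k (a : fE (ch (sval k))) := to_leaf k (plaque a).

Lemma plaque_fwdE k z : plaque_dom k z -> fwd (c k) (sval z) = (plaque_fwd k z, 0).
Proof. by move=> [_ <-]; rewrite -surjective_pairing. Qed.

Lemma plaque_fwd_cod k z : plaque_dom k z -> plaque_cod_set k (plaque_fwd k z).
Proof. by move=> [kz _]; have := fwd_cod kz; rewrite fcodE => -[]. Qed.

Lemma plaque_bwdE k (a : fE (ch (sval k))) : plaque_cod_set k a ->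
  sval (plaque_bwd a) = plaque a.
Proof. by move=> ar; rewrite to_leafK //; exact: plaque_leaf. Qed.

Lemma plaque_bwd_dom k (a : fE (ch (sval k))) : plaque_cod_set k a ->
  plaque_dom k (plaque_bwd a).
Proof.
move=> ar; have ac := plaque_cod ar; rewrite /plaque_dom /mkset plaque_bwdE //.
by split; [exact: bwd_dom|rewrite bwdK].
Qed.

Lemma plaque_fwdK k z : plaque_dom k z -> plaque_bwd (plaque_fwd k z) = z.
Proof.
move=> kz; apply: leaf_points_inj; rewrite plaque_bwdE; last exact: plaque_fwd_cod.
by rewrite /plaque -plaque_fwdE // fwdK //; case: kz.
Qed.

Lemma plaque_bwdK k (a : fE (ch (sval k))) : plaque_cod_set k a ->
  plaque_fwd k (plaque_bwd a) = a.
Proof.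
by move=> ar; rewrite /plaque_fwd plaque_bwdE // bwdK //; exact: plaque_cod.
Qed.

Lemma open_plaque_cod k : open (plaque_cod_set k).
Proof. exact: open_ball0. Qed.

Definition plaque_chart k : chart (fE (ch (sval k))) leaf_points :=
  Chart (@open_plaque_cod k) (@plaque_fwd_cod k) (@plaque_bwd_dom k)
    (@plaque_fwdK k) (@plaque_bwdK k).

Lemma plaque_center_dom k : dom (plaque_chart k) k.
Proof. by split; [exact: fdom_center|rewrite ffwd_center]. Qed.

Lemma plaque_smooth k : smooth_into (plaque_cod_set k) (@plaque k).
Proof.
apply: (smooth_into_comp (V := cod (c k)) (f := fun a => (a, 0))).
- exact: open_plaque_cod.
- apply: smooth_on_pair; [exact: open_plaque_cod| |exact: smooth_on_cst].
  by move=> n; apply: Ck_id; exact: open_plaque_cod.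
- by move=> a; exact: plaque_cod.
- exact: atlas_chart_bwd (fatlas _).
Qed.

Lemma near_plaque_dom (E : normedModType S) (U : set E) (f : E -> leaf_points) k x :
  open U -> (forall y, U y -> {for y, continuous (sval \o f : E -> M)}) -> U x ->
  plaque_dom k (f x) -> \forall y \near x, plaque_dom k (f y).
Proof.
move=> oU cf Ux [xk fx0].
have fU y : U y -> {for y, continuous (sval \o f : E -> M)} /\ L (sval (f y)).
  by move=> Uy; split; [exact: cf|exact: proj2_sig].
have := leaf_plaque sepM alg_h oU fU (proj2_sig k) Ux xk.
by apply: filterS => y [yk fy]; split=> //; rewrite -fx0.
Qed.

(** The overlap of two plaques is open by [leaf_plaque]; on it the transition is a component of a
    smooth map read in a foliated chart. *)
Lemma plaque_compat i j : smooth_transition (plaque_chart i) (plaque_chart j).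
Proof.
have [oi ci si] := plaque_smooth i.
have oU : open (plaque_cod_set i `&` @plaque_bwd i @^-1` plaque_dom j).
  rewrite openE => a [ai aj]; apply: filterI; first exact: open_nbhs_nbhs.
  apply: (near_plaque_dom (U := plaque_cod_set i)) => // b bi.
  rewrite /prop_for /continuous_at /= plaque_bwdE //.
  apply: cvg_trans (ci b bi); apply: near_eq_cvg.
  by apply: open_nbhs_eq oi _ bi => d di; rewrite /= plaque_bwdE.
split=> //; apply: (@smooth_on_ext _ _ _ _ (fst \o (fwd (c j) \o @plaque i))) => //.
  by move=> a [ai _]; rewrite /= /plaque_fwd plaque_bwdE.
apply: (@smooth_on_comp _ _ _ _ _ setT (fwd (c j) \o @plaque i) fst) => //.
  apply: smooth_on_sub (smooth_into_fwd (fatlas (ch (sval j))) (plaque_smooth i)).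
  by move=> a [ai [aj _]]; split=> //; rewrite /preimage /mkset -plaque_bwdE.
exact: smooth_on_fst.
Qed.

Definition leaf_atlas : atlas S :=
  @Atlas S leaf_points leaf_points (fun k => fE (ch (sval k))) plaque_chart id
    plaque_center_dom plaque_compat.

Definition leaf_inclusion (z : leaf_atlas) : M := sval z.

Lemma leaf_inclusion_smooth : smooth_map leaf_inclusion.
Proof.
apply: smooth_map_from_reps => k; apply: smooth_into_ext (plaque_smooth k) => a ar.
by rewrite /= /leaf_inclusion plaque_bwdE.
Qed.

Lemma plaque_chart_center k : fwd (plaque_chart k) k = 0.
Proof. by rewrite /= /plaque_fwd ffwd_center. Qed.

(** Continuity into [M] lifts to the finer leaf topology because nearby values stay in one plaque,
    where the leaf coordinate comes from a chart of [M]. *)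
Lemma leaf_valued_continuous (E : normedModType S) (U : set E) (f : E -> leaf_atlas) :
  open U -> (forall y, U y -> {for y, continuous (leaf_inclusion \o f)}) ->
  forall x, U x -> {for x, continuous f}.
Proof.
move=> oU cf x Ux A; rewrite nbhsE => -[B [oB Bx] BA].
change (nbhs x (f @^-1` A)); pose k : leaf_points := f x.
have xk : plaque_dom k (f x) by exact: plaque_center_dom.
have N1 := near_plaque_dom oU cf Ux xk.
have oP : open (plaque_cod_set k `&` @plaque_bwd k @^-1` B).
  exact: (@open_chart_preimage S leaf_atlas k B oB).
have cF : {for x, continuous (fst \o (fwd (c k) \o (leaf_inclusion \o f)))}.
  apply: continuous_comp; last exact: cvg_fst.
  apply: continuous_comp; first exact: cf.
  by apply: atlas_chart_fwd_cont (fatlas _) _; case: xk.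
have N2 : nbhs x ((fst \o (fwd (c k) \o (leaf_inclusion \o f))) @^-1`
    (plaque_cod_set k `&` @plaque_bwd k @^-1` B)).
  apply: cF; apply: open_nbhs_nbhs; split=> //; split; first exact: plaque_fwd_cod.
  by rewrite /preimage /mkset; have := plaque_fwdK xk => /= ->.
apply: filterS2 N1 N2 => y yk [_ yB]; apply: BA.
by rewrite -(plaque_fwdK yk).
Qed.

End Leaf.

(** * Topology of a leaf *)

Section LeafTopology.
Context {S : scalars} {M : atlas S} {h : tangent_bundle M -> M}.
Hypothesis hausM : hausdorff_space M.
Hypothesis paraM : paracompact M.
Hypothesis sepM : modelled_on_separable M.
Hypothesis alg_h : tangent_algebra h.
Variable ch : forall y, foliated h y.
Variable m0 : M.
Local Notation L := (accessible_set h m0).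
Local Notation leafM := (leaf_atlas sepM alg_h ch m0).
Local Notation incl := (@leaf_inclusion S M h sepM alg_h ch m0).
Local Notation c k := (fch (ch (sval k))).

Lemma leaf_inclusion_cont : continuous incl.
Proof. by move=> x; case: (@leaf_inclusion_smooth S M h sepM alg_h ch m0) => + _; exact. Qed.

Definition leaf_param (v : model (chart_at m0)) : leafM :=
  to_leaf (exist L m0 (accessible_refl alg_h m0)) (leaf_point h m0 v).

Lemma leaf_paramE v : incl (leaf_param v) = leaf_point h m0 v.
Proof. by rewrite /leaf_inclusion to_leafK // range_leaf_point; exists v. Qed.

Lemma leaf_param_surj z : exists v, leaf_param v = z.
Proof.
have : L (incl z) by exact: proj2_sig.
rewrite range_leaf_point => -[v _ vz]; exists v; apply: leaf_points_inj.
by rewrite -[LHS]/(incl _) leaf_paramE.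
Qed.

Lemma leaf_param_cont : continuous leaf_param.
Proof.
move=> x; apply: (@leaf_valued_continuous S M h sepM alg_h ch m0 _ setT) => //.
  exact: openT.
move=> v _; have -> : incl \o leaf_param = leaf_point h m0.
  by apply/funext => w; exact: leaf_paramE.
by have [_ cl _] := leaf_point_smooth alg_h m0; exact: cl.
Qed.

Lemma open_leaf_inclusion (A : set M) : open A -> open (incl @^-1` A).
Proof. by move=> oA; apply: open_comp => // x _; exact: leaf_inclusion_cont. Qed.

Lemma leaf_hausdorff : hausdorff_space leafM.
Proof.
rewrite open_hausdorff => x y xy.
have ixy : incl x != incl y.
  by apply: contra_neq xy => /leaf_points_inj.
have := hausM; rewrite open_hausdorff => /(_ _ _ ixy)[[A B] [/= Ax By] [oA oB AB]].
exists (incl @^-1` A, incl @^-1` B); split=> /=.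
- by move: Ax; rewrite !inE.
- by move: By; rewrite !inE.
- exact: open_leaf_inclusion.
- exact: open_leaf_inclusion.
- by rewrite -preimage_setI; move/eqP: AB => ->; rewrite preimage_set0 eqxx.
Qed.

(** A clopen set pulls back along the continuous surjection [leaf_param] to a clopen set of a normed
    space. *)
Lemma leaf_connected_space : connected [set: leafM].
Proof.
move=> B [b Bb] [C oC BC] [D cD BD].
rewrite setTI in BC; rewrite setTI in BD; subst B.
apply/seteqP; split=> // z _.
have [v vz] := leaf_param_surj z; have [w wb] := leaf_param_surj b.
have oA : open (leaf_param @^-1` C) by apply: open_comp => // x _; exact: leaf_param_cont.
have oA' : open (~` (leaf_param @^-1` C)).
  have oC' : open (~` C) by rewrite BD; exact: closed_openC.
  by rewrite preimage_setC; apply: open_comp => // x _; exact: leaf_param_cont.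
have := clopen_all oA oA' (a := w) v; rewrite /preimage /mkset vz wb.
by apply.
Qed.

Lemma leaf_lindelof (N : leafM -> set leafM) : (forall x, nbhs x (N x)) ->
  exists2 C : set leafM, countable C & forall x, exists2 d, C d & N d x.
Proof.
move=> NH; have sE : separable (model (chart_at m0)) by exact: sepM.
have [|C cC CH] := separable_lindelof (N := fun v => leaf_param @^-1` N (leaf_param v)) sE.
  by move=> v; exact: leaf_param_cont.
exists (leaf_param @` C); first exact: countable_image.
move=> x; have [v vx] := leaf_param_surj x; have [d Cd dx] := CH v.
by exists (leaf_param d); [exists d|move: dx; rewrite /preimage /mkset vx].
Qed.

(** The danger is a limit outside the chart domain. Such points lie in [V], while the closed plaque
    lies in [U]; inside the domain the continuity of the chart suffices. *)
Lemma closed_plaque k (rho : reals S) (U V : set M) :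
  open V -> ~` dom (c k) `<=` V -> U `&` V = set0 ->
  (forall a : fE (ch (sval k)), nm a <= rho -> U (bwd (c k) (a, 0))) ->
  closed [set z : leafM | plaque_dom ch k z /\ nm (plaque_fwd ch k z) <= rho].
Proof.
move=> oV CV UV aU; rewrite -openC openE => z nz.
have [kz|nkz] := pselect (dom (c k) (incl z)); last first.
  have oW : open (incl @^-1` V) by exact: open_leaf_inclusion.
  have Wz : (incl @^-1` V) z by exact: CV.
  apply: filterS (open_nbhs_nbhs (conj oW Wz)) => z' Vz' [kz' rz'].
  suff : (U `&` V) (incl z') by rewrite UV.
  split=> //; have := plaque_fwdE kz'; have [kz'' _] := kz' => E.
  by rewrite /leaf_inclusion -(fwdK kz'') E; exact: aU.
have cz : {for z, continuous (fwd (c k) \o incl)}.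
  apply: continuous_comp; first exact: leaf_inclusion_cont.
  exact: atlas_chart_fwd_cont (fatlas _) kz.
pose D := [set p : fE (ch (sval k)) * fF (ch (sval k)) | p.2 = 0 /\ nm p.1 <= rho].
have oD : open (~` D).
  apply/open_nm => -[a b] nD; rewrite /D /mkset /= in nD.
  have [b0|b0] := pselect (b = 0).
    have ar : rho < nm a by rewrite ltNge; apply/negP => ar; apply: nD.
    exists (nm a - rho); first by rewrite subr_gt0.
    move=> [a' b'] ab [/= _ a'r].
    have := le_lt_trans (nm_fst _) ab; have := nm_split a a'; rewrite nmC /=.
    by move: a'r ar; nlra.
  have nb : 0 < nm b by rewrite nm_gt0; exact/eqP.
  exists (nm b) => // -[a' b'] ab [/= b'0 _].
  have := le_lt_trans (nm_snd _) ab; rewrite /= b'0 sub0r nmN ltxx.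
  by [].
have Dz : (~` D) ((fwd (c k) \o incl) z).
  by move=> [z2 z1]; apply: nz; split.
have Nz : nbhs z ((fwd (c k) \o incl) @^-1` ~` D).
  exact: (cz _ (open_nbhs_nbhs (conj oD Dz))).
apply: filterS Nz => z' nD [kz' rz']; apply: nD; split=> //; exact: kz'.2.
Qed.

(** A small closed ball of the plaque through [x] is closed in the whole leaf once [M] separates [x]
    from the complement of the chart domain. *)
Lemma leaf_regular (x : leafM) (B : set leafM) : open B -> B x ->
  exists U, [/\ open U, U x & closure U `<=` B].
Proof.
move=> oB Bx; pose k : leaf_points h m0 := x; pose r := frad (ch (sval k)).
have r0 : 0 < r by exact: frad_gt0.
have clC : closed (~` dom (c k) : set M) by apply: open_closedC; exact: open_fdom.
have kC : ~ (~` dom (c k)) (sval k) by apply; exact: fdom_center.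
have [U [V [oU oV Uk CV UV]]] := paracompact_separation hausM paraM clC kC.
have [oP cP _] := plaque_smooth ch k.
have P0 : @plaque_cod_set S M h ch m0 k 0 by rewrite /plaque_cod_set /mkset nm0.
have plaque0 : @plaque S M h ch m0 k 0 = sval k.
  by rewrite /plaque -(ffwd_center (ch (sval k))) fwdK //; exact: fdom_center.
have N1 : nbhs (0 : fE (ch (sval k))) (@plaque S M h ch m0 k @^-1` U).
  by apply: (cP 0 P0); apply: open_nbhs_nbhs; rewrite plaque0.
have oQ : open (@plaque_cod_set S M h ch m0 k `&` @plaque_bwd S M h ch m0 k @^-1` B).
  exact: (@open_chart_preimage S leafM k B oB).
have k0 : plaque_bwd (0 : fE (ch (sval k))) = k.
  by apply: leaf_points_inj; rewrite plaque_bwdE.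
have N2 : nbhs (0 : fE (ch (sval k)))
    (@plaque_cod_set S M h ch m0 k `&` @plaque_bwd S M h ch m0 k @^-1` B).
  by apply: open_nbhs_nbhs; split=> //; split=> //; rewrite /preimage /mkset k0.
have [d d0 dH] := (nbhs_nm _ _).1 (filterI N1 N2).
pose rho := d / 2; have rho0 : 0 < rho by rewrite divr_gt0.
have rhod : rho < d by rewrite /rho ltr_pdivrMr // mulr_natr mulr2n ltrDl.
have aH (a : fE (ch (sval k))) : nm a <= rho -> [/\ U (plaque a), nm a < r & B (plaque_bwd a)].
  by move=> ar; have [|Ua [ra Ba]] := dH a; first by rewrite subr0; exact: le_lt_trans rhod.
pose K := [set z : leafM | plaque_dom ch k z /\ nm (plaque_fwd ch k z) <= rho].
have clK : closed K.
  apply: (closed_plaque (U := U) (V := V)) => //.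
  by move=> a /aH[].
exists (bwd (chart_of (a := leafM) k) @` [set a | nm a < rho]); split.
- apply: chart_open_image; first exact: open_ball0.
  by move=> a /= /ltW /aH[].
- by exists 0 => //=; rewrite nm0.
- have KB : K `<=` B.
    by move=> z [kz /aH[_ _]]; rewrite plaque_fwdK.
  apply: subset_trans KB; rewrite [X in _ `<=` X]((closure_id K).1 clK).
  apply: closureS => _ [a ar <-]; have [_ ak _] := aH a (ltW ar); split.
    exact: plaque_bwd_dom.
  by have -> := plaque_bwdK ak; exact: ltW.
Qed.

Lemma leaf_paracompact : paracompact leafM.
Proof. exact: regular_lindelof_paracompact leaf_regular leaf_lindelof. Qed.

End LeafTopology.

Section LeafInclusion.
Context {S : scalars} {M : manifold S} {h : tangent_bundle M -> M}.
Hypothesis sepM : modelled_on_separable M.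
Hypothesis alg_h : tangent_algebra h.
Variable ch : forall y, foliated h y.
Variable m0 : M.

Definition leaf_manifold : manifold S :=
  Manifold
    (@leaf_hausdorff S M h (@manifold_hausdorff S M) sepM alg_h ch m0)
    (@leaf_paracompact S M h (@manifold_hausdorff S M) (@manifold_paracompact S M)
      sepM alg_h ch m0).

Local Notation incl := (@leaf_inclusion S M h sepM alg_h ch m0 : leaf_manifold -> M).

Lemma range_leaf_inclusion : range incl = accessible_set h m0.
Proof.
apply/seteqP; split=> [_ [z _ <-]|z Lz]; first exact: proj2_sig.
by exists (exist _ z Lz).
Qed.

(** In the leaf chart at [s] the inclusion is the central plaque of the foliated chart at [s], whose
    derivative at 0 is described by [fincl]. *)
Lemma leaf_inclusion_tangent (s : leaf_manifold) :
  exists r : {linear tangent_space (incl s) -> tangent_space s},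
    [/\ continuous r, cancel (tangent_at incl s) r &
        range (tangent_at incl s) = induced_distribution h (incl s)].
Proof.
have [f [r [cr fr df fE]]] := fincl (ch (sval s)).
have E w : tangent_at incl s w = f w.
  have [_ H] : has_diff (fwd (chart_of (chart_at (incl s))) \o incl \o
      bwd (plaque_chart ch s)) 0 f.
    apply: (has_diff_near (U := plaque_cod_set (k := s))) df.
    - exact: open_plaque_cod.
    - by rewrite /plaque_cod_set /mkset nm0; exact: frad_gt0.
    - by move=> a ar; rewrite /= /leaf_inclusion plaque_bwdE.
  apply: etrans (H w); rewrite /tangent_at; congr ('d _ _ _).
  exact: plaque_chart_center.
exists r; split=> //; first by move=> w; rewrite E fr.
by rewrite -fE; apply/seteqP; split=> _ [w _ <-]; exists w.
Qed.

Lemma leaf_inclusion_initial : initial_submanifold incl.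
Proof.
split; first exact: leaf_points_inj.
- split; first exact: leaf_inclusion_smooth.
  by move=> s; have [r [cr rK _]] := leaf_inclusion_tangent s; exists r.
- move=> N f sf; apply: smooth_map_from_reps => i.
  have sg := smooth_into_rep i sf; have [oi ci _] := sg.
  have cf : forall x, cod (chart_of i) x -> {for x, continuous (f \o bwd (chart_of i))}.
    exact: (@leaf_valued_continuous S M h sepM alg_h ch m0 _ _ (f \o bwd (chart_of i))).
  split=> // k.
  have oW : open (cod (chart_of i) `&`
      (f \o bwd (chart_of i)) @^-1` dom (@chart_of S leaf_manifold k)).
    by apply: open_preimage_on => //; exact: open_dom.
  apply: (@smooth_on_comp _ _ _ _ _ setT
    (fwd (fch (ch (sval k))) \o (incl \o f \o bwd (chart_of i))) fst) => //.
    apply: smooth_on_sub (smooth_into_fwd (fatlas (ch (sval k))) sg).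
    by move=> x [xi [xk _]].
  exact: smooth_on_fst.
Qed.

End LeafInclusion.

(** * The foliation by accessible sets *)

Section AccessibleFoliation.
Context {S : scalars} {M : manifold S} {h : tangent_bundle M -> M}.
Hypothesis sepM : modelled_on_separable M.
Hypothesis alg_h : tangent_algebra h.
Variable ch : forall y, foliated h y.

(** Indexing by sets rather than by points makes distinct indices have disjoint leaves, as
    [partition] demands; a base point is then chosen for each set. *)
Definition accessible_index := {A : set M | exists x, A = accessible_set h x}.

Definition accessible_base (a : accessible_index) : M := sval (cid (proj2_sig a)).

Lemma accessible_baseE a : accessible_set h (accessible_base a) = sval a.
Proof. by rewrite /accessible_base; case: cid. Qed.

Definition accessible_leaf (a : accessible_index) : manifold S :=
  leaf_manifold sepM alg_h ch (accessible_base a).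

Definition accessible_incl (a : accessible_index) : accessible_leaf a -> M :=
  @leaf_inclusion S M h sepM alg_h ch (accessible_base a).

Lemma range_accessible_incl a : range (@accessible_incl a) = sval a.
Proof. by rewrite range_leaf_inclusion accessible_baseE. Qed.

Lemma accessible_partition :
  partition [set: accessible_index] (fun a => range (@accessible_incl a)) [set: M].
Proof.
split.
- apply/seteqP; split=> // x _.
  exists (exist _ (accessible_set h x) (ex_intro _ x erefl)) => //.
  by rewrite range_accessible_incl; exact: accessible_refl.
- move=> a b _ _ [z []]; rewrite !range_accessible_incl -!accessible_baseE.
  move=> /(accessible_eq alg_h) + /(accessible_eq alg_h); rewrite !accessible_baseE => ->.
  by case: a b => [A pA] [B pB] /= AB; exact: eq_exist.
- move=> a _; exists (accessible_base a); rewrite range_accessible_incl -accessible_baseE.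
  exact: accessible_refl.
Qed.

Lemma accessible_leaf_charts a (s : accessible_leaf a) :
  exists (E F : completeNormedModType S) (c : chart (E * F)%type M)
         (V : set E) (W : set F),
  [/\ atlas_chart c /\ dom c (accessible_incl s),
      [/\ cod c = V `*` W, nbhs 0 V & nbhs 0 W],
      toplinear_iso E (tangent_space s),
      fwd c (accessible_incl s) = (0, 0) &
      forall b, exists2 B, B `<=` W &
        fwd c @` (dom c `&` range (@accessible_incl b)) = V `*` B].
Proof.
pose y := accessible_incl s; pose k := ch y; pose r := frad k.
have r0 : 0 < r by exact: frad_gt0.
exists (fE k), (fF k), (fch k), [set v | nm v < r], [set w | nm w < r]; split.
- by split; [exact: fatlas|exact: fdom_center].
- split; first exact: fcodE.
    by apply: open_nbhs_nbhs; split; [exact: open_ball0|rewrite /mkset nm0].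
  by apply: open_nbhs_nbhs; split; [exact: open_ball0|rewrite /mkset nm0].
(* The leaf chart at [s] is modelled on [fE] of the foliated chart at [s], so the two spaces
   coincide by definition. *)
- by exists idfun, idfun; split=> // x; exact: cvg_id.
- exact: ffwd_center.
- move=> b; rewrite range_accessible_incl -accessible_baseE.
  set m := accessible_base b.
  exists [set w | nm w < r /\ accessible_set h m (bwd (fch k) (0, w))]; first by move=> w [].
  apply/seteqP; split=> [_ [z [zk mz] <-]|[v w] [/= vr [wr mw]]].
    have zc := fwd_cod zk; have := zc; rewrite fcodE => -[vr wr].
    by split=> //; split=> //; apply/(fplaque m zc); rewrite fwdK.
  have vwc : cod (fch k) (v, w) by rewrite fcodE.
  exists (bwd (fch k) (v, w)); last by rewrite bwdK.
  by split; [exact: bwd_dom|exact/(fplaque m vwc)].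
Qed.

Definition accessible_foliation : foliation M :=
  @Foliation S M accessible_index accessible_leaf accessible_incl
    (fun a => @leaf_connected_space S M h sepM alg_h ch (accessible_base a))
    (fun a => leaf_inclusion_initial sepM alg_h ch (accessible_base a))
    accessible_partition accessible_leaf_charts.

Lemma leaves_accessible : leaves accessible_foliation = range (accessible_set h).
Proof.
apply/seteqP; split=> [_ [a _ <-]|_ [x _ <-]].
  by rewrite [X in _ X](range_accessible_incl a) -accessible_baseE; exists (accessible_base a).
exists (exist _ (accessible_set h x) (ex_intro _ x erefl)) => //.
exact: range_accessible_incl.
Qed.

Lemma tangent_accessible y :
  tangent_distribution accessible_foliation y = induced_distribution h y.
Proof.
apply/seteqP; split=> [v [a [[s w] E]]|v].
  have [r [_ _ rE]] := @leaf_inclusion_tangent S M h sepM alg_h ch (accessible_base a) s.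
  (* The hypothesis is an equality of dependent pairs; a predicate on the whole bundle can be
     rewritten along it. *)
  pose D (p : tangent_bundle M) := induced_distribution h (projT1 p) (projT2 p).
  rewrite -[induced_distribution h y v]/(D (tangent_pt v)) -E /D /=.
  by rewrite -rE; exists w.
pose a : accessible_index := exist _ (accessible_set h y) (ex_intro _ y erefl).
have ay : accessible_set h (accessible_base a) y.
  by rewrite accessible_baseE; exact: accessible_refl.
pose s : accessible_leaf a := exist _ y ay.
have [r [_ _ rE]] := @leaf_inclusion_tangent S M h sepM alg_h ch (accessible_base a) s.
by rewrite -[y in X in X -> _]/(accessible_incl s) -rE => -[w _ <-]; exists a, (existT _ s w).
Qed.

End AccessibleFoliation.

Theorem theorem4p3p4 (K : numFieldType) (scalarsK : real_or_complex K)
    (M : manifold K) (sepM : modelled_on_separable M)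
    (h : tangent_bundle M -> M) (alg_h : tangent_algebra h)
    (tame_h : tame h) :
  (exists F : foliation M,
     leaves F = range (accessible_set h) /\
     forall x y : M, accessible_set h x y ->
       tangent_distribution F y = induced_distribution h y) /\
  integrable_distribution (induced_distribution h).
Proof.
have [S SK] := real_or_complex_scalars scalarsK; subst K.
(* Charts are only known to exist; putting this in existential form allows one to be chosen at every
   point, which fixes the atlases of all leaves. *)
have fol y : exists _ : foliated h y, True.
  by have [c] := foliated_exists alg_h tame_h y; exists c.
pose ch y := sval (cid (fol y)).
pose F := accessible_foliation sepM alg_h ch.
split; exists F; last by move=> x; exact: tangent_accessible.
by split; [exact: leaves_accessible|move=> x y _; exact: tangent_accessible].
Qed.
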